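(* Let $k$ be a field, $m\in\mathbb{N}$ not divisible by $\operatorname{char}(k)$, and $A$ an abelian variety over $k$. The pairing $$b_m\colon A_m(k)\times A_m^\vee(k)\to k^{\times}/ (k^\times)^m$$ satisfies the following for all $a,a_1,a_2\in A_m(k)$ and $a',a_1',a_2'\in A_m^\vee(k)$: (i) $b_m(a,a_1'+a_2')=b_m(a,a_1')\cdot b_m(a,a_2')$; (ii) $b_m(a_1+a_2,a')=b_m(a_1,a')\cdot b_m(a_2,a')$; (iii) $b_m(a,a')=e_m(a,a')\cdot b_m'(a',a)$, where $e_m$ is the Weil pairing.
   Context: $A^\vee$ is the dual abelian variety; $A_m(k)$ and $A_m^\vee(k)$ are the groups of $k$-rational $m$-torsion points of $A$ and $A^\vee$. Definition of $b_m$: given $a\in A_m(k)$ and $a'\in A_m^\vee(k)\subset\operatorname{Pic}(A)$, represent $a'$ by a divisor $D$ on $A$ whose support contains neither $a$ nor $0$, let $f$ be a rational function on $A$ with $\operatorname{div}(f)=m\cdot D$, and let $b_m(a,a')$ be the class of $f(a)/f(0)$ in $k^\times/(k^\times)^m$ (well-defined, i.e. independent of choices). Here divisors and functions are defined over $k$. The pairing $b_m'\colon A_m^\vee(k)\times A_m(k)\to k^\times/(k^\times)^m$ is obtained by the same construction for $A^\vee$ in place of $A$, using $(A^\vee)^\vee=A$. Weil pairing $e_m\colon A_m(k)\times A_m^\vee(k)\to\mu_m(k)$, where $\mu_m(k)\subset k^\times$ is the group of $m$th roots of unity in $k$: if $D$ is a divisor on $A$ representing $a'$ with support containing neither $a$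 nor $0$, $D'$ a divisor on $A^\vee$ representing $a\in A=(A^\vee)^\vee$ with support containing neither $a'$ nor $0$, and $f,f'$ are rational functions on $A$, $A^\vee$ with $\operatorname{div}(f)=mD$, $\operatorname{div}(f')=mD'$, then $$e_m(a,a')=\frac{f'(0)\cdot f(a)}{f(0)\cdot f'(a')}.$$ (This description agrees with the standard definition of the Weil pairing.) In (iii), $e_m(a,a')$ is regarded as an element of $k^\times/(k^\times)^m$. *)

(* Defs.v *)
From HB Require Import structures.
From mathcomp Require Import all_boot all_order all_algebra.
From mathcomp Require Import mpoly.
From Stdlib Require Import ClassicalEpsilon.

Set Implicit Arguments.
Unset Strict Implicit.
Unset Printing Implicit Defensive.

Import GRing.Theory.
Local Open Scope ring_scope.

(* Varieties over a field k, in the classical language: K is an algebraically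
   closed extension of k (an algebraic closure in the main theorem), a variety
   is the set of its K-points, given by homogeneous coordinate vectors, and
   "over k" means that everything is cut out by polynomials with coefficients
   in k.  Since the ideal of a variety has to be generated over k (see
   [defined_over]), these are the geometrically integral quasi-projective
   k-schemes.  All notions depend on the embedding iota : k -> K, so that the
   instance iota := idfun gives the same notions over K itself. *)

Definition points (K : fieldType) (n : nat) := 'rV[K]_n -> Prop.

Definition proj_eq (K : fieldType) n (x y : 'rV[K]_n) : Prop :=
  exists2 l : K, l != 0 & x = l *: y.

Section Segre.
Variable K : fieldType.
Variables n m : nat.

Definition seg (x : 'rV[K]_n) (y : 'rV[K]_m) : 'rV[K]_(n * m) :=
  mxvec (x^T *m y).

Definition segre (V : points K n) (W : points K m) : points K (n * m) :=
  fun z => exists x y, [/\ V x, W y & z = seg x y].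

(* The two projections, up to a scalar: a nonzero column, resp. row, of the
   rank one matrix x^T *m y. *)
Definition seg1 (z : 'rV[K]_(n * m)) : 'rV[K]_n :=
  if [pick j | col j (vec_mx z) != 0] is Some j then (col j (vec_mx z))^T
  else 0.

Definition seg2 (z : 'rV[K]_(n * m)) : 'rV[K]_m :=
  if [pick i | row i (vec_mx z) != 0] is Some i then row i (vec_mx z) else 0.

End Segre.

Section OverField.
Variables (k K : fieldType) (iota : {rmorphism k -> K}).

Definition ev n (p : {mpoly k[n]}) (x : 'rV[K]_n) : K := mmap iota (x 0) p.

Definition homogeneous n (p : {mpoly k[n]}) : Prop := exists d, p \is d.-homog.

Definition rational_point n (x : 'rV[K]_n) : Prop :=
  exists x0 : 'rV[k]_n, proj_eq x (map_mx iota x0).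

Definition closed_over n (V : points K n) : Prop :=
  exists2 s : seq {mpoly k[n]}, (forall p, p \in s -> homogeneous p) &
    forall x, V x <-> (x != 0 /\ forall p, p \in s -> ev p x = 0).

Definition locally_closed_over n (V : points K n) : Prop :=
  exists s t : seq {mpoly k[n]},
    (forall p, p \in s ++ t -> homogeneous p) /\
    forall x, V x <->
      [/\ x != 0, forall p, p \in s -> ev p x = 0
        & exists2 q, q \in t & ev q x != 0].

Definition irreducible_points n (V : points K n) : Prop :=
  (exists x, V x) /\
  forall (d e : nat) (p q : {mpoly K[n]}),
    p \is d.-homog -> q \is e.-homog ->
    (forall x, V x -> p.@[x 0] * q.@[x 0] = 0) ->
    (forall x, V x -> p.@[x 0] = 0) \/ (forall x, V x -> q.@[x 0] = 0).

(* The homogeneous ideal of V in K[X] is spanned over K by polynomials with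
   coefficients in k. *)
Definition defined_over n (V : points K n) : Prop :=
  forall (d : nat) (p : {mpoly K[n]}), p \is d.-homog ->
    (forall x, V x -> p.@[x 0] = 0) ->
    exists2 s : seq (K * {mpoly k[n]}),
      (forall u, u \in s -> forall x, V x -> ev u.2 x = 0) &
      p = \sum_(u <- s) u.1 *: map_mpoly iota u.2.

Definition projective_variety n (V : points K n) : Prop :=
  [/\ closed_over V, irreducible_points V & defined_over V].

Definition quasi_projective_variety n (V : points K n) : Prop :=
  [/\ locally_closed_over V, irreducible_points V & defined_over V].

(* Morphisms act on coordinate vectors; only their values up to a scalar
   matter. *)
Definition morphism n m (V : points K n) (W : points K m)
    (phi : 'rV[K]_n -> 'rV[K]_m) : Prop :=
  forall x, V x -> W (phi x) /\
    exists (d : nat) (F : 'I_m -> {mpoly k[n]}),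
      [/\ forall i, F i \is d.-homog,
          \row_i ev (F i) x != 0
        & forall y, V y -> \row_i ev (F i) y != 0 ->
            proj_eq (phi y) (\row_i ev (F i) y)].

(* Nonzero rational functions over k: fractions of homogeneous polynomials of
    the same degree, neither of which vanishes identically on V *)

Definition rfun n : Type := ({mpoly k[n]} * {mpoly k[n]})%type.

Definition rat_fun n (V : points K n) (f : rfun n) : Prop :=
  [/\ exists d, f.1 \is d.-homog /\ f.2 \is d.-homog,
      exists2 x, V x & ev f.1 x != 0
    & exists2 x, V x & ev f.2 x != 0].

Definition rf_eq n (V : points K n) (f g : rfun n) : Prop :=
  forall x, V x -> ev f.1 x * ev g.2 x = ev g.1 x * ev f.2 x.

Definition rf1 n : rfun n := (1, 1).
Definition rf_mul n (f g : rfun n) : rfun n := (f.1 * g.1, f.2 * g.2).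
Definition rf_div n (f g : rfun n) : rfun n := (f.1 * g.2, f.2 * g.1).
Definition rf_exp n (f : rfun n) (m : nat) : rfun n := (f.1 ^+ m, f.2 ^+ m).

(* f is a unit of the local ring of V at x, with value c (necessarily c != 0) *)
Definition unit_value n (V : points K n) (f : rfun n) (x : 'rV[K]_n) (c : K) :
    Prop :=
  rat_fun V f /\
  exists g, [/\ rat_fun V g, rf_eq V f g, ev g.1 x != 0, ev g.2 x != 0
              & c = ev g.1 x / ev g.2 x].

Definition unit_at n (V : points K n) (f : rfun n) (x : 'rV[K]_n) : Prop :=
  exists c, unit_value V f x c.

(* Divisors over k.  They are given by a local equation at every point of V
    (Cartier divisors; on a smooth variety these are the same as Weil
    divisors), and are equal when their local equations differ by units. *)

Definition divisor n : Type := 'rV[K]_n -> rfun n.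

Definition is_divisor n (V : points K n) (D : divisor n) : Prop :=
  (forall x, V x -> rat_fun V (D x)) /\
  forall x, V x -> exists h : {mpoly k[n]},
    [/\ homogeneous h, ev h x != 0
      & forall y, V y -> ev h y != 0 -> unit_at V (rf_div (D y) (D x)) y].

Definition div_eq n (V : points K n) (D E : divisor n) : Prop :=
  forall x, V x -> unit_at V (rf_div (D x) (E x)) x.

Definition div0 n : divisor n := fun _ => rf1 n.
Definition div_add n (D E : divisor n) : divisor n :=
  fun x => rf_mul (D x) (E x).
Definition div_sub n (D E : divisor n) : divisor n :=
  fun x => rf_div (D x) (E x).
Definition div_muln n (D : divisor n) (m : nat) : divisor n :=
  fun x => rf_exp (D x) m.
Definition div_of n (f : rfun n) : divisor n := fun _ => f.

Definition avoids n (V : points K n) (D : divisor n) (x : 'rV[K]_n) : Prop :=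
  unit_at V (D x) x.

Definition lin_equiv n (V : points K n) (D E : divisor n) : Prop :=
  exists2 h, rat_fun V h & div_eq V D (div_add E (div_of h)).

(* g = f \o phi as rational functions on V.  It is enough to compare values
   at the points over which f is a unit, but there has to be one. *)
Definition rf_comp n m (V : points K n) (X : points K m)
    (phi : 'rV[K]_n -> 'rV[K]_m) (f : rfun m) (g : rfun n) : Prop :=
  [/\ rat_fun V g,
      exists x c, V x /\ unit_value X f (phi x) c
    & forall x c, V x -> unit_value X f (phi x) c -> unit_value V g x c].

(* D is the pullback of the divisor E; this includes that phi(V) is not
   contained in the support of E. *)
Definition div_pullback n m (V : points K n) (X : points K m)
    (phi : 'rV[K]_n -> 'rV[K]_m) (E : divisor m) (D : divisor n) : Prop :=
  forall x, V x ->
    exists2 g, rf_comp V X phi (E (phi x)) g & unit_at V (rf_div (D x) g) x.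

(* D lies in the pullback of the class of E, i.e. O(D) = phi^* O(E) in
   Pic(V). *)
Definition class_pullback n m (V : points K n) (X : points K m)
    (phi : 'rV[K]_n -> 'rV[K]_m) (E : divisor m) (D : divisor n) : Prop :=
  is_divisor V D /\
  exists E' D',
    [/\ is_divisor X E', lin_equiv X E' E, is_divisor V D',
        div_pullback V X phi E' D' & lin_equiv V D' D].

End OverField.

Definition div_base_change (k k' K : fieldType) (j : {rmorphism k -> k'}) n
    (D : divisor k K n) : divisor k' K n :=
  fun x => (map_mpoly j (D x).1, map_mpoly j (D x).2).

Record group_data (K : fieldType) (n : nat) := GroupData {
  carrier :> points K n;
  zero_pt : 'rV[K]_n;
  mul_map : 'rV[K]_(n * n) -> 'rV[K]_n;
  opp_map : 'rV[K]_n -> 'rV[K]_n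
}.

Definition add_pt (K : fieldType) n (G : group_data K n) (x y : 'rV[K]_n) :=
  mul_map G (seg x y).

Definition abelian_variety (k K : fieldType) (iota : {rmorphism k -> K}) n
    (A : group_data K n) : Prop :=
  projective_variety iota A /\
  (carrier A (zero_pt A) /\ rational_point iota (zero_pt A)) /\
  (morphism iota (segre A A) A (mul_map A) /\
   morphism iota A A (opp_map A)) /\
  [/\ forall x y z, carrier A x -> carrier A y -> carrier A z ->
        proj_eq (add_pt A (add_pt A x y) z) (add_pt A x (add_pt A y z)),
      forall x, carrier A x -> proj_eq (add_pt A (zero_pt A) x) x
    & forall x, carrier A x -> proj_eq (add_pt A (opp_map A x) x) (zero_pt A)].

(* A_m(k) *)
Definition torsion_point (k K : fieldType) (iota : {rmorphism k -> K}) n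
    (A : group_data K n) (m : nat) (a : 'rV[K]_n) : Prop :=
  [/\ carrier A a, rational_point iota a
    & proj_eq (iter m (add_pt A a) (zero_pt A)) (zero_pt A)].

(* The class of D lies in Pic^0(A_K): t_a^* D ~ D for all a in A(K). *)
Definition in_pic0 (K : fieldType) n (A : group_data K n)
    (D : divisor K K n) : Prop :=
  forall a, carrier A a ->
    class_pullback (idfun : {rmorphism K -> K}) A A
      (fun x => add_pt A x a) D D.

(* L on A x T is a family of elements of Pic^0(A) parametrised by T: its
   restrictions to the fibres A x {t} are in Pic^0, and its restriction to
   {0} x T is trivial. *)
Definition pic0_family (k K : fieldType) (iota : {rmorphism k -> K}) n t
    (A : group_data K n) (T : points K t) (L : divisor k K (n * t)) : Prop :=
  [/\ is_divisor iota (segre A T) L,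
      forall y, T y -> exists2 D : divisor K K n,
        class_pullback (idfun : {rmorphism K -> K}) A (segre A T)
          (fun x => seg x y) (div_base_change iota L) D
        & in_pic0 A D
    & class_pullback iota T (segre A T) (fun y => seg (zero_pt A) y) L
        (@div0 k K t)].

(* B represents the functor of families of elements of Pic^0(A), with P as
   Poincare divisor (class) on A x B.  The universal property
   is required for varieties T over every field k' between k and K. *)
Definition dual_abelian_variety (k K : fieldType) (iota : {rmorphism k -> K})
    n n' (A : group_data K n) (B : group_data K n')
    (P : divisor k K (n * n')) : Prop :=
  [/\ abelian_variety iota B,
      pic0_family iota A B P,
      forall (k' : fieldType) (j : {rmorphism k -> k'})
          (iota' : {rmorphism k' -> K}),
        (forall c, iota' (j c) = iota c) ->
        forall (t : nat) (T : points K t) (L : divisor k' K (n * t)),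
        quasi_projective_variety iota' T ->
        pic0_family iota' A T L ->
        let classifies alpha :=
          morphism iota' T B alpha /\
          class_pullback iota' (segre A T) (segre A B)
            (fun z => seg (seg1 z) (alpha (seg2 z))) (div_base_change j P) L in
        exists2 alpha, classifies alpha &
          forall beta, classifies beta -> forall y, T y ->
            proj_eq (beta y) (alpha y)
    & (* b |-> P|_{A x b} is a group morphism to Pic^0(A_K) *)
      forall (b1 b2 : 'rV[K]_n') (D1 D2 : divisor K K n),
        let restricts b D :=
          class_pullback (idfun : {rmorphism K -> K}) A (segre A B)
            (fun x => seg x b) (div_base_change iota P) D in
        carrier B b1 -> carrier B b2 -> restricts b1 D1 -> restricts b2 D2 ->
        restricts (add_pt B b1 b2) (div_add D1 D2)].

(* Elements of k^* / (k^* )^m are given by representatives. *)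

Definition eq_mod_powers (k : fieldType) (m : nat) (x y : k) : Prop :=
  [/\ x != 0, y != 0 & exists2 u : k, u != 0 & x = y * u ^+ m].

Section Pairings.
Variables (k K : fieldType) (iota : {rmorphism k -> K}) (m : nat).

Definition ratio_value n (V : points K n) (f : rfun k n) (x o : 'rV[K]_n)
    (r : k) : Prop :=
  exists c c0 : k, [/\ unit_value iota V f x (iota c),
                       unit_value iota V f o (iota c0) & r = c / c0].

(* r = f(a) / f(0) with div(f) = m D, where D represents the pullback along s
   of the class of P on X. *)
Definition b_value n l (G : group_data K n) (X : points K l)
    (P : divisor k K l) (s : 'rV[K]_n -> 'rV[K]_l) (a : 'rV[K]_n) (r : k) :
    Prop :=
  exists (D : divisor k K n) (f : rfun k n),
    [/\ class_pullback iota G X s P D,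
        avoids iota G D a /\ avoids iota G D (zero_pt G),
        rat_fun iota G f,
        div_eq iota G (div_of f) (div_muln D m)
      & ratio_value G f a (zero_pt G) r].

Variables (n n' : nat) (A : group_data K n) (B : group_data K n').
Variable P : divisor k K (n * n').

(* a' in B(k) is the class of the restriction of P to A x {a'}. *)
Definition b_pairing (a : 'rV[K]_n) (a' : 'rV[K]_n') : k :=
  epsilon (inhabits 1) (b_value A (segre A B) P (fun x => seg x a') a).

(* The identification of A with the dual of B sends a to the class of the
   restriction of P to {a} x B. *)
Definition b'_pairing (a' : 'rV[K]_n') (a : 'rV[K]_n) : k :=
  epsilon (inhabits 1) (b_value B (segre A B) P (fun y => seg a y) a').

(* The Weil pairing (f'(0) f(a)) / (f(0) f'(a')).  For this to be well defined
   in k^*, and not only up to m-th powers, the divisors D and D' representing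
   a' and a have to be taken from one divisor E in the Poincare class:
   D = E|_{A x a'} - E|_{A x 0} and D' = E|_{a x B} - E|_{0 x B}
   (the restrictions to A x 0 and 0 x B are principal).  The support of E has
   to avoid the four points at which E is evaluated; otherwise changing E may
   change the value by an m-th power. *)
Definition weil_value (a : 'rV[K]_n) (a' : 'rV[K]_n') (e : k) : Prop :=
  let o := zero_pt A in
  let o' := zero_pt B in
  exists (E : divisor k K (n * n')) (D1 D0 : divisor k K n)
      (D1' D0' : divisor k K n') (f : rfun k n) (f' : rfun k n') (r r' : k),
    [/\ is_divisor iota (segre A B) E /\ lin_equiv iota (segre A B) E P,
        [/\ avoids iota (segre A B) E (seg a a'),
            avoids iota (segre A B) E (seg a o'),
            avoids iota (segre A B) E (seg o a')
          & avoids iota (segre A B) E (seg o o')],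
        [/\ div_pullback iota A (segre A B) (fun x => seg x a') E D1,
            div_pullback iota A (segre A B) (fun x => seg x o') E D0,
            div_pullback iota B (segre A B) (fun y => seg a y) E D1'
          & div_pullback iota B (segre A B) (fun y => seg o y) E D0'],
        [/\ rat_fun iota A f,
            div_eq iota A (div_of f) (div_muln (div_sub D1 D0) m),
            rat_fun iota B f'
          & div_eq iota B (div_of f') (div_muln (div_sub D1' D0') m)]
      & [/\ ratio_value A f a o r, ratio_value B f' a' o' r' & e = r / r']].

Definition weil_pairing (a : 'rV[K]_n) (a' : 'rV[K]_n') : k :=
  epsilon (inhabits 1) (weil_value a a').

End Pairings.

(* Main.v *)
Require Import Defs.
From HB Require Import structures.
From mathcomp Require Import all_boot all_order all_algebra.
From mathcomp Require Import mpoly ring zify.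
From mathcomp Require classical_sets.
From Stdlib Require Import ClassicalEpsilon FunctionalExtensionality.

(** Both sides of (iii) are built from one divisor E in the Poincare class that
    avoids four points: f(a)/f(0) and f'(a')/f'(0) are then values of b_m(a,a')
    and b_m'(a',a), and e_m(a,a') is their quotient. For (i) and (ii), two
    functions with divisors m D1 and m D2, D1 = D2 + div h, satisfy
    f1 = c f2 h^m, since a global unit on a projective variety is constant; (i)
    applies this to D_{a1'+a2'} ~ D_{a1'} + D_{a2'}, and (ii) to f(x + a2),
    whose divisor is m times a translate of D, linearly equivalent to D as
    D lies in Pic^0. Linear equivalences are known over K only; they descend
    to k by applying a k-linear form K -> k to the coefficients of a section.
    That P|a x A' is m-torsion comes from the universal property in place of
    the seesaw theorem: (t_a x 1)^* P - pr_2^* (P|a x A') has the same fibres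
    over A' as P, so it is classified by the identity. *)

Import GRing.Theory.
Local Open Scope ring_scope.
Set Implicit Arguments.
Unset Strict Implicit.
Unset Printing Implicit Defensive.

(** * Linear forms on a field extension *)

(** Three obstacles shape the proof. The Pic^0 condition and the additivity of the Poincare class
    are given over K, while b_m asks for divisors and functions over k; so every linear equivalence
    is found over K and then descended. Secondly, k may be finite, so there are no hyperplanes in
    general position: divisors are moved off finitely many rational points by explicit forms, with
    powers equalising the degrees. Finally, the two variables are not symmetric: additivity of the
    class in a' belongs to the data of the dual, whereas additivity in a has to be deduced, and even
    the existence of a value of b_m'(a',a) depends on it.

    The Nullstellensatz serves one purpose: a rational function that is regular where a form w is
    nonzero can be written with a power of w as denominator. This yields both the constancy of
    global regular functions and a denominator over k for a function over K. As the pairings are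
    picked by [epsilon], each of them needs the existence of a value and its independence of the
    choices. *)

Definition linear_form (k K : fieldType) (iota : k -> K) (lam : K -> k) :=
  (forall x y, lam (x + y) = lam x + lam y) /\
  (forall a x, lam (iota a * x) = a * lam x).

Definition subspace_over (k K : fieldType) (iota : k -> K) (U : K -> Prop) :=
  [/\ U 0, forall x y, U x -> U y -> U (x + y)
    & forall a x, U x -> U (iota a * x)].

(* A subspace maximal among those that contain U and not c0 is a hyperplane
   complementary to the line spanned by c0. *)
Lemma linear_form_separates (k K : fieldType) (iota : {rmorphism k -> K})
    (U : K -> Prop) (c0 : K) :
  subspace_over iota U -> ~ U c0 ->
  exists lam, [/\ linear_form iota lam, lam c0 = 1 & forall u, U u -> lam u = 0].
Proof.
move=> [U0 UD UZ] Uc0.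
(* The empty predicate counts as good because Zorn's lemma is applied to all chains, and the empty
   chain has an empty union. *)
pose good (W : K -> Prop) :=
  (forall x, ~ W x) \/ [/\ subspace_over iota W, (forall u, U u -> W u) & ~ W c0].
have [F FP Ftot|W [[Wempty|[[W0 WD WZ] UW Wc0]] Wmax]] :=
  @classical_sets.Zorn_bigcup K good.
- have [[B [FB [b Bb]]]|noB] := excluded_middle_informative
    (exists B, F B /\ exists b, B b); last first.
    by left => x [B FB Bx]; apply: noB; exists B; split => //; exists x.
  right; have sub X x : F X -> X x ->
      [/\ subspace_over iota X, forall u, U u -> X u & ~ X c0].
    by move=> /FP [/(_ x)|].
  split; [split|..].
  + by exists B => //; have [[]] := sub _ _ FB Bb.
  + move=> x y [X FX Xx] [Y FY Yy].
    have [[_ XD _] _ _] := sub _ _ FX Xx; have [[_ YD _] _ _] := sub _ _ FY Yy.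
    have [XY|YX] := Ftot X Y FX FY.
      by exists Y => //; apply: YD => //; apply: XY.
    by exists X => //; apply: XD => //; apply: YX.
  + move=> a x [X FX Xx]; exists X => //.
    by have [[_ _ XZ] _ _] := sub _ _ FX Xx; apply: XZ.
  + by move=> u Uu; exists B => //; have [_ BU _] := sub _ _ FB Bb; apply: BU.
  + by move=> [X FX Xx]; have [_ _] := sub _ _ FX Xx.
- exfalso; apply: (Wmax U); last by right.
  by split=> [x /Wempty //|sub]; apply: (Wempty 0); apply: sub.
have WN x : W x -> W (- x) by move=> /(WZ (-1)); rewrite rmorphN1 mulN1r.
(* Maximality gives K = W + k c0. Otherwise W + k z would be larger and still avoid c0, since c0 = w
   + a z with a nonzero puts z - a^-1 c0 into W. *)
have dec z : exists a, W (z - iota a * c0).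
  have [Wz|nWz] := excluded_middle_informative (W z).
    by exists 0; rewrite rmorph0 mul0r subr0.
  have [//|nex] := excluded_middle_informative (exists a, W (z - iota a * c0)).
  exfalso.
  apply: (Wmax (fun x => exists w a, W w /\ x = w + iota a * z)).
    split=> [x Wx|sub]; first by exists x, 0; rewrite rmorph0 mul0r addr0.
    by apply: nWz; apply: sub; exists 0, 1; rewrite rmorph1 mul1r add0r.
  right; split; [split|..].
  - by exists 0, 0; rewrite rmorph0 mul0r addr0.
  - move=> _ _ [w [a [Ww ->]]] [w' [a' [Ww' ->]]].
    by exists (w + w'), (a + a'); split; [apply: WD | rewrite rmorphD; ring].
  - move=> b _ [w [a [Ww ->]]].
    by exists (iota b * w), (b * a); split; [apply: WZ | rewrite rmorphM; ring].
  - by move=> u /UW Wu; exists u, 0; rewrite rmorph0 mul0r addr0.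
  - move=> [w [a [Ww Dc0]]]; have [a0|a0] := eqVneq a 0.
      by apply: Wc0; rewrite Dc0 a0 rmorph0 mul0r addr0.
    apply: nex; exists a^-1; rewrite Dc0 mulrDr fmorphV mulKf ?fmorph_eq0 //.
    rewrite opprD addrC addrNK -fmorphV; exact/WN/WZ.
pose lam z := proj1_sig (constructive_indefinite_description _ (dec z)).
have lamP z : W (z - iota (lam z) * c0).
  by rewrite /lam; case: constructive_indefinite_description.
have lamE z a : W (z - iota a * c0) -> lam z = a.
  move=> Wa; apply/eqP; rewrite -subr_eq0; apply/negPn/negP => ne0; apply: Wc0.
  have /(WZ (lam z - a)^-1) := WD _ _ Wa (WN _ (lamP z)).
  suff -> : z - iota a * c0 - (z - iota (lam z) * c0) = iota (lam z - a) * c0.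
    by rewrite fmorphV mulKf ?fmorph_eq0.
  by rewrite rmorphB; ring.
exists lam; split; [split|..].
- move=> x y; apply: lamE.
  have -> : x + y - iota (lam x + lam y) * c0 =
    x - iota (lam x) * c0 + (y - iota (lam y) * c0) by rewrite rmorphD; ring.
  exact: WD.
- move=> a x; apply: lamE.
  have -> : iota a * x - iota (a * lam x) * c0 = iota a * (x - iota (lam x) * c0).
    by rewrite rmorphM; ring.
  exact: WZ.
- by apply: lamE; rewrite rmorph1 mul1r subrr.
- by move=> u Uu; apply: lamE; rewrite rmorph0 mul0r subr0; apply: UW.
Qed.

(** * Weak Nullstellensatz *)

Definition is_ideal (R : comNzRingType) (J : R -> Prop) :=
  [/\ J 0, forall x y, J x -> J y -> J (x + y) & forall a x, J x -> J (a * x)].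

(** Descent on the size: a nonzero element of J that fails to divide some p in J is replaced by the
    remainder of p, which lies in J and is smaller. *)
Lemma poly_ideal_principal (F : fieldType) (J : {poly F} -> Prop) :
  is_ideal J -> exists2 g, J g & forall p, J p -> g %| p.
Proof.
move=> [J0 JD JM].
have main N : forall g, J g -> g != 0 -> (size g <= N)%N ->
    exists2 g, J g & forall p, J p -> g %| p.
  elim: N => [|N IH] g Jg g0 szg.
    by rewrite leqn0 size_poly_eq0 (negPf g0) in szg.
  have [[p [Jp ndvd]]|nex] := excluded_middle_informative
    (exists p, J p /\ ~~ (g %| p)); last first.
    by exists g => // p Jp; apply/negPn/negP => nd; apply: nex; exists p.
  apply: (IH (p %% g)).
  - have -> : p %% g = p + (- (p %/ g)) * g by rewrite {2}(divp_eq p g); ring.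
    by apply: JD => //; apply: JM.
  - by rewrite /dvdp in ndvd.
  - by rewrite -ltnS; apply: leq_trans szg; rewrite ltn_modp.
have [[g [Jg g0]]|nex] := excluded_middle_informative (exists g, J g /\ g != 0).
  exact: main Jg g0 (leqnn _).
exists 0 => // p Jp; have [-> //|p0] := eqVneq p 0.
by exfalso; apply: nex; exists p.
Qed.

(** Both leading coefficients survive [f], so the sizes, and with them the shape of the Sylvester
    matrix, are preserved; the determinant can then be mapped entrywise. *)
Lemma map_resultant_rmorphism (R S : nzRingType) (f : {rmorphism R -> S})
    (p q : {poly R}) :
  f (lead_coef p) != 0 -> f (lead_coef q) != 0 ->
  f (resultant p q) = resultant (map_poly f p) (map_poly f q).
Proof.
move=> nz_fp nz_fq; rewrite /resultant /Sylvester_mx !size_map_poly_id0 //.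
rewrite -det_map_mx /= map_col_mx; congr (\det (col_mx _ _));
  by apply: map_lin1_mx => v; rewrite map_poly_rV rmorphM /= map_rVpoly.
Qed.

Lemma mpoly_rmorphism_ext (n : nat) (R S : comNzRingType)
    (f g : {rmorphism {mpoly R[n]} -> S}) :
  (forall c, f c%:MP = g c%:MP) -> (forall i, f 'X_i = g 'X_i) -> f =1 g.
Proof.
move=> fgC fgX p; rewrite (mpolyE p) !rmorph_sum; apply: eq_bigr => m _.
rewrite -mul_mpolyC !rmorphM fgC mpolyXE_id !rmorph_prod; congr (_ * _).
by apply: eq_bigr => i _; rewrite !rmorphXn fgX.
Qed.

Lemma meval_homog (R : comNzRingType) n d (p : {mpoly R[n]}) (v : 'I_n -> R) l :
  p \is d.-homog -> p.@[fun i => l * v i] = l ^+ d * p.@[v].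
Proof.
move=> hp; rewrite !mevalE mulr_sumr big_seq [RHS]big_seq.
apply: eq_bigr => m mp; have <- : mdeg m = d := dhomog_mf hp mp.
rewrite mulrCA; congr (_ * _).
rewrite mdegE -prodrXr -big_split /=.
by apply: eq_bigr => i _; rewrite exprMn.
Qed.

Section SlantedVariable.
Variables (K : fieldType) (n : nat) (c : 'I_n -> K).

(* The change of variables X_j -> X_j + c_j T, X_max -> T. *)
Definition slant_var (i : 'I_n.+1) : {poly {mpoly K[n]}} :=
  if unlift ord_max i is Some j then ('X_j)%:P + (c j)%:MP%:P * 'X else 'X.

Definition slant : {mpoly K[n.+1]} -> {poly {mpoly K[n]}} :=
  mmap (polyC \o @mpolyC n K) slant_var.
HB.instance Definition _ := GRing.RMorphism.on slant.

Definition unslant_coef : {mpoly K[n]} -> {mpoly K[n.+1]} :=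
  mmap (@mpolyC n.+1 K) (fun j => 'X_(lift ord_max j) - (c j)%:MP * 'X_ord_max).
HB.instance Definition _ := GRing.RMorphism.on unslant_coef.

Definition unslant : {poly {mpoly K[n]}} -> {mpoly K[n.+1]} :=
  horner_eval 'X_ord_max \o map_poly unslant_coef.
HB.instance Definition _ := GRing.RMorphism.on unslant.

Definition slant_pt (v : 'I_n -> K) (t : K) (i : 'I_n.+1) : K :=
  if unlift ord_max i is Some j then v j + c j * t else t.

Lemma slantX i : slant 'X_i = slant_var i.
Proof. by rewrite /slant mmapX mmap1U. Qed.

Lemma slantC a : slant a%:MP = a%:MP%:P.
Proof. by rewrite /slant mmapC. Qed.

Lemma unslantC p : unslant p%:P = unslant_coef p.
Proof. by rewrite /unslant /= map_polyC horner_evalE hornerC. Qed.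

Lemma unslantX : unslant 'X = 'X_ord_max.
Proof. by rewrite /unslant /= map_polyX horner_evalE hornerX. Qed.

Lemma unslant_coefC a : unslant_coef a%:MP = a%:MP.
Proof. by rewrite /unslant_coef mmapC. Qed.

Lemma unslant_coefX j :
  unslant_coef 'X_j = 'X_(lift ord_max j) - (c j)%:MP * 'X_ord_max.
Proof. by rewrite /unslant_coef mmapX mmap1U. Qed.

Lemma slantD p q : slant (p + q) = slant p + slant q.
Proof. exact: mmapD. Qed.

Lemma slantB p q : slant (p - q) = slant p - slant q.
Proof. exact: mmapB. Qed.

Lemma slantM p q : slant (p * q) = slant p * slant q.
Proof. exact: (rmorphM slant). Qed.

Lemma slant1 : slant 1 = 1.
Proof. exact: (rmorph1 slant). Qed.

Lemma slantK : cancel slant unslant.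
Proof.
apply: (@mpoly_rmorphism_ext _ _ _ (unslant \o slant) idfun) => [a|i] /=.
  by rewrite slantC unslantC unslant_coefC.
rewrite slantX /slant_var; case: unliftP => [j|] ->; last by rewrite unslantX.
by rewrite rmorphD rmorphM /= !unslantC unslantX unslant_coefX unslant_coefC; ring.
Qed.

Lemma meval_slant (v : 'I_n -> K) t p :
  p.@[slant_pt v t] = (map_poly (meval v) (slant p)).[t].
Proof.
apply: (@mpoly_rmorphism_ext _ _ _ (meval (slant_pt v t))
  (horner_eval t \o (map_poly (meval v) \o slant))) => [a|i] /=.
  by rewrite slantC map_polyC /= !mevalC horner_evalE hornerC.
rewrite slantX mevalXU /slant_pt /slant_var horner_evalE.
case: unliftP => [j|] _; last by rewrite map_polyX hornerX.
by rewrite rmorphD rmorphM /= !map_polyC map_polyX /= !hornerE mevalXU mevalC.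
Qed.

(** Allowing a = 0, with d a mere bound for the degree, lets top coefficients be multiplied and
    added without case distinctions. *)
Definition top_coef d (Q : {poly {mpoly K[n]}}) (a : K) :=
  (size Q <= d.+1)%N /\ Q`_d = a%:MP.

Lemma top_coefM d e Q R a b :
  top_coef d Q a -> top_coef e R b -> top_coef (d + e) (Q * R) (a * b).
Proof.
move=> [szQ Qd] [szR Re]; split.
  apply: leq_trans (size_polyMleq _ _) _.
  by rewrite -subn1 leq_subLR add1n -addSn -addnS -ltnS ltnS leq_add.
have ltd : (d < (d + e).+1)%N by rewrite ltnS leq_addr.
rewrite coefM (bigD1 (Ordinal ltd)) //= addKn Qd Re -mpolyCM big1 ?addr0 //.
move=> i; rewrite -val_eqE /= neq_ltn => /orP [lt|gt].
  rewrite [R`__]nth_default ?mulr0 //; apply: leq_trans szR _.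
  by rewrite ltn_subRL ltn_add2r.
by rewrite [Q`__]nth_default ?mul0r //; apply: leq_trans szQ _.
Qed.

Definition slant_dir := slant_pt (fun=> 0) 1.

Lemma top_coef_slantX (m : 'X_{1..n.+1}) :
  top_coef (mdeg m) (slant 'X_[m]) ('X_[m]).@[slant_dir].
Proof.
have var i : top_coef 1 (slant_var i) (slant_dir i).
  rewrite /slant_var /slant_dir /slant_pt; case: unliftP => [j|] _; last first.
    by split; rewrite ?size_polyX // coefX.
  split; last by rewrite coefD coefC coefCM coefX !add0r !mulr1.
  apply: leq_trans (size_polyD _ _) _; rewrite geq_max (leq_trans (size_polyC_leq1 _)) //=.
  apply: leq_trans (size_polyMleq _ _) _.
  by rewrite size_polyX addn2 /= ltnS size_polyC_leq1.
have pow i e : top_coef e (slant_var i ^+ e) (slant_dir i ^+ e).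
  elim: e => [|e IH]; first by rewrite !expr0; split; rewrite ?size_poly1 // coefC.
  by rewrite !exprS -[e.+1]add1n; apply: top_coefM.
rewrite /slant mmapX mevalX mdegE /mmap1.
elim/big_rec3: _ => [|i a d Q _ IH]; first by split; rewrite ?size_poly1 // coefC.
exact: top_coefM.
Qed.

(** A monomial of degree e becomes a polynomial of degree at most e in T, whose T^e-coefficient is
    its value in the direction (c, 1). Only monomials of degree d reach T^d. If the top form of p is
    nonzero in that direction, p thus becomes monic in T up to a constant, as in Noether
    normalization. *)
Lemma slant_coef_top (p : {mpoly K[n.+1]}) d : (msize p <= d.+1)%N ->
  top_coef d (slant p) ((pihomog mdeg d p).@[slant_dir]).
Proof.
move=> szp; have mdp m : m \in msupp p -> (mdeg m <= d)%N.
  by move=> /msize_mdeg_lt lt; rewrite -ltnS (leq_trans lt).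
rewrite pihomogE rmorph_sum /= big_mkcond /=.
rewrite {1}(mpolyE p) rmorph_sum /= big_seq [X in top_coef _ _ X]big_seq.
elim/big_rec2: _ => [|m a Q mp [szQ Qd]]; first by split; rewrite ?size_poly0 ?coef0.
have [szX Xd] := top_coef_slantX m.
have szmX : (size (slant (p@_m *: 'X_[m])) <= (mdeg m).+1)%N.
  rewrite -mul_mpolyC rmorphM /= slantC mul_polyC.
  exact: leq_trans (size_scale_leq _ _) szX.
split.
  apply: leq_trans (size_polyD _ _) _; rewrite geq_max szQ andbT.
  by apply: leq_trans szmX _; rewrite ltnS mdp.
rewrite coefD Qd mpolyCD; congr (_ + _).
rewrite -mul_mpolyC rmorphM /= slantC coefCM.
case: eqP => [<-|/eqP ne]; first by rewrite Xd -mpolyCM mevalM mevalC.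
rewrite nth_default ?mulr0 //; apply: leq_trans szX _.
by rewrite ltn_neqAle ne mdp.
Qed.

End SlantedVariable.

Section Nullstellensatz.
Variable K : closedFieldType.

(** Induction on the number of variables: where the leading coefficient in the last variable
    survives, a nonzero polynomial in one variable remains, and it has a non-root. *)
Lemma mpoly_nonzero_point n (p : {mpoly K[n]}) : p != 0 -> exists v, p.@[v] != 0.
Proof.
elim: n p => [|n IH] p p0.
  exists (fun=> 0); rewrite (nvar0_mpolyC p) mevalC.
  by apply: contraNneq p0 => e; rewrite (nvar0_mpolyC p) e.
pose c : 'I_n -> K := fun=> 0.
have sp0 : slant c p != 0.
  by apply: contraNneq p0 => e; rewrite -(slantK c p) e rmorph0.
have [v vP] := IH (lead_coef (slant c p)) ltac:(by rewrite lead_coef_eq0).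
have : map_poly (meval v) (slant c p) != 0.
  by rewrite -lead_coef_eq0 lead_coef_map_eq.
by move=> /closed_nonrootP [t nt]; exists (slant_pt c v t); rewrite meval_slant.
Qed.

Lemma homog_nonzero_direction n d (p : {mpoly K[n.+1]}) :
  p != 0 -> p \is d.-homog -> exists c, p.@[slant_dir c] != 0.
Proof.
move=> p0 hp.
(* The factor ['X_ord_max] forces the last coordinate of the point to be nonzero, so that
   homogeneity allows it to be scaled to 1. *)
have [|w] := @mpoly_nonzero_point _ (p * 'X_ord_max).
  by rewrite mulf_neq0 // -msupp_eq0 msuppX.
rewrite mevalM mevalXU mulf_eq0 negb_or => /andP [pw wmax].
exists (fun j => w (lift ord_max j) / w ord_max).
apply: contraNneq pw => e; rewrite (@meval_eq _ _ _ (fun i => w ord_max *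
  slant_dir (fun j => w (lift ord_max j) / w ord_max) i)).
  by rewrite (meval_homog _ _ hp) e mulr0.
move=> i; rewrite /slant_dir /slant_pt; case: unliftP => [j|] ->.
  by rewrite add0r mulr1 mulrC divfK.
by rewrite mulr1.
Qed.

(* With an element g of J monic in T, the resultants of g with the elements of
   J lie in the elimination ideal, and specialise well. *)
Lemma weak_nullstellensatz n (J : {mpoly K[n]} -> Prop) :
  is_ideal J -> ~ J 1 -> exists v, forall p, J p -> p.@[v] = 0.
Proof.
elim: n J => [|n IH] J [J0 JD JM] J1.
  exists (fun=> 0) => p Jp; apply/eqP/negPn/negP.
  rewrite (nvar0_mpolyC p) mevalC => ne; apply: J1.
  have := JM (p@_0%MM)^-1%:MP p Jp.
  by rewrite {2}(nvar0_mpolyC p) -mpolyCM mulVf.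
have [[f [Jf f0]]|nex] := excluded_middle_informative (exists f, J f /\ f != 0);
  last first.
  exists (fun=> 0) => p Jp; have [->|p0] := eqVneq p 0; first by rewrite meval0.
  by exfalso; apply: nex; exists p.
pose d := (msize f).-1.
have fd0 : pihomog mdeg d f != 0.
  apply/eqP => e; have mf := mlead_supp f0.
  have := congr1 (mcoeff (mlead f)) e; rewrite mcoeff0 pihomogE raddf_sum /=.
  rewrite -big_filter (bigD1_seq (mlead f)) ?filter_uniq ?msupp_uniq //=; last first.
    by rewrite mem_filter mf /d -(mlead_deg f0) eqxx.
  rewrite mcoeffZ mcoeffX eqxx mulr1 big1 ?addr0 => [|m ne].
    by move/eqP; rewrite mleadc_eq0 (negPf f0).
  by rewrite mcoeffZ mcoeffX (negPf ne) mulr0.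
have [c cP] := homog_nonzero_direction fd0 (pihomogP _ _ _).
pose g := slant c f; set a := _.@[_] in cP.
have [szg gd] : top_coef d g a.
  by apply: slant_coef_top; rewrite /d; case: (msize f).
pose J2 P := J (unslant c P).
have J2D P Q : J2 P -> J2 Q -> J2 (P + Q) by rewrite /J2 rmorphD; apply: JD.
have J2M P Q : J2 Q -> J2 (P * Q) by rewrite /J2 rmorphM; apply: JM.
have J2g : J2 g by rewrite /J2 slantK.
have J21 : ~ J2 1 by rewrite /J2 rmorph1.
have aMP0 : a%:MP != 0 :> {mpoly K[n]} by rewrite mpolyC_eq0.
have szgE : size g = d.+1.
  apply/eqP; rewrite eqn_leq szg ltnNge; apply: contraNN aMP0 => /leq_sizeP /(_ d (leqnn _)).
  by rewrite gd => ->.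
have lg : lead_coef g = a%:MP by rewrite lead_coefE szgE.
have szg1 : (1 < size g)%N.
  rewrite szgE ltnS lt0n; apply/eqP => d0; apply: J21.
  have := J2M (a^-1)%:MP%:P _ J2g.
  rewrite [g]size1_polyC ?szgE ?d0 // -d0 gd -polyCM -mpolyCM mulVf //.
have [|v vP] := IH (fun r => J2 r%:P) _ J21.
  split=> [|x y|x y]; first by rewrite /J2 !rmorph0.
    by rewrite polyCD; apply: J2D.
  by rewrite polyCM; apply: J2M.
pose e : {rmorphism {mpoly K[n]} -> K} := meval v.
pose ge := map_poly e g.
have lge : e (lead_coef g) != 0 by rewrite lg /e /= mevalC.
have szge : size ge = size g by rewrite size_map_poly_id0.
(* The image of the ideal in K[T] after specialising the other variables at v. Unless it is the unit
   ideal, its generator has a root t, and [slant_pt c v t] is the required zero. *)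
pose E q := exists2 P, J2 P & q = map_poly e P.
have [q [P J2P ->] qdvd] : exists2 q, E q & forall p, E p -> q %| p.
  apply: poly_ideal_principal; split.
  - by exists 0; rewrite ?rmorph0 // /J2 rmorph0.
  - move=> _ _ [P JP ->] [Q JQ ->]; exists (P + Q); first exact: J2D.
    by rewrite rmorphD.
  - move=> q _ [Q JQ ->]; exists (map_poly (@mpolyC n K) q * Q); first exact: J2M.
    rewrite rmorphM /=; congr (_ * _); rewrite -map_poly_comp map_poly_id //.
    by move=> x _ /=; rewrite /e /= mevalC.
have szq : size (map_poly e P) != 1.
  apply/eqP => /eqP /size_poly1P [b b0 eP].
  have [Q J2Q eQ] : exists2 Q, J2 Q & map_poly e Q = 1.
    exists (b^-1%:MP%:P * P); first exact: J2M.
    by rewrite rmorphM /= eP map_polyC /e /= mevalC -polyCM mulVf.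
  (* Adding g T^N stays in the ideal and produces the leading coefficient a, so the resultant with g
     commutes with specialisation. It lies in the elimination ideal and so vanishes at v, whereas Q'
     specialises to 1 + g T^N, which is coprime to g. *)
  pose N := (size Q); pose Q' := Q + g * 'X^N.
  have g0 : g != 0 by rewrite -size_poly_eq0 szgE.
  have szgX : size (g * 'X^N) = (size g + N)%N by rewrite size_Mmonic ?monicXn // size_polyXn addnS.
  have ltQ : (size Q < size (g * 'X^N)%R)%N by rewrite szgX -[X in (X < _)%N]add0n ltn_add2r szgE.
  have J2Q' : J2 Q' by apply: J2D => //; rewrite mulrC; apply: J2M.
  have szQ' : (1 < size Q')%N.
    by rewrite /Q' addrC size_polyDl // szgX (leq_trans szg1) // leq_addr.
  have lQ' : lead_coef Q' = a%:MP.
    by rewrite /Q' addrC lead_coefDl // lead_coef_Mmonic ?monicXn.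
  have [[u w] /= _ uw] := resultant_in_ideal szQ' szg1.
  have /vP : J2 (resultant Q' g)%:P by rewrite uw; apply: J2D; exact: J2M.
  rewrite -[_.@[v]]/(e _) map_resultant_rmorphism //; last by rewrite lQ' -lg.
  move/eqP; rewrite resultant_eq0; apply/negP; rewrite -leqNgt.
  have : coprimep (map_poly e Q') (map_poly e g).
    rewrite rmorphD rmorphM /= eQ.
    apply/Bezout_coprimepP; exists (1, - map_poly e 'X^N).
    rewrite /=; set A := map_poly e g; set B := map_poly e 'X^N.
    by rewrite (_ : _ + _ = 1) ?eqpxx //; ring.
  by rewrite /coprimep => /eqP ->.
have /closed_rootP [t rt] := szq.
exists (slant_pt c v t) => p Jp; rewrite meval_slant.
apply/rootP; move: rt; rewrite -!dvdp_XsubCl => rt; apply: (dvdp_trans rt (qdvd _ _)).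
exists (slant c p); last by [].
by rewrite /J2 slantK.
Qed.

End Nullstellensatz.

(** * Nullstellensatz over a subfield *)

Lemma meval_map_mpoly (k K : fieldType) (iota : {rmorphism k -> K}) n
    (v : 'I_n -> K) (p : {mpoly k[n]}) :
  (map_mpoly iota p).@[v] = mmap iota v p.
Proof.
apply: (@mpoly_rmorphism_ext _ _ _ (meval v \o map_mpoly iota) (mmap iota v)).
  by move=> c; rewrite /= map_mpolyC mevalC mmapC.
by move=> i; rewrite /= map_mpolyX mevalXU mmapX mmap1U.
Qed.

Lemma linear_form_sum (k K : fieldType) (iota : {rmorphism k -> K})
    (lam : K -> k) (T : Type) (s : seq T) (P : pred T) (F : T -> K) :
  linear_form iota lam ->
  lam (\sum_(i <- s | P i) F i) = \sum_(i <- s | P i) lam (F i).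
Proof.
move=> [lamD lamZ]; elim/big_rec2: _ => [|i x y _ <-]; last by rewrite lamD.
by have := lamZ 0 0; rewrite mulr0 mul0r.
Qed.

(** The coefficients of p and of the [u.2] lie in k, so in each coefficient of the relation [lam]
    acts on the scalars alone. *)
Lemma mpoly_span_descent (k K : fieldType) (iota : {rmorphism k -> K}) n
    (lam : K -> k) (s : seq (K * {mpoly k[n]})) (p : {mpoly k[n]}) (c : K) :
  linear_form iota lam ->
  c *: map_mpoly iota p = \sum_(u <- s) u.1 *: map_mpoly iota u.2 ->
  lam c *: p = \sum_(u <- s) lam u.1 *: u.2.
Proof.
move=> hlam e; apply/mpolyP => m.
have := congr1 (lam \o mcoeff m) e; rewrite /= mcoeffZ mcoeff_map_mpoly.
rewrite !raddf_sum /= (linear_form_sum _ _ _ hlam) mcoeffZ mulrC hlam.2 mulrC => ->.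
by apply: eq_bigr => u _; rewrite !mcoeffZ mcoeff_map_mpoly mulrC hlam.2 mulrC.
Qed.

Section StrongNullstellensatz.
Variables (k : fieldType) (K : closedFieldType) (iota : {rmorphism k -> K}).
Variable n : nat.

Definition extended_ideal (J : {mpoly k[n]} -> Prop) (P : {mpoly K[n]}) :=
  exists2 s : seq (K * {mpoly k[n]}), (forall u, u \in s -> J u.2) &
    P = \sum_(u <- s) u.1 *: map_mpoly iota u.2.

Lemma extended_ideal_ideal J : is_ideal J -> is_ideal (extended_ideal J).
Proof.
move=> [J0 JD JM].
have ED x y : extended_ideal J x -> extended_ideal J y -> extended_ideal J (x + y).
  move=> [s sJ ->] [t tJ ->]; exists (s ++ t); last by rewrite big_cat.
  by move=> u; rewrite mem_cat => /orP [/sJ|/tJ].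
have E0 : extended_ideal J 0 by exists [::]; rewrite ?big_nil.
split=> // a x [s sJ ->]; rewrite (mpolyE a) mulr_suml.
elim/big_rec: _ => // m y _ Ey; apply: ED => //.
exists [seq (a@_m * u.1, 'X_[m] * u.2) | u <- s].
  by move=> _ /mapP [u us ->]; apply/JM/sJ.
rewrite big_map mulr_sumr; apply: eq_bigr => u _ /=.
by rewrite rmorphM /= map_mpolyX -scalerAl -scalerAr scalerA.
Qed.

(* Rabinowitsch: the ideal generated by J and 1 - w T. *)
Theorem nullstellensatz (J : {mpoly k[n]} -> Prop) (w : {mpoly k[n]}) :
  is_ideal J ->
  (forall v : 'I_n -> K, (forall q, J q -> mmap iota v q = 0) ->
    mmap iota v w = 0) ->
  exists N, J (w ^+ N).
Proof.
move=> idJ van; have [J0 JD JM] := idJ.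
have [E0 ED EM] := extended_ideal_ideal idJ.
have [->|w0] := eqVneq w 0; first by exists 1%N; rewrite expr1.
pose W := map_mpoly iota w.
have W0 : W != 0.
  apply: contraNneq w0 => e; apply/eqP/mpolyP => m; apply: (fmorph_inj iota).
  by rewrite -mcoeff_map_mpoly -/W e !mcoeff0 rmorph0.
(* With zero slopes, [slant] merely singles out the last variable as T, the extra variable of the
   Rabinowitsch trick. *)
pose z : 'I_n -> K := fun=> 0.
have unslant_coefK p : slant z (unslant_coef z p) = p%:P.
  apply: (@mpoly_rmorphism_ext _ _ _ (slant z \o unslant_coef z) polyC) => [c|i] /=.
    by rewrite unslant_coefC slantC.
  rewrite unslant_coefX mpolyC0 mul0r subr0 slantX /slant_var liftK.
  by rewrite mpolyC0 polyC0 mul0r addr0.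
have unslant_eval p v t : (unslant_coef z p).@[slant_pt z v t] = p.@[v].
  by rewrite meval_slant unslant_coefK map_polyC hornerC.
pose R := 1 - W%:P * 'X.
have clear_T (p : {poly {mpoly K[n]}}) :
    exists M Q H, W%:P ^+ M * p = Q%:P + R * H.
  elim/poly_ind: p => [|p c [M [Q [H eH]]]].
    by exists 0%N, 0, 0; rewrite !mulr0 polyC0 addr0.
  exists M.+1, (Q + W ^+ M.+1 * c), (W%:P * 'X * H - Q%:P).
  transitivity (W%:P * 'X * (W%:P ^+ M * p) + (W ^+ M.+1 * c)%:P).
    by rewrite polyCM rmorphXn /= exprS; move: W%:P => a; ring.
  by rewrite eH polyCD polyCM rmorphXn /= exprS /R; move: W%:P => a; ring.
(* This is the ideal generated by J and 1 - w T, described by certificates from which T has been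
   cleared: modulo 1 - w T, w is invertible, and a power of w times any polynomial is free of T. *)
pose J' P := exists N Q H,
  extended_ideal J Q /\ W%:P ^+ N * slant z P = Q%:P + R * H.
have idJ' : is_ideal J'.
  split.
  - by exists 0%N, 0, 0; split => //; rewrite /slant mmap0 !mulr0 polyC0 addr0.
  - move=> x y [N [Q [H [JQ eQ]]]] [N' [Q' [H' [JQ' eQ']]]].
    exists (N + N')%N, (W ^+ N' * Q + W ^+ N * Q'),
      (W%:P ^+ N' * H + W%:P ^+ N * H'); split; first by apply: ED; apply: EM.
    transitivity (W%:P ^+ N' * (W%:P ^+ N * slant z x) +
                  W%:P ^+ N * (W%:P ^+ N' * slant z y)).
      rewrite slantD exprD; move: (slant z x) (slant z y) (W%:P ^+ N) (W%:P ^+ N').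
      by move=> a b c d; ring.
    rewrite eQ eQ' polyCD !polyCM !rmorphXn /=.
    by move: (W%:P ^+ N) (W%:P ^+ N') (R) => a b c; ring.
  - move=> a x [N [Q [H [JQ eQ]]]]; have [M [S [G eG]]] := clear_T (slant z a).
    exists (M + N)%N, (S * Q), (S%:P * H + G * Q%:P + R * G * H).
    split; first exact: EM.
    transitivity ((W%:P ^+ M * slant z a) * (W%:P ^+ N * slant z x)).
      rewrite slantM exprD; move: (slant z x) (slant z a) (W%:P ^+ N) (W%:P ^+ M).
      by move=> ? ? ? ?; ring.
    by rewrite eQ eG polyCM; move: (R) => c; ring.
have [[N [Q [H [[s sJ Qs] eQ]]]]|nJ'] := excluded_middle_informative (J' 1).
  (* In W^N = Q + (1 - W T) H, the left side and Q are free of T, so comparing degrees in T kills H,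
     and W^N lies in the ideal generated by J over K. A linear form with value 1 at 1 brings w^N
     back into J. *)
  have H0 : H = 0.
    apply/eqP/negPn/negP => H0; have WX : size (W%:P * 'X) = 2%N.
      by rewrite mul_polyC size_scale ?size_polyX.
    have szR : size R = 2%N by rewrite /R addrC size_polyDl size_polyN WX // size_poly1.
    have R0 : R != 0 by rewrite -size_poly_eq0 szR.
    have : size (R * H) = (size H).+1 by rewrite size_mul // szR.
    have -> : R * H = (W ^+ N - Q)%:P.
      by rewrite polyCB -[R * H](addKr Q%:P) -eQ slant1 mulr1 rmorphXn addrC.
    move=> e; have := size_polyC_leq1 (W ^+ N - Q); rewrite e ltnS.
    by rewrite leqn0 size_poly_eq0 (negPf H0).
  have eW : W ^+ N = Q.
    by apply: polyC_inj; rewrite rmorphXn /= -[LHS]mulr1 -(slant1 z) eQ H0 mulr0 addr0.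
  have [] := @linear_form_separates _ _ iota (fun x => x = 0) 1.
  - split=> // [x y -> ->|a x ->]; first by rewrite addr0.
    by rewrite mulr0.
  - by move/eqP; rewrite oner_eq0.
  move=> lam [hlam lam1 _]; exists N.
  rewrite -[w ^+ N]scale1r -lam1 (@mpoly_span_descent _ _ iota _ lam s) //; last first.
    by rewrite scale1r rmorphXn /= -/W eW Qs.
  elim: s sJ {Qs} => [|u s IH] sJ; first by rewrite big_nil.
  rewrite big_cons; apply: JD.
    by rewrite -mul_mpolyC; apply/JM/sJ; rewrite mem_head.
  by apply: IH => v vs; apply: sJ; rewrite in_cons vs orbT.
(* A zero of J' is a zero of J, where w vanishes, and at the same time a zero of 1 - w T, whose
   value there is 1. *)
exfalso; have [v0 v0P] := weak_nullstellensatz idJ' nJ'.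
pose v j := v0 (lift ord_max j); pose t := v0 ord_max.
have vE P : P.@[v0] = P.@[slant_pt z v t].
  apply: meval_eq => i; rewrite /slant_pt.
  by case: unliftP => [j|] ->; rewrite // mul0r addr0.
have : W.@[v] = 0.
  rewrite meval_map_mpoly; apply: van => q Jq.
  rewrite -meval_map_mpoly -(unslant_eval _ _ t) -vE; apply: v0P.
  exists 0%N, (map_mpoly iota q), 0; split.
    exists [:: (1, q)]; last by rewrite big_seq1 scale1r.
    by move=> u; rewrite mem_seq1 => /eqP ->.
  by rewrite unslant_coefK mulr0 addr0 expr0 mul1r.
have /v0P : J' (1 - unslant_coef z W * 'X_ord_max).
  exists 0%N, 0, 1; split => //.
  rewrite slantB slant1 slantM unslant_coefK slantX /slant_var unlift_none.
  by rewrite expr0 mul1r polyC0 add0r mulr1.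
rewrite vE mevalB meval1 mevalM unslant_eval => + e; rewrite e mul0r subr0.
by move/eqP; rewrite oner_eq0.
Qed.

End StrongNullstellensatz.

(** * Evaluation, dense open sets and rational functions *)

Section Evaluation.
Variables (k K : fieldType) (iota : {rmorphism k -> K}).
Local Notation ev := (ev iota).

Lemma evD n (p q : {mpoly k[n]}) x : ev (p + q) x = ev p x + ev q x.
Proof. exact: mmapD. Qed.
Lemma evB n (p q : {mpoly k[n]}) x : ev (p - q) x = ev p x - ev q x.
Proof. exact: mmapB. Qed.
Lemma ev0 n x : ev (0 : {mpoly k[n]}) x = 0.
Proof. exact: mmap0. Qed.
Lemma evC n c x : ev (c%:MP : {mpoly k[n]}) x = iota c.
Proof. exact: mmapC. Qed.
Lemma ev1 n x : ev (1 : {mpoly k[n]}) x = 1.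
Proof. exact: (rmorph1 (mmap iota (x 0))). Qed.
Lemma evM n (p q : {mpoly k[n]}) x : ev (p * q) x = ev p x * ev q x.
Proof. exact: (rmorphM (mmap iota (x 0))). Qed.
Lemma evXn n (p : {mpoly k[n]}) e x : ev (p ^+ e) x = ev p x ^+ e.
Proof. exact: (rmorphXn (mmap iota (x 0))). Qed.
Lemma evX n (i : 'I_n) x : ev 'X_i x = x 0 i.
Proof. by rewrite /Defs.ev mmapX mmap1U. Qed.
Lemma ev_sum n (T : Type) (s : seq T) (P : pred T) (F : T -> {mpoly k[n]}) x :
  ev (\sum_(i <- s | P i) F i) x = \sum_(i <- s | P i) ev (F i) x.
Proof. exact: (raddf_sum (mmap iota (x 0))). Qed.

Lemma ev_map (k' : fieldType) (j : {rmorphism k' -> k})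
    (iota' : {rmorphism k' -> K}) n (p : {mpoly k'[n]}) x :
  (forall c, iota (j c) = iota' c) -> ev (map_mpoly j p) x = Defs.ev iota' p x.
Proof.
move=> e; apply: (@mpoly_rmorphism_ext _ _ _ (mmap iota (x 0) \o map_mpoly j)
  (mmap iota' (x 0))) => [c|i] /=.
  by rewrite map_mpolyC [LHS]mmapC [RHS]mmapC; exact: e.
by rewrite map_mpolyX !mmapX !mmap1U.
Qed.

Lemma dhomog_map n d (p : {mpoly k[n]}) :
  p \is d.-homog -> map_mpoly iota p \is d.-homog.
Proof.
move=> hp; apply/dhomogP => m; rewrite mcoeff_msupp mcoeff_map_mpoly fmorph_eq0.
by rewrite -mcoeff_msupp; apply: dhomog_mf.
Qed.

Lemma dhomogXi n (i : 'I_n) : ('X_i : {mpoly k[n]}) \is 1.-homog.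
Proof. by rewrite dhomogX; apply/eqP; exact: mdeg1. Qed.

Lemma ev_map_mx n (p : {mpoly k[n]}) (x : 'rV[k]_n) :
  ev p (map_mx iota x) = iota p.@[x 0].
Proof.
apply: (@mpoly_rmorphism_ext _ _ _ (mmap iota ((map_mx iota x) 0)) (iota \o meval (x 0))) => [c|j] /=.
  by rewrite mmapC mevalC.
by rewrite mmapX mmap1U mevalXU mxE.
Qed.

Lemma ev_scale n d (p : {mpoly k[n]}) l x :
  p \is d.-homog -> ev p (l *: x) = l ^+ d * ev p x.
Proof.
move=> hp; have hmp := dhomog_map hp.
rewrite /Defs.ev -!meval_map_mpoly -(meval_homog _ _ hmp).
by apply: meval_eq => i; rewrite mxE.
Qed.

Lemma ev_comp n m (p : {mpoly k[m]}) (F : 'I_m -> {mpoly k[n]}) x :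
  ev (p \mPo [tuple F i | i < m]) x = ev p (\row_i ev (F i) x).
Proof.
apply: (@mpoly_rmorphism_ext _ _ _
  (mmap iota (x 0) \o comp_mpoly [tuple F i | i < m])
  (mmap iota ((\row_i ev (F i) x) 0))) => [c|i] /=.
  by rewrite comp_mpolyC !mmapC.
by rewrite comp_mpolyXU -tnth_nth tnth_mktuple mmapX mmap1U mxE.
Qed.

Lemma dhomog_comp n m d e (p : {mpoly k[m]}) (F : 'I_m -> {mpoly k[n]}) :
  p \is e.-homog -> (forall i, F i \is d.-homog) ->
  p \mPo [tuple F i | i < m] \is (d * e).-homog.
Proof.
move=> hp hF; rewrite comp_mpolyE big_seq.
elim/big_ind: _ => [||mm mp]; [exact: dhomog0|exact: dhomogD|].
apply: dhomogZ; have <- : mdeg mm = e := dhomog_mf hp mp.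
rewrite mdegE big_distrr /=; elim/big_rec2: _ => [|i q e' _ IH].
  exact: dhomog1.
by apply: dhomogM => //; rewrite tnth_mktuple; apply: dhomogMn.
Qed.

End Evaluation.

Lemma ev_idfun (K : fieldType) n (p : {mpoly K[n]}) x :
  ev (idfun : {rmorphism K -> K}) p x = p.@[x 0].
Proof. by []. Qed.

Lemma proj_eq_refl (K : fieldType) n (x : 'rV[K]_n) : proj_eq x x.
Proof. by exists 1; rewrite ?oner_neq0 ?scale1r. Qed.

Lemma proj_eq_sym (K : fieldType) n (x y : 'rV[K]_n) : proj_eq x y -> proj_eq y x.
Proof.
by move=> [l l0 ->]; exists l^-1; rewrite ?invr_eq0 // scalerA mulVf // scale1r.
Qed.

Lemma proj_eq_trans (K : fieldType) n (x y z : 'rV[K]_n) :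
  proj_eq x y -> proj_eq y z -> proj_eq x z.
Proof. by move=> [l l0 ->] [m m0 ->]; exists (l * m); rewrite ?mulf_neq0 ?scalerA. Qed.

Lemma ev_proj_eq0 (k K : fieldType) (iota : {rmorphism k -> K}) n
    (p : {mpoly k[n]}) x y :
  homogeneous p -> proj_eq x y -> (ev iota p x == 0) = (ev iota p y == 0).
Proof.
move=> [d hp] [l l0 ->].
by rewrite (ev_scale _ _ _ hp) mulf_eq0 expf_eq0 (negPf l0) andbF.
Qed.

Section Dense.
Variables (k K : fieldType) (iota : {rmorphism k -> K}).
Variables (n : nat) (V : points K n).
Hypothesis irrV : irreducible_points V.
Local Notation ev := (ev iota).

(** The form [w] has coefficients in K, whereas [near] asks for coefficients in k like the
    neighbourhoods in [is_divisor]. Dense sets that come from different fields between k and K can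
    thus be intersected. *)
Definition dense (U : points K n) : Prop :=
  exists w : {mpoly K[n]}, [/\ homogeneous w, exists2 x, V x & w.@[x 0] != 0
    & forall x, V x -> w.@[x 0] != 0 -> U x].

Definition near (x : 'rV[K]_n) (U : points K n) : Prop :=
  exists h : {mpoly k[n]}, [/\ homogeneous h, ev h x != 0
    & forall y, V y -> ev h y != 0 -> U y].

Lemma dense_and U W : dense U -> dense W -> dense (fun x => U x /\ W x).
Proof.
move=> [p [[d hp] [x Vx px] Up]] [q [[e hq] [y Vy qy] Uq]].
exists (p * q); split; first by exists (d + e)%N; apply: dhomogM.
  apply: NNPP => nex.
  have [z Vz|van|van] := irrV.2 _ _ _ _ hp hq.
  - rewrite -mevalM; apply/eqP/negPn/negP => pq; apply: nex.
    by exists z.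
  - by rewrite van ?eqxx in px.
  - by rewrite van ?eqxx in qy.
move=> z Vz; rewrite mevalM mulf_eq0 negb_or => /andP [pz qz].
by split; [apply: Up | apply: Uq].
Qed.

Lemma dense_mono U W : (forall x, V x -> U x -> W x) -> dense U -> dense W.
Proof.
move=> UW [p [hp np Up]]; exists p; split=> // x Vx px.
by apply: UW => //; apply: Up.
Qed.

Lemma dense_ex U : dense U -> exists2 x, V x & U x.
Proof. by move=> [p [_ [x Vx px] Up]]; exists x; last exact: Up. Qed.

Lemma dense_ne0 (p : {mpoly k[n]}) :
  homogeneous p -> (exists2 x, V x & ev p x != 0) -> dense (fun x => ev p x != 0).
Proof.
move=> [d hp] [x Vx px]; exists (map_mpoly iota p); split.
- by exists d; apply: dhomog_map.
- by exists x; rewrite // meval_map_mpoly.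
- by move=> y _; rewrite meval_map_mpoly.
Qed.

Lemma near_dense x U : V x -> near x U -> dense U.
Proof.
move=> Vx [h [hh hx hU]].
apply: (dense_mono _ (dense_ne0 hh (ex_intro2 _ _ x Vx hx))).
by move=> y Vy; apply: hU.
Qed.

Lemma near_and x U W : near x U -> near x W -> near x (fun y => U y /\ W y).
Proof.
move=> [p [[d hp] px Up]] [q [[e hq] qx Uq]]; exists (p * q); split.
- by exists (d + e)%N; apply: dhomogM.
- by rewrite evM mulf_neq0.
- move=> y Vy; rewrite evM mulf_eq0 negb_or => /andP [py qy].
  by split; [apply: Up | apply: Uq].
Qed.

Lemma near_mono x U W : (forall y, V y -> U y -> W y) -> near x U -> near x W.
Proof.
by move=> UW [h [hh hx hU]]; exists h; split=> // y Vy hy; apply: UW => //; apply: hU.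
Qed.

Lemma ev_dense_eq d (p q : {mpoly k[n]}) :
  p \is d.-homog -> q \is d.-homog -> dense (fun x => ev p x = ev q x) ->
  forall x, V x -> ev p x = ev q x.
Proof.
move=> hp hq den x Vx; apply/eqP; rewrite -subr_eq0 -evB; apply/negPn/negP => ne.
have hpq : homogeneous (p - q) by exists d; rewrite dhomogD // dhomogN.
have [y Vy [e]] := dense_ex (dense_and den (dense_ne0 hpq (ex_intro2 _ _ x Vx ne))).
by rewrite evB e subrr eqxx.
Qed.

End Dense.

Section RationalFunctions.
Variables (k K : fieldType) (iota : {rmorphism k -> K}).
Variables (n : nat) (V : points K n).
Hypothesis irrV : irreducible_points V.
Local Notation ev := (ev iota).
Local Notation rat_fun := (rat_fun iota V).
Local Notation rf_eq := (rf_eq iota V).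
Local Notation unit_value := (unit_value iota V).
Local Notation unit_at := (unit_at iota V).
Local Notation dense := (dense V).
Local Notation near := (near iota V).
Implicit Types f g h : rfun k n.

Lemma homogeneousM (p q : {mpoly k[n]}) :
  homogeneous p -> homogeneous q -> homogeneous (p * q).
Proof. by move=> [d hp] [e hq]; exists (d + e)%N; apply: dhomogM. Qed.

Lemma rat_fun_homog f : rat_fun f -> homogeneous f.1 /\ homogeneous f.2.
Proof. by move=> [[d [h1 h2]] _ _]; split; exists d. Qed.

Lemma ne0_ex_mul (p q : {mpoly k[n]}) : homogeneous p -> homogeneous q ->
  (exists2 x, V x & ev p x != 0) -> (exists2 x, V x & ev q x != 0) ->
  exists2 x, V x & ev (p * q) x != 0.
Proof.
move=> hp hq np nq.
have [x Vx [px qx]] := dense_ex (dense_and irrV (dense_ne0 hp np) (dense_ne0 hq nq)).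
by exists x; rewrite // evM mulf_neq0.
Qed.

Lemma rat_fun1 : rat_fun (rf1 k n).
Proof.
have [[x Vx] _] := irrV; have n1 : ev (1 : {mpoly k[n]}) x != 0 by rewrite ev1 oner_neq0.
by split; [exists 0%N; split; apply: dhomog1|exists x|exists x].
Qed.

Lemma rat_fun_mul f g : rat_fun f -> rat_fun g -> rat_fun (rf_mul f g).
Proof.
move=> Rf Rg; have [f1 f2] := rat_fun_homog Rf; have [g1 g2] := rat_fun_homog Rg.
case: Rf Rg => [[d [hf1 hf2]] nf1 nf2] [[e [hg1 hg2]] ng1 ng2].
split; [|exact: ne0_ex_mul|exact: ne0_ex_mul].
by exists (d + e)%N; split; apply: dhomogM.
Qed.

Lemma rat_fun_inv f : rat_fun f -> rat_fun (f.2, f.1).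
Proof. by move=> [[d [h1 h2]] n1 n2]; split=> //; exists d. Qed.

Lemma rat_fun_div f g : rat_fun f -> rat_fun g -> rat_fun (rf_div f g).
Proof. by move=> Rf Rg; apply: (rat_fun_mul Rf (rat_fun_inv Rg)). Qed.

Lemma rat_fun_exp f e : rat_fun f -> rat_fun (rf_exp f e).
Proof.
move=> Rf; elim: e => [|e IH]; first by rewrite /rf_exp !expr0; exact: rat_fun1.
by rewrite /rf_exp !exprS; apply: (rat_fun_mul Rf IH).
Qed.

Lemma rf_eq_refl f : rf_eq f f.
Proof. by []. Qed.

Lemma rf_eq_sym f g : rf_eq f g -> rf_eq g f.
Proof. by move=> e x Vx; rewrite e. Qed.

(** The denominator of the middle fraction is cancelled on the dense set where it is nonzero. Of the
    outer fractions only homogeneity matters: both sides are then forms of one degree, and equality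
    extends to V. This covers fractions whose numerator may vanish. *)
Lemma rf_eq_trans_pair f g h :
  (exists d, f.1 \is d.-homog /\ f.2 \is d.-homog) -> rat_fun g ->
  (exists d, h.1 \is d.-homog /\ h.2 \is d.-homog) ->
  rf_eq f g -> rf_eq g h -> rf_eq f h.
Proof.
move=> [d [f1 f2]] Rg [e [h1 h2]] fg gh x Vx.
rewrite -!evM; apply: (@ev_dense_eq _ _ iota _ _ irrV (d + e)) => //; try exact: dhomogM.
  by rewrite addnC; apply: dhomogM.
have [_ hg2] := rat_fun_homog Rg; have [_ _ ng2] := Rg.
apply: (dense_mono _ (dense_ne0 hg2 ng2)) => y Vy g2y.
apply: (mulfI g2y); rewrite !evM mulrCA mulrA fg // mulrAC gh //.
by rewrite [RHS]mulrCA mulrA.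
Qed.

Lemma rf_eq_trans f g h : rat_fun f -> rat_fun g -> rat_fun h ->
  rf_eq f g -> rf_eq g h -> rf_eq f h.
Proof. by move=> [hf _ _] Rg [hh _ _]; apply: rf_eq_trans_pair. Qed.


Lemma unit_at_rat f x : unit_at f x -> rat_fun f.
Proof. by move=> [c []]. Qed.

Lemma unit_value_neq0 f x c : unit_value f x c -> c != 0.
Proof. by move=> [_ [g [_ _ g1 g2 ->]]]; rewrite mulf_neq0 ?invr_eq0. Qed.

Lemma unit_value_self f x : rat_fun f -> ev f.1 x != 0 -> ev f.2 x != 0 ->
  unit_value f x (ev f.1 x / ev f.2 x).
Proof. by move=> Rf f1 f2; split=> //; exists f; split. Qed.

Lemma unit_at_const x c : c != 0 -> unit_at (c%:MP, 1) x.
Proof.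
move=> c0; have [[y Vy] _] := irrV; exists (ev c%:MP x / ev 1 x).
apply: unit_value_self; rewrite /= ?evC ?ev1 ?fmorph_eq0 ?oner_neq0 //.
split=> /=; last 2 first.
- by exists y; rewrite // evC fmorph_eq0.
- by exists y; rewrite // ev1 oner_neq0.
by exists 0%N; rewrite -alg_mpolyC dhomogZ ?dhomog1.
Qed.

Lemma unit_value_eq f g x c : rf_eq f g -> rat_fun g ->
  unit_value f x c -> unit_value g x c.
Proof.
move=> fg Rg [Rf [h [Rh fh h1 h2 ->]]]; split=> //; exists h; split=> //.
exact: rf_eq_trans (rf_eq_sym fg) fh.
Qed.

Lemma unit_value_uniq f x c c' : V x ->
  unit_value f x c -> unit_value f x c' -> c = c'.
Proof.
move=> Vx [Rf [g [Rg fg g1 g2 ->]]] [_ [h [Rh fh h1 h2 ->]]].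
apply/eqP; rewrite eqr_div //; apply/eqP.
by rewrite (rf_eq_trans Rg Rf Rh (rf_eq_sym fg) fh).
Qed.

Lemma unit_value_mul f g x c e : unit_value f x c -> unit_value g x e ->
  unit_value (rf_mul f g) x (c * e).
Proof.
move=> [Rf [f' [Rf' ff' f1 f2 ->]]] [Rg [g' [Rg' gg' g1 g2 ->]]].
split; first exact: rat_fun_mul.
exists (rf_mul f' g'); split; rewrite /= ?evM ?mulf_neq0 //.
- exact: rat_fun_mul.
- by move=> y Vy; rewrite /= !evM mulrACA ff' // gg' // mulrACA.
- by rewrite mulf_div.
Qed.

Lemma unit_value_inv f x c : unit_value f x c -> unit_value (f.2, f.1) x c^-1.
Proof.
move=> [Rf [f' [Rf' ff' f1 f2 ->]]]; split; first exact: rat_fun_inv.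
exists (f'.2, f'.1); split=> //=; first exact: rat_fun_inv.
  by move=> y Vy /=; rewrite mulrC -ff' // mulrC.
by rewrite invf_div.
Qed.

Lemma unit_value_div f g x c e : unit_value f x c -> unit_value g x e ->
  unit_value (rf_div f g) x (c / e).
Proof. by move=> uf ug; apply: (unit_value_mul uf (unit_value_inv ug)). Qed.

Lemma unit_value1 x : unit_value (rf1 k n) x 1.
Proof.
split; first exact: rat_fun1.
exists (rf1 k n); rewrite /= !ev1 oner_neq0 divr1; split=> //; exact: rat_fun1.
Qed.

Lemma unit_value_exp f x c e : unit_value f x c -> unit_value (rf_exp f e) x (c ^+ e).
Proof.
move=> uf; elim: e => [|e IH].
  by rewrite /rf_exp !expr0; exact: unit_value1.
by rewrite /rf_exp !exprS; apply: (unit_value_mul uf IH).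
Qed.

Lemma unit_value_proj f x y c : proj_eq x y -> unit_value f x c -> unit_value f y c.
Proof.
move=> xy [Rf [g [Rg fg g1 g2 ->]]]; have [hg1 hg2] := rat_fun_homog Rg.
split=> //; exists g; split=> //; rewrite -?(ev_proj_eq0 iota hg1 xy)
  -?(ev_proj_eq0 iota hg2 xy) //.
case: Rg => [[d [h1 h2]] _ _]; case: xy => l l0 ->.
by rewrite !(ev_scale _ _ _ h1) !(ev_scale _ _ _ h2) -mulf_div divff ?mul1r ?expf_neq0.
Qed.

Lemma unit_at_proj f x y : proj_eq x y -> unit_at f x -> unit_at f y.
Proof. by move=> xy [c uc]; exists c; apply: unit_value_proj uc. Qed.

Lemma unit_at_eq f g x : rf_eq f g -> rat_fun g -> unit_at f x -> unit_at g x.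
Proof. by move=> fg Rg [c uc]; exists c; apply: unit_value_eq uc. Qed.

Lemma unit_at_mul f g x : unit_at f x -> unit_at g x -> unit_at (rf_mul f g) x.
Proof. by move=> [c uc] [e ue]; exists (c * e); apply: unit_value_mul. Qed.

Lemma unit_at_div f g x : unit_at f x -> unit_at g x -> unit_at (rf_div f g) x.
Proof. by move=> [c uc] [e ue]; exists (c / e); apply: unit_value_div. Qed.

Lemma unit_at_exp f x e : unit_at f x -> unit_at (rf_exp f e) x.
Proof. by move=> [c uc]; exists (c ^+ e); apply: unit_value_exp. Qed.

Lemma unit_at_near f x : V x -> unit_at f x -> near x (unit_at f).
Proof.
move=> Vx [c [Rf [g [Rg fg g1 g2 _]]]]; have [h1 h2] := rat_fun_homog Rg.
exists (g.1 * g.2); split; [exact: homogeneousM|by rewrite evM mulf_neq0|].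
move=> y Vy; rewrite evM mulf_eq0 negb_or => /andP [g1y g2y].
by exists (ev g.1 y / ev g.2 y); split=> //; exists g; split.
Qed.

Lemma rat_fun_dense f : rat_fun f -> dense (unit_at f).
Proof.
move=> Rf; have [h1 h2] := rat_fun_homog Rf; have [_ n1 n2] := Rf.
apply: (dense_mono _ (dense_and irrV (dense_ne0 h1 n1) (dense_ne0 h2 n2))).
by move=> y Vy [f1 f2]; exists (ev f.1 y / ev f.2 y); apply: unit_value_self.
Qed.

Lemma unit_value_ev f x c : V x -> unit_value f x c -> ev f.1 x = c * ev f.2 x.
Proof.
move=> Vx [Rf [g [Rg fg g1 g2 ->]]].
by rewrite mulrAC -fg // mulfK.
Qed.

Lemma rf_eq_dense f g : rat_fun f -> rat_fun g ->
  dense (fun y => exists c, unit_value f y c /\ unit_value g y c) -> rf_eq f g.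
Proof.
move=> [[d [f1 f2]] _ _] [[e [g1 g2]] _ _] den x Vx.
rewrite -!evM; apply: (@ev_dense_eq _ _ iota _ _ irrV (d + e)) => //.
- exact: dhomogM.
- by rewrite addnC; apply: dhomogM.
apply: dense_mono den => y Vy [c [fc gc]].
by rewrite !evM (unit_value_ev Vy fc) (unit_value_ev Vy gc); ring.
Qed.

End RationalFunctions.

(** * Composition with morphisms *)

Ltac rat_fun_tac :=
  repeat first [ assumption | apply: rat_fun1 | apply: rat_fun_div
               | apply: rat_fun_mul | apply: rat_fun_exp ].
Ltac rf_ring := let x := fresh in let Vx := fresh in
  move=> x Vx;
  lazy beta iota delta [div_of div0 div_add div_sub div_muln rf_div rf_mul rf1 rf_exp fst snd];
  rewrite ?(evM, ev1, evXn);
  repeat match goal with |- context [Defs.ev ?i ?p ?y] =>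
    let z := fresh in generalize (Defs.ev i p y); intro z end;
  ring.

Section Composition.
Variables (k K : fieldType) (iota : {rmorphism k -> K}).
Variables (n m : nat) (V : points K n) (W : points K m).
Hypotheses (irrV : irreducible_points V) (irrW : irreducible_points W).
Variable phi : 'rV[K]_n -> 'rV[K]_m.
Hypothesis mphi : morphism iota V W phi.
Local Notation ev := (ev iota).
Local Notation unit_value := (unit_value iota).
Local Notation unit_at := (unit_at iota).
Local Notation rat_fun := (rat_fun iota).
Local Notation rf_comp := (rf_comp iota V W phi).

Lemma morphism_in x : V x -> W (phi x).
Proof. by move=> /mphi []. Qed.

Lemma near_preimage U x : V x -> near iota W (phi x) U ->
  near iota V x (fun y => U (phi y)).
Proof.
move=> Vx [h [[e he] hx hU]]; have [Wx [d [F [hF nF pF]]]] := mphi Vx.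
have /rV0Pn [i] := nF; rewrite mxE => Fi.
(* The factor [F i], nonzero at x, confines y to the set where the forms F represent phi. *)
exists ((h \mPo [tuple F i | i < m]) * F i); split.
- apply: homogeneousM; last by exists d.
  by exists (d * e)%N; apply: dhomog_comp.
- by rewrite evM ev_comp mulf_neq0 // -(ev_proj_eq0 iota _ (pF _ Vx nF)) //; exists e.
move=> y Vy; rewrite evM mulf_eq0 negb_or => /andP [hy Fiy].
apply: hU; first exact: morphism_in.
have nFy : \row_i ev (F i) y != 0 by apply/rV0Pn; exists i; rewrite mxE.
by rewrite (ev_proj_eq0 iota _ (pF _ Vy nFy)); [rewrite -ev_comp | exists e].
Qed.

Definition rf_subst (f : rfun k m) (F : 'I_m -> {mpoly k[n]}) : rfun k n :=
  (f.1 \mPo [tuple F i | i < m], f.2 \mPo [tuple F i | i < m]).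

Lemma rf_subst_value f d (F : 'I_m -> {mpoly k[n]}) y :
  rat_fun W f -> (forall i, F i \is d.-homog) ->
  proj_eq (phi y) (\row_i ev (F i) y) ->
  ev (rf_subst f F).1 y != 0 -> ev (rf_subst f F).2 y != 0 ->
  unit_value W f (phi y) (ev (rf_subst f F).1 y / ev (rf_subst f F).2 y).
Proof.
rewrite /= !ev_comp => Rf hF pF f1 f2.
by apply: unit_value_proj (proj_eq_sym pF) _ => //; apply: unit_value_self.
Qed.

Lemma rat_fun_subst f d (F : 'I_m -> {mpoly k[n]}) y : V y ->
  rat_fun W f -> (forall i, F i \is d.-homog) ->
  ev (rf_subst f F).1 y != 0 -> ev (rf_subst f F).2 y != 0 ->
  rat_fun V (rf_subst f F).
Proof.
move=> Vy [[e [h1 h2]] _ _] hF f1 f2; split; [|by exists y|by exists y].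
by exists (d * e)%N; split; apply: dhomog_comp.
Qed.

(** Forms representing phi near x are substituted into a fraction that computes f near phi x. Near
    another point y, other forms and another fraction compute f; the two substitutions have equal
    values where none of their terms vanishes, and hence agree by density. *)
Lemma rf_comp_ex f x : V x -> unit_at W f (phi x) -> exists g, rf_comp f g.
Proof.
move=> Vx [c0 uc0]; have [Rf [G [RG fG G1 G2 _]]] := uc0.
have [Wx [d [F [hF nF pF]]]] := mphi Vx; have pFx := pF _ Vx nF.
have [hG1 hG2] := rat_fun_homog RG.
have g1 : ev (rf_subst G F).1 x != 0.
  by rewrite ev_comp -(ev_proj_eq0 iota hG1 pFx).
have g2 : ev (rf_subst G F).2 x != 0.
  by rewrite ev_comp -(ev_proj_eq0 iota hG2 pFx).
have Rg := rat_fun_subst Vx RG hF g1 g2.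
exists (rf_subst G F); split=> //; first by exists x, c0.
move=> y c Vy [_ [H [RH fH H1 H2 ->]]].
have [Wy [e [F' [hF' nF' pF']]]] := mphi Vy; have pFy := pF' _ Vy nF'.
have [hH1 hH2] := rat_fun_homog RH.
have h1 : ev (rf_subst H F').1 y != 0.
  by rewrite ev_comp -(ev_proj_eq0 iota hH1 pFy).
have h2 : ev (rf_subst H F').2 y != 0.
  by rewrite ev_comp -(ev_proj_eq0 iota hH2 pFy).
have Rh := rat_fun_subst Vy RH hF' h1 h2.
have -> : ev H.1 (phi y) / ev H.2 (phi y) =
    ev (rf_subst H F').1 y / ev (rf_subst H F').2 y.
  apply: (unit_value_uniq irrW Wy (unit_value_self RH H1 H2)).
  exact: rf_subst_value hF' pFy _ _.
split=> //; exists (rf_subst H F'); split=> //.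
apply: (rf_eq_dense irrV) => //.
have /rV0Pn [i] := nF; rewrite mxE => Fi.
have /rV0Pn [j] := nF'; rewrite mxE => Fj.
have hFi : homogeneous (F i) by exists d.
have hFj : homogeneous (F' j) by exists e.
have dFi := dense_ne0 hFi (ex_intro2 _ _ x Vx Fi).
have dFj := dense_ne0 hFj (ex_intro2 _ _ y Vy Fj).
have [[rg1 rg2] [rh1 rh2]] := (rat_fun_homog Rg, rat_fun_homog Rh).
have [[_ ng1 ng2] [_ nh1 nh2]] := (Rg, Rh).
have dg := dense_and irrV (dense_ne0 rg1 ng1) (dense_ne0 rg2 ng2).
have dh := dense_and irrV (dense_ne0 rh1 nh1) (dense_ne0 rh2 nh2).
apply: (dense_mono _ (dense_and irrV (dense_and irrV dFi dFj) (dense_and irrV dg dh))).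
move=> z Vz [[Fiz Fjz] [[g1z g2z] [h1z h2z]]].
have nFz : \row_i ev (F i) z != 0 by apply/rV0Pn; exists i; rewrite mxE.
have nF'z : \row_i ev (F' i) z != 0 by apply/rV0Pn; exists j; rewrite mxE.
have uG := rf_subst_value RG hF (pF _ Vz nFz) g1z g2z.
have uH := rf_subst_value RH hF' (pF' _ Vz nF'z) h1z h2z.
have e1 := unit_value_uniq irrW (morphism_in Vz) (unit_value_eq irrW (rf_eq_sym fG) Rf uG)
  (unit_value_eq irrW (rf_eq_sym fH) Rf uH).
exists (ev (rf_subst G F).1 z / ev (rf_subst G F).2 z); split.
  exact: unit_value_self.
by rewrite e1; apply: unit_value_self.
Qed.

Lemma rf_comp_rat f g : rf_comp f g -> rat_fun W f /\ rat_fun V g.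
Proof. by move=> [Rg [x [c [_ [Rf _]]]] _]. Qed.

Lemma rf_comp_unit f g x : rf_comp f g -> V x -> unit_at W f (phi x) -> unit_at V g x.
Proof. by move=> [_ _ H] Vx [c uc]; exists c; apply: H. Qed.

Lemma rf_comp_dense f g : rf_comp f g -> dense V (fun x => unit_at W f (phi x)).
Proof.
move=> [_ [x [c [Vx uc]]] _]; apply: (near_dense Vx); apply: near_preimage => //.
by apply: unit_at_near; [apply: morphism_in|exists c].
Qed.

Lemma rf_comp_uniq f f' g g' : rf_comp f g -> rf_comp f' g' ->
  rf_eq iota W f f' -> rf_eq iota V g g'.
Proof.
move=> fg fg' ff'; have [Rf Rg] := rf_comp_rat fg; have [Rf' Rg'] := rf_comp_rat fg'.
apply: (rf_eq_dense irrV) => //; apply: (dense_mono _ (rf_comp_dense fg)) => x Vx [c uc].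
exists c; split; first by case: fg => _ _; apply.
by case: fg' => _ _; apply=> //; apply: unit_value_eq uc.
Qed.

Lemma rf_comp_eq f f' g g' : rf_comp f g -> rf_eq iota W f f' -> rat_fun W f' ->
  rf_eq iota V g g' -> rat_fun V g' -> rf_comp f' g'.
Proof.
move=> fg ff' Rf' gg' Rg'; have [Rf _] := rf_comp_rat fg.
case: fg => _ [x [c [Vx uc]]] H; split=> //.
  by exists x, c; split=> //; apply: unit_value_eq uc.
move=> y e Vy ue; apply: (unit_value_eq irrV gg') => //; apply: H => //.
by apply: unit_value_eq ue => //; apply: rf_eq_sym.
Qed.

(** The product may be a unit at points where the factors are not, so the values of g1 and g2 alone
    do not settle the claim. A composite of the product exists by [rf_comp_ex], and it equals g1 g2
    because it does so on a dense set. *)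
Lemma rf_comp_mul f1 f2 g1 g2 : rf_comp f1 g1 -> rf_comp f2 g2 ->
  rf_comp (rf_mul f1 f2) (rf_mul g1 g2).
Proof.
move=> fg1 fg2; have [Rf1 Rg1] := rf_comp_rat fg1; have [Rf2 Rg2] := rf_comp_rat fg2.
have den := dense_and irrV (rf_comp_dense fg1) (rf_comp_dense fg2).
have [x Vx [u1 u2]] := dense_ex den.
have [g fg] := rf_comp_ex Vx (unit_at_mul irrW u1 u2).
have [Rf Rg] := rf_comp_rat fg; have Rg12 := rat_fun_mul irrV Rg1 Rg2.
apply: (rf_comp_eq fg) => //; apply: (rf_eq_dense irrV) => //.
apply: (dense_mono _ den) => y Vy [[c1 uc1] [c2 uc2]]; exists (c1 * c2); split.
  by case: fg => _ _; apply=> //; apply: unit_value_mul.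
by case: fg1 fg2 => _ _ H1 [_ _ H2]; apply: unit_value_mul; [|apply: H1|apply: H2].
Qed.

Lemma rf_comp_inv f g : rf_comp f g -> rf_comp (f.2, f.1) (g.2, g.1).
Proof.
move=> [Rg [x [c [Vx uc]]] H]; split; first exact: rat_fun_inv.
  by exists x, c^-1; split => //; apply: unit_value_inv.
move=> y e Vy ue; rewrite -[e]invrK; apply: unit_value_inv; apply: H => //.
by have := unit_value_inv ue; case: (f).
Qed.

Lemma rf_comp_div f1 f2 g1 g2 : rf_comp f1 g1 -> rf_comp f2 g2 ->
  rf_comp (rf_div f1 f2) (rf_div g1 g2).
Proof. by move=> fg1 fg2; apply: (rf_comp_mul fg1 (rf_comp_inv fg2)). Qed.

Lemma rf_comp_ext psi f g : morphism iota V W psi ->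
  (forall x, V x -> proj_eq (psi x) (phi x)) ->
  rf_comp f g -> Defs.rf_comp iota V W psi f g.
Proof.
move=> mpsi e [Rg [x [c [Vx uc]]] H]; split=> //.
  exists x, c; split=> //; apply: (unit_value_proj _ uc).
  exact/proj_eq_sym/e.
by move=> y d Vy ud; apply: H => //; apply: (unit_value_proj (e _ Vy)).
Qed.

End Composition.

(** The last hypothesis is separate because the first only says that phi(V) meets the set where g is
    a unit, which may be larger than the set where f is a unit at psi. *)
Lemma rf_comp_comp (k K : fieldType) (iota : {rmorphism k -> K}) n m l
    (V : points K n) (W : points K m) (X : points K l) phi psi f g h :
  morphism iota V W phi ->
  rf_comp iota V W phi g h -> rf_comp iota W X psi f g ->
  (exists2 x, V x & unit_at iota X f (psi (phi x))) ->
  rf_comp iota V X (psi \o phi) f h.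
Proof.
move=> mphi [Rh _ H] [_ _ G] [x Vx [c uc]]; split=> //; first by exists x, c.
by move=> y e Vy ue; apply: H => //; apply: G => //; case: (mphi y Vy).
Qed.

(** * Divisors *)

Ltac unit_by irr H := apply: (unit_at_eq irr _ _ H); [rf_ring | rat_fun_tac].

Lemma is_divisor_rat (k K : fieldType) (iota : {rmorphism k -> K}) n (V : points K n) D x :
  is_divisor iota V D -> V x -> rat_fun iota V (D x).
Proof. by move=> [R _]; apply: R. Qed.

Section Divisors.
Variables (k K : fieldType) (iota : {rmorphism k -> K}).
Variables (n : nat) (V : points K n).
Hypothesis irrV : irreducible_points V.
Local Notation unit_at := (unit_at iota V).
Local Notation rat_fun := (rat_fun iota V).
Local Notation is_divisor := (is_divisor iota V).
Local Notation lin_equiv := (lin_equiv iota V).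
Local Notation near := (near iota V).
Implicit Types D E F : divisor k K n.

Lemma near_all x (U : points K n) : (forall y, V y -> U y) -> near x U.
Proof.
move=> HU; exists 1; split; [by exists 0%N; apply: dhomog1|by rewrite ev1 oner_neq0|].
by move=> y Vy _; apply: HU.
Qed.

Lemma unit_at_ratio (f g : rfun k n) x :
  rat_fun g -> unit_at (rf_div f g) x -> unit_at g x -> rat_fun f -> unit_at f x.
Proof. by move=> Rg u1 u2 Rf; unit_by irrV (unit_at_mul irrV u1 u2). Qed.

Lemma unit_at_div_trans (f g h : rfun k n) x : rat_fun f -> rat_fun g -> rat_fun h ->
  unit_at (rf_div f g) x -> unit_at (rf_div g h) x -> unit_at (rf_div f h) x.
Proof. by move=> Rf Rg Rh u1 u2; unit_by irrV (unit_at_mul irrV u1 u2). Qed.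

Lemma unit_at_div_sym (f g : rfun k n) x : rat_fun f -> rat_fun g ->
  unit_at (rf_div f g) x -> unit_at (rf_div g f) x.
Proof.
move=> Rf Rg u.
unit_by irrV (unit_at_div irrV (ex_intro _ 1 (unit_value1 iota irrV x)) u).
Qed.

Lemma unit_at_mul_div (f g h : rfun k n) x : rat_fun g -> rat_fun h ->
  unit_at f x -> unit_at (rf_div g h) x -> unit_at (rf_div (rf_mul f g) h) x.
Proof.
by move=> Rg Rh u1 u2; have Rf := unit_at_rat u1; unit_by irrV (unit_at_mul irrV u1 u2).
Qed.

Lemma rf_eq_constant_multiple (f h : rfun k n) c :
  (forall x, V x -> ev iota (rf_div f h).1 x = iota c * ev iota (rf_div f h).2 x) ->
  rf_eq iota V (rf_mul (c%:MP, 1) h) f.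
Proof.
move=> e x Vx; have := e x Vx; rewrite /= !evM evC ev1 => {}e.
by rewrite mul1r e; ring.
Qed.

Lemma unit_at_div1 (f h : rfun k n) x : rat_fun f -> rat_fun h ->
  unit_at (rf_div f (rf_mul (rf1 k n) h)) x <-> unit_at (rf_div f h) x.
Proof. by move=> Rf Rh; split=> u; unit_by irrV u. Qed.

Lemma rf_eq_div_cancel (f g h : rfun k n) :
  rf_eq iota V (rf_div f g) (rf_div (rf_div f h) (rf_div g h)).
Proof. rf_ring. Qed.

Lemma is_divisor_near D x : is_divisor D -> V x ->
  near x (fun y => unit_at (rf_div (D y) (D x)) y).
Proof. by move=> [_ H] Vx; apply: H. Qed.

Lemma avoids_near D x : is_divisor D -> V x -> unit_at (D x) x ->
  near x (fun y => unit_at (D y) y).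
Proof.
move=> dD Vx ux; have [RD _] := dD.
apply: (near_mono _ (near_and (is_divisor_near dD Vx) (unit_at_near Vx ux))).
by move=> y Vy [u1 u2]; apply: (unit_at_ratio (RD x Vx)) => //; apply: RD.
Qed.

Lemma is_divisor_of h : rat_fun h -> is_divisor (div_of h).
Proof.
move=> Rh; split=> // x Vx.
apply: near_all => y Vy; unit_by irrV (ex_intro _ 1 (unit_value1 iota irrV y)).
Qed.

Lemma is_divisor0 : is_divisor (@div0 k K n).
Proof. exact: is_divisor_of (rat_fun1 _ irrV). Qed.

Lemma is_divisor_combine (op : rfun k n -> rfun k n -> rfun k n) D E :
  (forall f g, rat_fun f -> rat_fun g -> rat_fun (op f g)) ->
  (forall f f' g g' y, rat_fun f -> rat_fun f' -> rat_fun g -> rat_fun g' ->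
     unit_at (rf_div f f') y -> unit_at (rf_div g g') y ->
     unit_at (rf_div (op f g) (op f' g')) y) ->
  is_divisor D -> is_divisor E -> is_divisor (fun x => op (D x) (E x)).
Proof.
move=> Rop uop dD dE; have [RD _] := dD; have [RE _] := dE.
split=> [x Vx|x Vx]; first by apply: Rop; [apply: RD|apply: RE].
apply: (near_mono _ (near_and (is_divisor_near dD Vx) (is_divisor_near dE Vx))).
by move=> y Vy [u1 u2]; apply: uop; auto.
Qed.

Lemma is_divisor_add D E : is_divisor D -> is_divisor E -> is_divisor (div_add D E).
Proof.
apply: (@is_divisor_combine (@rf_mul k n)) => [|f f' g g' y Rf Rf' Rg Rg' u1 u2].
  exact: rat_fun_mul.
unit_by irrV (unit_at_mul irrV u1 u2).
Qed.

Lemma is_divisor_sub D E : is_divisor D -> is_divisor E -> is_divisor (div_sub D E).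
Proof.
apply: (@is_divisor_combine (@rf_div k n)) => [|f f' g g' y Rf Rf' Rg Rg' u1 u2].
  exact: rat_fun_div.
unit_by irrV (unit_at_div irrV u1 u2).
Qed.

Lemma div_mulnS D m : div_muln D m.+1 = div_add D (div_muln D m).
Proof.
apply: functional_extensionality => x.
by rewrite /div_muln /rf_exp /div_add /rf_mul !exprS.
Qed.

Lemma is_divisor_muln D m : is_divisor D -> is_divisor (div_muln D m).
Proof.
move=> dD; elim: m => [|m IH]; last by rewrite div_mulnS; apply: is_divisor_add.
by rewrite /div_muln /rf_exp; exact: is_divisor0.
Qed.

Lemma lin_equiv_refl D : is_divisor D -> lin_equiv D D.
Proof.
move=> [RD _]; exists (rf1 k n); first exact: rat_fun1.
move=> x Vx; have RDx := RD x Vx.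
unit_by irrV (ex_intro _ 1 (unit_value1 iota irrV x)).
Qed.

Lemma lin_equiv_sym D E : is_divisor D -> is_divisor E -> lin_equiv D E -> lin_equiv E D.
Proof.
move=> [RD _] [RE _] [h Rh H]; exists (rf_div (rf1 k n) h); first by rat_fun_tac.
move=> x Vx; have RDx := RD x Vx; have REx := RE x Vx.
unit_by irrV (unit_at_div irrV (ex_intro _ 1 (unit_value1 iota irrV x)) (H x Vx)).
Qed.

Lemma lin_equiv_trans D E F : is_divisor D -> is_divisor E -> is_divisor F ->
  lin_equiv D E -> lin_equiv E F -> lin_equiv D F.
Proof.
move=> [RD _] [RE _] [RF _] [h Rh H] [h' Rh' H'].
exists (rf_mul h h'); first by rat_fun_tac.
move=> x Vx; have RDx := RD x Vx; have REx := RE x Vx; have RFx := RF x Vx.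
unit_by irrV (unit_at_mul irrV (H x Vx) (H' x Vx)).
Qed.

Lemma lin_equiv_add D E D' E' :
  is_divisor D -> is_divisor E -> is_divisor D' -> is_divisor E' ->
  lin_equiv D E -> lin_equiv D' E' -> lin_equiv (div_add D D') (div_add E E').
Proof.
move=> [RD _] [RE _] [RD' _] [RE' _] [h Rh H] [h' Rh' H'].
exists (rf_mul h h'); first by rat_fun_tac.
move=> x Vx; have RDx := RD x Vx; have REx := RE x Vx.
have RD'x := RD' x Vx; have RE'x := RE' x Vx.
unit_by irrV (unit_at_mul irrV (H x Vx) (H' x Vx)).
Qed.

Lemma lin_equiv_sub D E D' E' :
  is_divisor D -> is_divisor E -> is_divisor D' -> is_divisor E' ->
  lin_equiv D E -> lin_equiv D' E' -> lin_equiv (div_sub D D') (div_sub E E').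
Proof.
move=> [RD _] [RE _] [RD' _] [RE' _] [h Rh H] [h' Rh' H'].
exists (rf_div h h'); first by rat_fun_tac.
move=> x Vx; have RDx := RD x Vx; have REx := RE x Vx.
have RD'x := RD' x Vx; have RE'x := RE' x Vx.
unit_by irrV (unit_at_div irrV (H x Vx) (H' x Vx)).
Qed.

Lemma lin_equiv_muln D E m : is_divisor D -> is_divisor E ->
  lin_equiv D E -> lin_equiv (div_muln D m) (div_muln E m).
Proof.
move=> dD dE DE; elim: m => [|m IH]; last first.
  by rewrite !div_mulnS; apply: lin_equiv_add => //; apply: is_divisor_muln.
by rewrite /div_muln /rf_exp; apply: lin_equiv_refl; exact: is_divisor0.
Qed.

Lemma lin_equiv_subr D E F : is_divisor D -> is_divisor E -> is_divisor F ->
  lin_equiv (div_sub D E) F -> lin_equiv D (div_add F E).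
Proof.
move=> [RD _] [RE _] [RF _] [h Rh H]; exists h => // x Vx.
have RDx := RD x Vx; have REx := RE x Vx; have RFx := RF x Vx.
unit_by irrV (H x Vx).
Qed.

Lemma div_eq_lin_equiv D E : is_divisor D -> is_divisor E ->
  (forall x, V x -> unit_at (rf_div (D x) (E x)) x) -> lin_equiv D E.
Proof.
move=> [RD _] [RE _] H; exists (rf1 k n); first exact: rat_fun1.
by move=> x Vx; have RDx := RD x Vx; have REx := RE x Vx; unit_by irrV (H x Vx).
Qed.

Lemma lin_equiv_sub_self D E : is_divisor D -> is_divisor E -> lin_equiv E (@div0 k K n) ->
  lin_equiv (div_sub D E) D.
Proof.
move=> dD dE [h Rh H]; exists (rf_div (rf1 k n) h); first by rat_fun_tac.
case: dD dE => RD _ [RE _] x Vx; have RDx := RD x Vx; have REx := RE x Vx.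
unit_by irrV (unit_at_div irrV (ex_intro _ 1 (unit_value1 iota irrV x)) (H x Vx)).
Qed.

(** A single point, rational or not, is easy to avoid: after subtracting the principal divisor of
    [D x], the local equation at x is [D x] divided by itself. *)
Lemma lin_equiv_avoid D x : is_divisor D -> V x ->
  exists E, [/\ is_divisor E, lin_equiv E D & unit_at (E x) x].
Proof.
move=> dD Vx; have [RD _] := dD; have RDx := RD x Vx.
have dh := is_divisor_of RDx.
exists (div_sub D (div_of (D x))); split.
- exact: is_divisor_sub.
- apply: lin_equiv_sub_self => //; exists (D x) => // y Vy.
  unit_by irrV (ex_intro _ 1 (unit_value1 iota irrV y)).
- unit_by irrV (ex_intro _ 1 (unit_value1 iota irrV x)).
Qed.

End Divisors.

(** * Pullback of divisor classes *)

Section Congruence.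
Variables (k K : fieldType) (iota : {rmorphism k -> K}) (n : nat) (V : points K n).
Implicit Types f g : rfun k n.

Lemma rf_eq_mul f f' g g' : rf_eq iota V f f' -> rf_eq iota V g g' ->
  rf_eq iota V (rf_mul f g) (rf_mul f' g').
Proof. by move=> ff' gg' x Vx; rewrite /= !evM mulrACA ff' // gg' // mulrACA. Qed.

Lemma rf_eq_inv f f' : rf_eq iota V f f' -> rf_eq iota V (f.2, f.1) (f'.2, f'.1).
Proof. by move=> ff' x Vx; rewrite /= mulrC -ff' // mulrC. Qed.

Lemma rf_eq_div f f' g g' : rf_eq iota V f f' -> rf_eq iota V g g' ->
  rf_eq iota V (rf_div f g) (rf_div f' g').
Proof. by move=> ff' gg'; apply: (rf_eq_mul ff' (rf_eq_inv gg')). Qed.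

End Congruence.

Section Pullback.
Variables (k K : fieldType) (iota : {rmorphism k -> K}).
Variables (n m : nat) (V : points K n) (W : points K m).
Hypotheses (irrV : irreducible_points V) (irrW : irreducible_points W).
Variable phi : 'rV[K]_n -> 'rV[K]_m.
Hypothesis mphi : morphism iota V W phi.
Local Notation unit_at := (unit_at iota).
Local Notation rat_fun := (rat_fun iota).
Local Notation is_divisor := (is_divisor iota).
Local Notation lin_equiv := (lin_equiv iota).
Local Notation rf_comp := (rf_comp iota V W phi).
Local Notation div_pullback := (div_pullback iota V W phi).
Local Notation class_pullback := (class_pullback iota V W phi).

Let Wphi x : V x -> W (phi x). Proof. exact: (morphism_in mphi). Qed.

Lemma div_pullback_avoids E D x : is_divisor V D -> div_pullback E D -> V x ->
  unit_at W (E (phi x)) (phi x) -> unit_at V (D x) x.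
Proof.
move=> [RD _] pD Vx uE; have [g fg ug] := pD x Vx.
have [_ Rg] := rf_comp_rat fg.
apply: (unit_at_ratio irrV Rg ug) (RD x Vx).
exact: rf_comp_unit fg Vx uE.
Qed.

(* The local equations of E at the points phi x are defined along phi(V) as
   soon as phi(V) meets the complement of the support of E. *)
Lemma avoids_somewhere E x0 x : is_divisor W E -> V x0 -> V x ->
  unit_at W (E (phi x0)) (phi x0) ->
  exists2 x1, V x1 & unit_at W (E (phi x)) (phi x1).
Proof.
move=> dE Vx0 Vx u0; have [RE _] := dE.
have d1 := near_dense Vx0 (near_preimage mphi Vx0 (avoids_near irrW dE (Wphi Vx0) u0)).
have d2 := near_dense Vx (near_preimage mphi Vx (is_divisor_near dE (Wphi Vx))).
have [x1 Vx1 [u1 u2]] := dense_ex (dense_and irrV d1 d2).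
exists x1 => //; have R1 := RE _ (Wphi Vx); have R2 := RE _ (Wphi Vx1).
unit_by irrW (unit_at_div irrW u1 u2).
Qed.

Lemma div_pullback_local E D : is_divisor W E ->
  (forall x, V x -> rf_comp (E (phi x)) (D x)) ->
  is_divisor V D /\ div_pullback E D.
Proof.
move=> dE H; have RD x : V x -> rat_fun V (D x) by move=> /H /rf_comp_rat [].
split; last first.
  move=> x Vx; exists (D x); first exact: H.
  have RDx := RD x Vx; unit_by irrV (ex_intro _ 1 (unit_value1 iota irrV x)).
split=> // x Vx; apply: (near_mono _ (near_preimage mphi Vx (is_divisor_near dE (Wphi Vx)))).
move=> y Vy uy; apply: (rf_comp_unit _ Vy uy).
by apply: rf_comp_div => //; apply: H.
Qed.

Lemma div_pullback_ex E x0 : is_divisor W E -> V x0 ->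
  unit_at W (E (phi x0)) (phi x0) -> exists D, is_divisor V D /\ div_pullback E D.
Proof.
move=> dE Vx0 u0.
have ex x : exists g, V x -> rf_comp (E (phi x)) g.
  have [Vx|nVx] := excluded_middle_informative (V x); last by exists (rf1 k n).
  have [x1 Vx1 u1] := avoids_somewhere dE Vx0 Vx u0.
  by have [g fg] := rf_comp_ex irrV irrW mphi Vx1 u1; exists g.
exists (fun x => proj1_sig (constructive_indefinite_description _ (ex x))).
apply: div_pullback_local => // x Vx.
by case: constructive_indefinite_description => g /= /(_ Vx).
Qed.

Lemma class_pullback_ex E : is_divisor W E -> exists D, class_pullback E D.
Proof.
move=> dE; have [[x0 Vx0] _] := irrV.
have [E' [dE' EE' u0]] := lin_equiv_avoid irrW dE (Wphi Vx0).
have [D [dD pD]] := div_pullback_ex dE' Vx0 u0.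
exists D; split=> //; exists E', D; split=> //; exact: lin_equiv_refl.
Qed.

Lemma class_pullback_div E D : class_pullback E D -> is_divisor V D.
Proof. by case. Qed.

(** The function h with E1 = E2 + div h can be composed with phi because near each phi x it is the
    quotient of the local equations of E1 and E2, up to a unit, and all of these compose with phi.
    The composites found at different x agree by uniqueness. *)
Lemma div_pullback_lin E1 E2 D1 D2 : is_divisor W E1 -> is_divisor W E2 ->
  is_divisor V D1 -> is_divisor V D2 ->
  div_pullback E1 D1 -> div_pullback E2 D2 ->
  lin_equiv W E1 E2 -> lin_equiv V D1 D2.
Proof.
move=> dE1 dE2 dD1 dD2 p1 p2 [h Rh H].
have key x : V x -> exists gh, [/\ rf_comp h gh &
    unit_at V (rf_div (D1 x) (rf_mul (D2 x) gh)) x].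
  move=> Vx; have [g1 c1 u1] := p1 x Vx; have [g2 c2 u2] := p2 x Vx.
  have uu := H _ (Wphi Vx).
  have [gu cu] := rf_comp_ex irrV irrW mphi Vx uu.
  have [[RE1 Rg1] [RE2 Rg2]] := (rf_comp_rat c1, rf_comp_rat c2).
  have [_ Ru] := rf_comp_rat cu.
  exists (rf_div (rf_div g1 g2) gu); split.
    have cc := rf_comp_div irrV irrW mphi (rf_comp_div irrV irrW mphi c1 c2) cu.
    by apply: (rf_comp_eq irrV irrW cc) => //; [rf_ring | rat_fun_tac].
  have RD1 := is_divisor_rat dD1 Vx.
  have RD2 := is_divisor_rat dD2 Vx.
  unit_by irrV (unit_at_mul irrV (unit_at_div irrV u1 u2) (rf_comp_unit cu Vx uu)).
have [[x0 Vx0] _] := irrV; have [gh [ch _]] := key x0 Vx0.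
have [_ Rgh] := rf_comp_rat ch; exists gh => // x Vx.
have [gh' [ch' u]] := key x Vx; have [_ Rgh'] := rf_comp_rat ch'.
have RD1 := is_divisor_rat dD1 Vx.
have RD2 := is_divisor_rat dD2 Vx.
apply: (unit_at_eq irrV _ _ u); last by rewrite /div_add /div_of; rat_fun_tac.
have e := rf_comp_uniq irrV irrW mphi ch' ch (@rf_eq_refl _ _ _ _ _ h).
exact: (rf_eq_div (@rf_eq_refl _ _ iota _ V _) (rf_eq_mul (@rf_eq_refl _ _ iota _ V _) e)).
Qed.

Lemma class_pullback_linE E1 E2 D1 D2 : is_divisor W E1 -> is_divisor W E2 ->
  lin_equiv W E1 E2 -> class_pullback E1 D1 -> class_pullback E2 D2 ->
  lin_equiv V D1 D2.
Proof.
move=> dE1 dE2 EE [dD1 [E1' [D1' [dE1' l1 dD1' p1 m1]]]].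
move=> [dD2 [E2' [D2' [dE2' l2 dD2' p2 m2]]]].
apply: (lin_equiv_trans irrV dD1 dD1' dD2); first exact: lin_equiv_sym.
apply: (lin_equiv_trans irrV dD1' dD2' dD2) => //.
apply: (div_pullback_lin dE1' dE2') => //.
apply: (lin_equiv_trans irrW dE1' dE1 dE2') => //.
by apply: (lin_equiv_trans irrW dE1 dE2 dE2') => //; apply: lin_equiv_sym.
Qed.

Lemma class_pullback_uniq E D1 D2 : is_divisor W E ->
  class_pullback E D1 -> class_pullback E D2 -> lin_equiv V D1 D2.
Proof. by move=> dE; apply: class_pullback_linE => //; apply: lin_equiv_refl. Qed.

Lemma class_pullback_lin E D D' : class_pullback E D -> is_divisor V D' ->
  lin_equiv V D D' -> class_pullback E D'.
Proof.
move=> [dD [E' [F [dE' l dF p DF]]]] dD' DD'; split=> //; exists E', F; split=> //.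
exact: lin_equiv_trans DF DD'.
Qed.

Lemma class_pullback_linl E E' D : is_divisor W E -> is_divisor W E' ->
  class_pullback E D -> lin_equiv W E E' -> class_pullback E' D.
Proof.
move=> dE dE' [dD [E1 [F [dE1 l dF p DF]]]] EE'; split=> //; exists E1, F; split=> //.
exact: lin_equiv_trans l EE'.
Qed.

Lemma div_pullback_class E D : is_divisor W E -> is_divisor V D ->
  div_pullback E D -> class_pullback E D.
Proof.
move=> dE dD p; split=> //; exists E, D; split=> //; exact: lin_equiv_refl.
Qed.

Lemma class_pullback_sub E1 E2 D1 D2 : is_divisor W E1 -> is_divisor W E2 ->
  class_pullback E1 D1 -> class_pullback E2 D2 ->
  class_pullback (div_sub E1 E2) (div_sub D1 D2).
Proof.
move=> dE1 dE2 [dD1 [E1' [D1' [dE1' l1 dD1' p1 m1]]]].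
move=> [dD2 [E2' [D2' [dE2' l2 dD2' p2 m2]]]].
split; first exact: is_divisor_sub.
exists (div_sub E1' E2'), (div_sub D1' D2').
split; [exact: is_divisor_sub|exact: lin_equiv_sub|exact: is_divisor_sub| |exact: lin_equiv_sub].
move=> x Vx; have [g1 c1 u1] := p1 x Vx; have [g2 c2 u2] := p2 x Vx.
exists (rf_div g1 g2); first exact: rf_comp_div.
have RD1 := is_divisor_rat dD1' Vx.
have RD2 := is_divisor_rat dD2' Vx.
have [[_ Rg1] [_ Rg2]] := (rf_comp_rat c1, rf_comp_rat c2).
unit_by irrV (unit_at_div irrV u1 u2).
Qed.

(** Local equations are indexed by coordinate vectors, so those of E' at [psi x] and [phi x] may
    differ although the two vectors are one point. They differ by a unit, and its pullback corrects
    the local equation. *)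
Lemma class_pullback_ext psi E D : is_divisor W E -> morphism iota V W psi ->
  (forall x, V x -> proj_eq (psi x) (phi x)) ->
  class_pullback E D -> Defs.class_pullback iota V W psi E D.
Proof.
move=> dE mpsi e [dD [E' [D' [dE' l dD' p lD]]]]; split=> //.
exists E', D'; split=> // x Vx; have [g c u] := p x Vx.
have Wpsi := morphism_in mpsi Vx.
have uE : unit_at W (rf_div (E' (psi x)) (E' (phi x))) (phi x).
  have [h [hh hx hu]] := is_divisor_near dE' (Wphi Vx).
  apply: (unit_at_proj (e _ Vx)); apply: hu => //.
  by rewrite (ev_proj_eq0 iota hh (e _ Vx)).
have [gu cu] := rf_comp_ex irrV irrW mphi Vx uE.
have [[RE Rg] [_ Ru]] := (rf_comp_rat c, rf_comp_rat cu).
have RD := is_divisor_rat dD' Vx.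
have RE2 := is_divisor_rat dE' Wpsi.
exists (rf_mul g gu).
  apply: (rf_comp_ext mpsi e).
  have cc := rf_comp_mul irrV irrW mphi c cu.
  by apply: (rf_comp_eq irrV irrW cc) => //; [rf_ring | rat_fun_tac].
unit_by irrV (unit_at_div irrV u (rf_comp_unit cu Vx uE)).
Qed.

(** A representative of the class that avoids the common image point has local equations that pull
    back to units everywhere. *)
Lemma class_pullback_const y E : is_divisor W E ->
  (forall x, V x -> proj_eq (phi x) y) -> W y -> class_pullback E (@div0 k K n).
Proof.
move=> dE cst Wy; have [[x0 Vx0] _] := irrV.
have [E' [dE' EE' u0]] := lin_equiv_avoid irrW dE (Wphi Vx0).
have [D [dD pD]] := div_pullback_ex dE' Vx0 u0.
have d0 := is_divisor0 iota irrV.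
split=> //; exists E', D; split=> //; apply: div_eq_lin_equiv => // x Vx.
have [RD _] := dD; have RDx := RD x Vx.
suff u : unit_at V (D x) x by unit_by irrV u.
apply: div_pullback_avoids pD _ _ => //.
have xx : proj_eq (phi x) (phi x0).
  exact: proj_eq_trans (cst _ Vx) (proj_eq_sym (cst _ Vx0)).
have [h [hh hx hu]] := avoids_near irrW dE' (Wphi Vx0) u0.
by apply: hu; [apply: Wphi | rewrite (ev_proj_eq0 iota hh xx)].
Qed.

End Pullback.

Lemma class_pullback_id (k K : fieldType) (iota : {rmorphism k -> K}) n
    (V : points K n) E :
  irreducible_points V -> is_divisor iota V E -> class_pullback iota V V id E E.
Proof.
move=> irrV dE; split=> //; exists E, E; split=> //; try exact: lin_equiv_refl.
move=> x Vx; have RE := is_divisor_rat dE Vx.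
exists (E x); last by unit_by irrV (ex_intro _ 1 (unit_value1 iota irrV x)).
split=> //; have [y Vy [c uc]] := dense_ex (rat_fun_dense irrV RE).
by exists y, c.
Qed.

Section PullbackComposition.
Variables (k K : fieldType) (iota : {rmorphism k -> K}) (n m l : nat).
Variables (V : points K n) (W : points K m) (X : points K l).
Hypotheses (irrV : irreducible_points V) (irrW : irreducible_points W).
Hypothesis irrX : irreducible_points X.
Variables (phi : 'rV[K]_n -> 'rV[K]_m) (psi : 'rV[K]_m -> 'rV[K]_l).
Hypotheses (mphi : morphism iota V W phi) (mpsi : morphism iota W X psi).

(** A representative of the class of F that avoids psi (phi x0) can be pulled back twice as a
    divisor, since its pullback to W avoids phi x0. This reduces the claim to the composition of
    functions. *)
Lemma class_pullback_comp F E D : is_divisor iota X F ->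
  class_pullback iota V W phi E D -> class_pullback iota W X psi F E ->
  class_pullback iota V X (psi \o phi) F D.
Proof.
move=> dF cD cE; have [[x0 Vx0] _] := irrV.
have Wphi := morphism_in mphi; have Xpsi := morphism_in mpsi.
have [F' [dF' FF' u0]] := lin_equiv_avoid irrX dF (Xpsi _ (Wphi _ Vx0)).
have [E' [dE' pE']] := div_pullback_ex irrW irrX mpsi dF' (Wphi _ Vx0) u0.
have uE' := div_pullback_avoids irrW dE' pE' (Wphi _ Vx0) u0.
have [D' [dD' pD']] := div_pullback_ex irrV irrW mphi dE' Vx0 uE'.
have EE' : lin_equiv iota W E' E.
  have cE' := div_pullback_class irrW irrX dF' dE' pE'.
  exact: (class_pullback_linE irrW irrX mpsi dF' dF).
have dE : is_divisor iota W E by case: cE.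
have DD' : lin_equiv iota V D' D.
  have cD' := div_pullback_class irrV irrW dE' dD' pD'.
  exact: (class_pullback_linE irrV irrW mphi dE' dE).
split; first by case: cD.
exists F', D'; split=> // x Vx.
have [gE cgE ugE] := pE' _ (Wphi _ Vx); have [gD cgD ugD] := pD' _ Vx.
have [gu cu] := rf_comp_ex irrV irrW mphi Vx ugE.
have [[[RF RgE] [RE RgD]] [_ Ru]] :=
  (rf_comp_rat cgE, rf_comp_rat cgD, rf_comp_rat cu).
have RD := is_divisor_rat dD' Vx.
exists (rf_div gD gu); last by unit_by irrV (unit_at_mul irrV ugD (rf_comp_unit cu Vx ugE)).
have mcomp : exists2 x1, V x1 & unit_at iota X (F' (psi (phi x))) (psi (phi x1)).
  have d1 := near_dense Vx0 (near_preimage mphi Vx0 (near_preimage mpsi (Wphi _ Vx0)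
    (avoids_near irrX dF' (Xpsi _ (Wphi _ Vx0)) u0))).
  have d2 := near_dense Vx (near_preimage mphi Vx (near_preimage mpsi (Wphi _ Vx)
    (is_divisor_near dF' (Xpsi _ (Wphi _ Vx))))).
  have [x1 Vx1 [u1 u2]] := dense_ex (dense_and irrV d1 d2).
  exists x1 => //; have R1 : rat_fun iota X (F' (psi (phi x1))).
    by case: dF' => R _; apply/R/Xpsi/Wphi.
  unit_by irrX (unit_at_div irrX u1 u2).
apply: (rf_comp_comp mphi _ cgE mcomp).
have cc := rf_comp_div irrV irrW mphi cgD cu.
by apply: (rf_comp_eq irrV irrW cc) => //; [rf_ring | rat_fun_tac].
Qed.

End PullbackComposition.

(** * Regular functions *)

Definition nonzero_points (K : fieldType) n (V : points K n) := forall x, V x -> x != 0.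
Definition scale_closed (K : fieldType) n (V : points K n) :=
  forall x y, proj_eq y x -> V x -> V y.

Lemma closed_over_nonzero (k K : fieldType) (iota : {rmorphism k -> K}) n (V : points K n) :
  closed_over iota V -> nonzero_points V.
Proof. by move=> [s _ H] x /H []. Qed.

Lemma closed_over_scale_closed (k K : fieldType) (iota : {rmorphism k -> K}) n
    (V : points K n) : closed_over iota V -> scale_closed V.
Proof.
move=> [s hs H] x y yx /H [x0 sx]; apply/H; split; last first.
  by move=> p ps; apply/eqP; rewrite (ev_proj_eq0 iota (hs p ps) yx) sx.
by case: yx => l l0 ->; rewrite scalemx_eq0 negb_or l0.
Qed.

Section RegularFunctions.
Variables (k : fieldType) (K : closedFieldType) (iota : {rmorphism k -> K}).
Variables (n : nat) (V : points K n).
Hypotheses (irrV : irreducible_points V) (clV : closed_over iota V).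
Local Notation ev := (ev iota).
Implicit Types f g : rfun k n.

Definition homog_pair f : Prop := exists d, f.1 \is d.-homog /\ f.2 \is d.-homog.

(** Unlike [unit_value], this admits numerators that vanish at x or on all of V, so that regular
    functions can be added. *)
Definition reg_value f (x : 'rV[K]_n) (c : K) : Prop :=
  exists g : rfun k n, [/\ homog_pair g, ev g.2 x != 0, rf_eq iota V f g
    & c = ev g.1 x / ev g.2 x].

Definition regular_at f x : Prop := exists c, reg_value f x c.

(** V is a cone, so the identity holds at l x for every nonzero l and becomes one between
    polynomials in l; the coefficient of l^(a + d) involves only the part of p of degree a. *)
Lemma homogeneous_component d a (p q F : {mpoly k[n]}) :
  F \is (a + d).-homog -> q \is d.-homog ->
  (forall x, V x -> ev F x = ev p x * ev q x) ->
  forall x, V x -> ev F x = ev (pihomog mdeg a p) x * ev q x.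
Proof.
move=> hF hq e x Vx.
pose M := maxn (msize p) a.+1.
pose Q : {poly K} := ev F x *: 'X^(a + d)
  - \sum_(i < M) (ev (pihomog mdeg i p) x * ev q x) *: 'X^(i + d).
have Q0 l : l != 0 -> Q.[l] = 0.
  move=> l0; have := e _ (closed_over_scale_closed clV (ex_intro2 _ _ l l0 erefl) Vx).
  rewrite (ev_scale _ _ _ hF) (ev_scale _ _ _ hq).
  rewrite {1}(@pihomog_partitionE _ _ mdeg M p) ?leq_maxl // ev_sum => eq.
  rewrite hornerD hornerN horner_sum hornerZ hornerXn mulrC eq mulr_suml.
  rewrite -sumrB big1 // => i _.
  rewrite hornerZ hornerXn (ev_scale _ _ _ (pihomogP _ _ _)) exprD.
  by ring.
have : Q * 'X = 0.
  apply/eqP/negPn/negP => /closed_nonrootP [l]; rewrite rootM rootX negb_or.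
  by move=> /andP [nr l0]; rewrite /root Q0 ?eqxx in nr.
move/eqP; rewrite mulf_eq0 polyX_eq0 orbF => /eqP Qz.
have := congr1 (fun P : {poly K} => P`_(a + d)) Qz.
rewrite coefB coefZ coefXn eqxx mulr1 coef_sum coef0.
have aM : (a < M)%N by rewrite leq_maxr.
rewrite (bigD1 (Ordinal aM)) //= coefZ coefXn eqxx mulr1 big1 ?addr0 => [/subr0_eq //|].
move=> i; rewrite -val_eqE /= => ne.
by rewrite coefZ coefXn eqn_add2r eq_sym (negPf ne) mulr0.
Qed.

(** The Nullstellensatz is applied to the ideal of denominators of f on V. It has no zero with w
    nonzero: on V, regularity supplies a denominator; off V, the equations of V are denominators;
    and at the zero vector w vanishes, as e > 0. So some w^N is a denominator, and homogeneity
    selects one component of its numerator. *)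
Lemma regular_basic_open f (w : {mpoly k[n]}) e :
  homog_pair f -> w \is e.-homog -> (0 < e)%N ->
  (forall y, V y -> ev w y != 0 -> regular_at f y) ->
  exists N p, p \is (e * N).-homog /\
    forall x, V x -> ev f.1 x * ev w x ^+ N = ev p x * ev f.2 x.
Proof.
move=> [d [h1 h2]] hw e0 reg.
pose J q := exists p, forall x, V x -> ev f.1 x * ev q x = ev p x * ev f.2 x.
have [||N [p pP]] := @nullstellensatz _ _ iota _ J w.
- split.
  + by exists 0 => x Vx; rewrite !ev0 mulr0 mul0r.
  + move=> x y [p pP] [q qP]; exists (p + q) => z Vz.
    by rewrite !evD mulrDr mulrDl pP ?qP.
  + move=> a x [p pP]; exists (a * p) => z Vz.
    by rewrite !evM mulrCA pP // mulrA.
- move=> v van; pose x : 'rV[K]_n := \row_i v i.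
  have vx : v = x 0 by apply: functional_extensionality => i; rewrite mxE.
  rewrite vx in van *; apply/eqP/negPn/negP => wx.
  have [Vx|nVx] := excluded_middle_informative (V x).
    have [c [g [_ g2 fg _]]] := reg x Vx wx.
    by move/eqP: g2; apply; apply: van; exists g.1 => y /fg.
  have [x0|x0] := eqVneq x 0.
    move: wx; rewrite -[mmap _ _ _]/(ev w x) x0 -(scale0r (0 : 'rV[K]_n)).
    by rewrite (ev_scale _ _ _ hw) expr0n gtn_eqF // mul0r eqxx.
  case: clV => s hs HV; apply: nVx; apply/HV; split=> // p ps.
  apply: van; exists 0 => y /HV [_ sy].
  by rewrite (sy _ ps) ev0 mulr0 mul0r.
exists N, (pihomog mdeg (e * N) p); split; first exact: pihomogP.
move=> x Vx; rewrite -evXn -evM; apply: (@homogeneous_component d) => //.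
  by rewrite addnC; apply: dhomogM => //; apply: dhomogMn.
by move=> y Vy; rewrite evM pP.
Qed.

End RegularFunctions.

Section GlobalFunctions.
Variables (K : closedFieldType) (n : nat) (V : points K n).
Local Notation id_K := (idfun : {rmorphism K -> K}).
Hypotheses (irrV : irreducible_points V) (clV : closed_over id_K V).
Local Notation ev := (ev id_K).

(* Multiplication by f preserves the forms of a large degree M on V, so that
   every value of f is an eigenvalue of one fixed matrix. *)
Lemma regular_constant (f : rfun K n) : homog_pair f ->
  (exists2 x, V x & ev f.2 x != 0) ->
  (forall y, V y -> regular_at id_K V f y) ->
  exists c, forall x, V x -> ev f.1 x = c * ev f.2 x.
Proof.
move=> hf nf2 reg.
have key i : exists Np : nat * {mpoly K[n]}, Np.2 \is Np.1.-homog /\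
    forall x, V x -> ev f.1 x * x 0 i ^+ Np.1 = ev Np.2 x * ev f.2 x.
  have [|N [p [hp pP]]] := @regular_basic_open _ _ id_K _ _ clV f 'X_i 1 hf _ isT
    (fun y Vy _ => reg y Vy).
    exact: dhomogXi.
  by exists (N, p); split=> [|x Vx]; [rewrite mul1n in hp|rewrite -pP // evX].
pose Np i := proj1_sig (constructive_indefinite_description _ (key i)).
have NpP i : (Np i).2 \is (Np i).1.-homog /\
    forall x, V x -> ev f.1 x * x 0 i ^+ (Np i).1 = ev (Np i).2 x * ev f.2 x.
  by rewrite /Np; case: constructive_indefinite_description.
(* By the pigeonhole principle, every monomial of degree M is divisible by some X_i^(N_i) with N_i =
   [(Np i).1], and f X_i^(N_i) is a form on V. So f maps forms of degree M to forms of degree M. *)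
pose M := (\sum_i (Np i).1).+1.
have mult (m : 'X_{1..n}) : exists q : {mpoly K[n]}, mdeg m = M ->
    q \is M.-homog /\ forall x, V x -> ev f.1 x * ev 'X_[m] x = ev q x * ev f.2 x.
  have [mM|] := eqVneq (mdeg m) M; last by move=> ne; exists 0 => e; rewrite e eqxx in ne.
  have [i le] : exists i, ((Np i).1 <= m i)%N.
    apply/existsP; rewrite -[X in is_true X]negbK negb_exists; apply/negP => /forallP all.
    have : (mdeg m <= \sum_i (Np i).1)%N.
      by rewrite mdegE; apply: leq_sum => i _; have := all i; rewrite -ltnNge => /ltnW.
    by rewrite mM ltnn.
  have Em : m = (U_(i) *+ (Np i).1 + (m - U_(i) *+ (Np i).1))%MM.
    rewrite addmC submK //; apply/mnm_lepP => j; rewrite mulmnE mnm1E.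
    by case: eqP => [<-|_]; rewrite ?mul1n ?mul0n.
  have [hp pP] := NpP i.
  exists ((Np i).2 * 'X_[m - U_(i) *+ (Np i).1]) => _; split.
    have -> : M = ((Np i).1 + mdeg (m - U_(i) *+ (Np i).1)%MM)%N.
      by rewrite -mM {1}Em mdegD mdegMn mdeg1 mul1n.
    by apply: dhomogM => //; rewrite dhomogX.
  move=> x Vx; rewrite evM mulrAC -pP // {1}Em mpolyXD evM -mulrA; congr (_ * _).
  by rewrite -mpolyXn evXn evX.
pose q m := proj1_sig (constructive_indefinite_description _ (mult m)).
have qP m : mdeg m = M -> q m \is M.-homog /\
    forall x, V x -> ev f.1 x * ev 'X_[m] x = ev (q m) x * ev f.2 x.
  by rewrite /q; case: constructive_indefinite_description.
pose T := 'X_{1..n < M.+1}.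
pose mon (i : 'I_#|{: T}|) : 'X_{1..n} := bmnm (enum_val i).
(* Multiplication by f on the monomials of degree M. The index type contains all monomials of degree
   at most M, and everything in smaller degree is padded with 0. At each point, the row of values of
   the monomials is a left eigenvector. *)
pose A := \matrix_(i < #|{: T}|, j < #|{: T}|)
  if mdeg (mon j) == M then (q (mon j))@_(mon i) else 0.
pose u (x : 'rV[K]_n) := \row_(i < #|{: T}|) if mdeg (mon i) == M then ev 'X_[mon i] x else 0.
have eig x : V x -> ev f.2 x != 0 -> root (char_poly A) (ev f.1 x / ev f.2 x).
  move=> Vx f2x; rewrite -eigenvalue_root_char; apply/eigenvalueP; exists (u x).
    apply/rowP => j; rewrite !mxE.
    have [ej|nj] := eqVneq (mdeg (mon j)) M; last first.
      by rewrite mulr0 big1 // => i _; rewrite !mxE (negPf nj) mulr0.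
    have [hq qE] := qP _ ej.
    apply: (mulIf f2x); rewrite [RHS]mulrAC divfK // qE //; congr (_ * _).
    have szq : (msize (q (mon j)) <= M.+1)%N.
      rewrite mmeasureE; apply/bigmax_leqP_seq => m mq _.
      by move: (dhomog_mf hq mq) => /= ->.
    rewrite [RHS](mmapE M.+1) //= (big_enum_val (A := {: T}) (fun m : T => _)) /=.
    apply: eq_bigr => i _; rewrite !mxE ej eqxx.
    case: ifP => [_|/negbT ne]; first by rewrite mulrC /Defs.ev mmapX.
    by rewrite (dhomog_nemf_coeff hq ne) !mul0r.
  have /rV0Pn [i xi] := closed_over_nonzero clV Vx.
  have dm : mdeg (U_(i) *+ M)%MM = M by rewrite mdegMn mdeg1 mul1n.
  have bm : (mdeg (U_(i) *+ M)%MM < M.+1)%N by rewrite dm.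
  apply/rV0Pn; exists (enum_rank (BMultinom bm : T)).
  rewrite mxE /mon enum_rankK /= dm eqxx -mpolyXn evXn evX.
  by rewrite expf_neq0.
have [r rP] := closed_field_poly_normal (char_poly A).
have den : dense V (fun x => ev f.2 x != 0 /\ ev f.1 x / ev f.2 x \in r).
  have hf2 : homogeneous f.2 by case: hf => d [_ h]; exists d.
  apply: (dense_mono _ (dense_ne0 hf2 nf2)) => x Vx f2x; split=> //.
  have := eig x Vx f2x; rewrite rP rootZ ?root_prod_XsubC //.
  by rewrite lead_coef_eq0 monic_neq0 // char_poly_monic.
(* On a dense set f takes its values in a finite list. Either f is the constant c, or f differs from
   c on a dense set and c can be struck off; the list cannot become empty. *)
elim: r den {rP} => [|c r IH] den.
  by have [x _ [_]] := dense_ex den.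
have [van|nvan] := excluded_middle_informative (forall x, V x -> ev f.1 x = c * ev f.2 x).
  by exists c.
apply: IH; have hfc : homogeneous (f.1 - c *: f.2).
  case: hf => d [h1 h2]; exists d; rewrite dhomogD // dhomogN.
  exact: dhomogZ.
have [x [Vx nx]] : exists x, V x /\ ev (f.1 - c *: f.2) x != 0.
  apply: NNPP => nex; apply: nvan => x Vx; apply/eqP/negPn/negP => ne.
  apply: nex; exists x; split=> //.
  by rewrite evB -mul_mpolyC evM evC subr_eq0.
apply: (dense_mono _ (dense_and irrV den (dense_ne0 hfc (ex_intro2 _ _ x Vx nx)))).
move=> y Vy [[f2y]]; rewrite in_cons => /orP [/eqP e|//].
by rewrite evB -mul_mpolyC evM evC /= -e divfK // subrr eqxx.
Qed.

End GlobalFunctions.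

(** * Linear forms on coefficients *)

Section CoefficientForms.
Variables (k K : fieldType) (iota : {rmorphism k -> K}) (n : nat).

Definition form_mpoly (lam : K -> k) (p : {mpoly K[n]}) : {mpoly k[n]} :=
  \sum_(m <- msupp p) lam p@_m *: 'X_[m].

Variable lam : K -> k.
Hypothesis hlam : linear_form iota lam.

Lemma linear_form0 : lam 0 = 0.
Proof. by have := hlam.2 0 0; rewrite mulr0 mul0r. Qed.

Lemma mcoeff_form_mpoly p m : (form_mpoly lam p)@_m = lam p@_m.
Proof.
rewrite /form_mpoly raddf_sum /=; under eq_bigr do rewrite mcoeffZ mcoeffX.
have [mp|nmp] := boolP (m \in msupp p).
  rewrite (bigD1_seq m) ?msupp_uniq //= eqxx mulr1 big1 ?addr0 // => i ne.
  by rewrite (negPf ne) mulr0.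
rewrite (memN_msupp_eq0 nmp) linear_form0 big1_seq // => i /= ip.
by have -> : (i == m) = false; [apply: contraNF nmp => /eqP <- | rewrite mulr0].
Qed.

Lemma form_mpoly_homog d p : p \is d.-homog -> form_mpoly lam p \is d.-homog.
Proof.
move=> hp; apply/dhomogP => m; rewrite mcoeff_msupp mcoeff_form_mpoly => ne.
apply: (dhomog_mf hp); rewrite mcoeff_msupp; apply: contraNneq ne => ->.
by rewrite linear_form0.
Qed.

(** Linearity of [lam] over k makes the action on polynomials linear over k[X]. For this reason the
    relations used in the descent need cofactors with coefficients in k. *)
Lemma form_mpolyM p g : form_mpoly lam (p * map_mpoly iota g) = form_mpoly lam p * g.
Proof.
apply/mpolyP => m; rewrite mcoeff_form_mpoly !mcoeffM (linear_form_sum _ _ _ hlam).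
apply: eq_bigr => i _; rewrite mcoeff_map_mpoly mcoeff_form_mpoly.
by rewrite mulrC hlam.2 mulrC.
Qed.

Lemma form_mpolyB p q : form_mpoly lam (p - q) = form_mpoly lam p - form_mpoly lam q.
Proof.
apply/mpolyP => m; rewrite mcoeffB !mcoeff_form_mpoly mcoeffB hlam.1.
by congr (_ + _); have := hlam.2 (-1) q@_m; rewrite rmorphN1 !mulN1r.
Qed.

Lemma form_mpoly_sum (T : Type) (s : seq T) (c : T -> K) (G : T -> {mpoly k[n]}) :
  form_mpoly lam (\sum_(i <- s) c i *: map_mpoly iota (G i)) =
  \sum_(i <- s) lam (c i) *: G i.
Proof.
apply/mpolyP => m; rewrite mcoeff_form_mpoly !raddf_sum /= (linear_form_sum _ _ _ hlam).
by apply: eq_bigr => i _; rewrite !mcoeffZ mcoeff_map_mpoly mulrC hlam.2 mulrC.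
Qed.

End CoefficientForms.

Section FormsOnVariety.
Variables (k K : fieldType) (iota : {rmorphism k -> K}) (n : nat).
Variable V : points K n.
Local Notation ev := (ev iota).

(** This is where [defined_over] enters: p is a K-combination of polynomials over k that vanish on
    V, and [lam] changes only the scalars. *)
Lemma form_mpoly_vanish lam d (p : {mpoly K[n]}) :
  linear_form iota lam -> defined_over iota V -> p \is d.-homog ->
  (forall x, V x -> p.@[x 0] = 0) ->
  forall x, V x -> ev (form_mpoly lam p) x = 0.
Proof.
move=> hlam defV hp van x Vx; have [s sV ->] := defV d p hp van.
rewrite (form_mpoly_sum hlam) ev_sum big_seq big1 // => u us.
by rewrite -mul_mpolyC evM (sV u us) ?mulr0.
Qed.

(* A coefficient in the span of the others can be eliminated; otherwise some
   form isolates it. *)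
Lemma linear_form_nonvanishing N (c : nat -> K) (G : nat -> {mpoly k[n]}) :
  (exists2 x, V x & (\sum_(i < N) c i *: map_mpoly iota (G i)).@[x 0] != 0) ->
  exists2 lam, linear_form iota lam &
    exists2 x, V x & ev (\sum_(i < N) lam (c i) *: G i) x != 0.
Proof.
elim: N G => [|N IH] G; first by move=> [x _]; rewrite big_ord0 meval0 eqxx.
pose S z := exists b : nat -> k, z = \sum_(i < N) iota (b i) * c i.
have subS : subspace_over iota S.
  split.
  - by exists (fun=> 0); rewrite big1 // => i _; rewrite rmorph0 mul0r.
  - move=> _ _ [b ->] [b' ->]; exists (fun i => b i + b' i).
    by rewrite -big_split; apply: eq_bigr => i _; rewrite rmorphD mulrDl.
  - move=> a _ [b ->]; exists (fun i => a * b i).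
    by rewrite mulr_sumr; apply: eq_bigr => i _; rewrite rmorphM mulrA.
rewrite big_ord_recr /=; have [[b eb]|nS] := excluded_middle_informative (S (c N)).
  move=> [x Vx ne]; have [|lam hlam [y Vy ney]] := IH (fun i => G i + b i *: G N).
    exists x => //; apply: contraNneq ne => eB; apply/eqP; rewrite -[RHS]eB; congr meval.
    rewrite eb scaler_suml -big_split; apply: eq_bigr => i _ /=.
    by rewrite rmorphD /= map_mpolyZ scalerDr scalerA [c i * _]mulrC.
  exists lam => //; exists y => //; apply: contraNneq ney.
  rewrite big_ord_recr /= => eB; apply/eqP; rewrite -[RHS]eB; congr (ev _ _).
  rewrite eb (linear_form_sum _ _ _ hlam) scaler_suml -big_split.
  by apply: eq_bigr => i _ /=; rewrite hlam.2 scalerDr scalerA [lam _ * _]mulrC.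
move=> [x Vx ne].
have [[y Vy ney]|nG] := excluded_middle_informative (exists2 y, V y & ev (G N) y != 0).
  have [lam [hlam lam1 lam0]] := linear_form_separates subS nS.
  exists lam => //; exists y => //; rewrite big_ord_recr /= lam1 scale1r big1 ?add0r //.
  move=> i _; rewrite lam0 ?scale0r //; exists (fun j : nat => (j == i :> nat)%:R).
  rewrite (bigD1 i) //= eqxx rmorph1 mul1r big1 ?addr0 // => j ne'.
  by rewrite -val_eqE /= in ne'; rewrite (negPf ne') rmorph0 mul0r.
have G0 y : V y -> ev (G N) y = 0.
  by move=> Vy; apply/eqP/negPn/negP => ney; apply: nG; exists y.
have [|lam hlam [y Vy ney]] := IH G.
  exists x => //; apply: contraNneq ne => e.
  by rewrite mevalD e mevalZ meval_map_mpoly [mmap _ _ _]G0 // mulr0 addr0.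
exists lam => //; exists y => //; rewrite big_ord_recr /= evD -mul_mpolyC evM.
by rewrite G0 // mulr0 addr0.
Qed.

Lemma form_mpoly_nonvanishing (s : {mpoly K[n]}) :
  (exists2 x, V x & s.@[x 0] != 0) ->
  exists2 lam, linear_form iota lam &
    exists2 x, V x & ev (form_mpoly lam s) x != 0.
Proof.
move=> ns; pose m i := nth 0%MM (msupp s) i.
have es : s = \sum_(i < size (msupp s)) s@_(m i) *: map_mpoly iota 'X_[m i].
  rewrite [LHS]mpolyE (big_nth 0%MM) big_mkord.
  by apply: eq_bigr => i _; rewrite map_mpolyX.
have [|lam hlam [x Vx ne]] :=
  @linear_form_nonvanishing (size (msupp s)) (fun i => s@_(m i)) (fun i => 'X_[m i]).
  by rewrite -es.
exists lam => //; exists x => //; apply: contraNneq ne => eB.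
by rewrite -[X in _ == X]eB [in X in _ == X]es (form_mpoly_sum hlam).
Qed.

End FormsOnVariety.

(** * Base change and descent *)

Section BaseChange.
Variables (k k' K : fieldType) (j : {rmorphism k -> k'}).
Variables (iota : {rmorphism k -> K}) (iota' : {rmorphism k' -> K}).
Hypothesis iotaE : forall c, iota' (j c) = iota c.

Definition rf_map n (f : rfun k n) : rfun k' n :=
  (map_mpoly j f.1, map_mpoly j f.2).

Let evj n (p : {mpoly k[n]}) x : ev iota' (map_mpoly j p) x = ev iota p x.
Proof. exact: ev_map. Qed.

Lemma homogeneous_map n (p : {mpoly k[n]}) : homogeneous p -> homogeneous (map_mpoly j p).
Proof. by move=> [d hp]; exists d; apply: dhomog_map. Qed.

Lemma near_map n (V : points K n) x U : near iota V x U -> near iota' V x U.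
Proof.
move=> [h [hh hx hU]]; exists (map_mpoly j h).
by split; rewrite ?evj //; [exact: homogeneous_map | move=> y Vy; rewrite evj; apply: hU].
Qed.

Lemma rat_fun_map n (V : points K n) f : rat_fun iota V f -> rat_fun iota' V (rf_map f).
Proof.
move=> [[d [h1 h2]] [x Vx n1] [y Vy n2]]; split.
- by exists d; split; apply: dhomog_map.
- by exists x; rewrite //= evj.
- by exists y; rewrite //= evj.
Qed.

Lemma rf_map_eq n (V : points K n) f g :
  rf_eq iota V f g -> rf_eq iota' V (rf_map f) (rf_map g).
Proof. by move=> e x Vx; rewrite /= !evj e. Qed.

Lemma rf_map_div n (f g : rfun k n) : rf_map (rf_div f g) = rf_div (rf_map f) (rf_map g).
Proof. by rewrite /rf_map /rf_div /= !rmorphM. Qed.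

Lemma rf_map_mul n (f g : rfun k n) : rf_map (rf_mul f g) = rf_mul (rf_map f) (rf_map g).
Proof. by rewrite /rf_map /rf_mul /= !rmorphM. Qed.

Lemma unit_value_map n (V : points K n) f x c :
  unit_value iota V f x c -> unit_value iota' V (rf_map f) x c.
Proof.
move=> [Rf [g [Rg fg g1 g2 ->]]]; split; first exact: rat_fun_map.
have evg1 : ev iota' (rf_map g).1 x = ev iota g.1 x := evj _ _.
have evg2 : ev iota' (rf_map g).2 x = ev iota g.2 x := evj _ _.
exists (rf_map g); split; [exact: rat_fun_map|exact: rf_map_eq|..].
- by rewrite evg1.
- by rewrite evg2.
- by rewrite evg1 evg2.
Qed.

Lemma unit_at_map n (V : points K n) f x :
  unit_at iota V f x -> unit_at iota' V (rf_map f) x.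
Proof. by move=> [c uc]; exists c; apply: unit_value_map. Qed.

Lemma is_divisor_map n (V : points K n) D :
  is_divisor iota V D -> is_divisor iota' V (div_base_change j D).
Proof.
move=> [RD nD]; split=> [x Vx|x Vx]; first exact/rat_fun_map/RD.
apply: near_map; have [h [hh hx hU]] := nD x Vx; exists h; split=> // y Vy hy.
by rewrite -rf_map_div; apply/unit_at_map/hU.
Qed.

Lemma lin_equiv_map n (V : points K n) D E :
  lin_equiv iota V D E -> lin_equiv iota' V (div_base_change j D) (div_base_change j E).
Proof.
move=> [h Rh H]; exists (rf_map h); first exact: rat_fun_map.
by move=> x Vx; rewrite /div_add /div_of -rf_map_mul -rf_map_div; apply/unit_at_map/H.
Qed.

Lemma morphism_map n m (V : points K n) (W : points K m) phi :
  morphism iota V W phi -> morphism iota' V W phi.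
Proof.
move=> H x Vx; have [Wx [d [F [hF nF pF]]]] := H x Vx; split=> //.
exists d, (fun i => map_mpoly j (F i)).
have rowE y : \row_i ev iota' (map_mpoly j (F i)) y = \row_i ev iota (F i) y.
  by apply/rowP => i; rewrite !mxE evj.
by split=> [i||y Vy]; rewrite ?rowE //; [apply: dhomog_map | apply: pF].
Qed.

Lemma closed_over_map n (V : points K n) : closed_over iota V -> closed_over iota' V.
Proof.
move=> [s hs HV]; exists [seq map_mpoly j p | p <- s].
  by move=> _ /mapP [p ps ->]; apply/homogeneous_map/hs.
move=> x; rewrite HV; split=> -[x0 sx]; split=> // p.
  by move=> /mapP [q qs ->]; rewrite evj sx.
by move=> ps; rewrite -evj; apply: sx; apply: map_f.
Qed.

(** Over k' the local equation may be a unit at points where it is not known to be one over k, so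
    [rf_map g] is not a composite by its definition alone. It is compared on a dense set with the
    composite that exists over k'. *)
Lemma div_pullback_map n m (V : points K n) (W : points K m) phi E D :
  irreducible_points V -> irreducible_points W -> morphism iota V W phi ->
  div_pullback iota V W phi E D ->
  div_pullback iota' V W phi (div_base_change j E) (div_base_change j D).
Proof.
move=> irrV irrW mphi H x Vx; have [g cg ug] := H x Vx.
exists (rf_map g); last by rewrite -rf_map_div; apply: unit_at_map.
have [RE Rg] := rf_comp_rat cg; have [_ [x1 [c [Vx1 uc]]] gE] := cg.
have Wphi := morphism_in mphi; have mphi' := morphism_map mphi.
have uE : unit_at iota' W (div_base_change j E (phi x)) (phi x1).
  by exists c; apply: unit_value_map.
have [g' cg'] := rf_comp_ex irrV irrW mphi' Vx1 uE.
have [_ Rg'] := rf_comp_rat cg'; have Rgm := rat_fun_map Rg.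
apply: (rf_comp_eq irrV irrW cg') => //; first exact: rat_fun_map.
apply: (rf_eq_dense irrV) => //; apply: (dense_mono _ (rf_comp_dense mphi cg)).
move=> y Vy [e ue]; exists e; split; last exact/unit_value_map/gE.
by case: cg' => _ _; apply=> //; apply: unit_value_map.
Qed.

Lemma class_pullback_map n m (V : points K n) (W : points K m) phi E D :
  irreducible_points V -> irreducible_points W -> morphism iota V W phi ->
  class_pullback iota V W phi E D ->
  class_pullback iota' V W phi (div_base_change j E) (div_base_change j D).
Proof.
move=> irrV irrW mphi [dD [E' [D' [dE' l1 dD' p l2]]]].
split; first exact: is_divisor_map.
exists (div_base_change j E'), (div_base_change j D'); split.
- exact: is_divisor_map.
- exact: lin_equiv_map.
- exact: is_divisor_map.
- exact: div_pullback_map.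
- exact: lin_equiv_map.
Qed.

End BaseChange.

Section Descent.
Variables (k : fieldType) (K : closedFieldType) (iota : {rmorphism k -> K}).
Variables (n : nat) (V : points K n).
Local Notation id_K := (idfun : {rmorphism K -> K}).
Hypotheses (irrV : irreducible_points V) (clV : closed_over iota V).
Hypothesis defV : defined_over iota V.
Local Notation evk := (ev iota).
Local Notation evK := (ev id_K).

(** A coordinate that is nonzero at x raises the degree; with positive degree, h vanishes at the
    zero vector, as [regular_basic_open] needs. *)
Lemma near_positive_degree x U : V x -> near iota V x U -> exists h d,
  [/\ h \is d.-homog, (0 < d)%N, evk h x != 0 &
    forall y, V y -> evk h y != 0 -> U y].
Proof.
move=> Vx [h [[d hh] hx hU]]; have /rV0Pn [i xi] := closed_over_nonzero clV Vx.
exists (h * 'X_i), (d + 1)%N; split; rewrite ?addn1 //.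
- by rewrite -addn1; apply: dhomogM => //; exact: dhomogXi.
- by rewrite evM evX mulf_neq0.
- by move=> y Vy; rewrite evM mulf_eq0 negb_or => /andP [hy _]; apply: hU.
Qed.

Lemma unit_regular (k' : fieldType) (iota' : {rmorphism k' -> K}) f x :
  unit_at iota' V f x -> regular_at iota' V f x.
Proof.
move=> [c [Rf [g [Rg fg g1 g2 _]]]]; exists (ev iota' g.1 x / ev iota' g.2 x), g.
by split=> //; case: Rg.
Qed.

Lemma cancel_on (k' : fieldType) (iota' : {rmorphism k' -> K}) d
    (h p q : {mpoly k'[n]}) :
  homogeneous h -> (exists2 x, V x & ev iota' h x != 0) ->
  p \is d.-homog -> q \is d.-homog ->
  (forall x, V x -> ev iota' h x * ev iota' p x = ev iota' h x * ev iota' q x) ->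
  forall x, V x -> ev iota' p x = ev iota' q x.
Proof.
move=> hh nh hp hq e; apply: (ev_dense_eq irrV hp hq).
apply: (dense_mono _ (dense_ne0 hh nh)) => y Vy hy; exact: (mulfI hy (e y Vy)).
Qed.

(** Regularity gives a fraction over k whose denominator is nonzero at x. Comparison with a fraction
    over K that has both terms nonzero at x shows that its numerator is nonzero there too. *)
Lemma unit_at_descent f x : rat_fun iota V f -> V x -> regular_at iota V f x ->
  unit_at id_K V (rf_map iota f) x -> unit_at iota V f x.
Proof.
move=> Rf Vx [_ [g [[d [hg1 hg2]] g2 fg _]]] [_ [_ [e [Re fe e1 e2 _]]]].
have [[d' [he1 he2]] _ _] := Re; have [_ hf2] := rat_fun_homog Rf; have [_ _ nf2] := Rf.
have g1 : evk g.1 x != 0.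
  have := @cancel_on _ id_K (d + d') (map_mpoly iota f.2)
    (map_mpoly iota g.1 * e.2) (map_mpoly iota g.2 * e.1).
  have evE p y : evK (map_mpoly iota p) y = evk p y by exact: ev_map.
  move=> /(_ _ _ _ _ _ x Vx) H.
  apply: contraTneq isT => g1; have := mulf_neq0 g2 e1.
  rewrite -evE -evM -H ?evM ?evE ?g1 ?mul0r ?eqxx //.
  + by case: hf2 => d2 h2; exists d2; apply: dhomog_map.
  + by case: nf2 => y Vy ny; exists y; rewrite ?evE.
  + by apply: dhomogM => //; apply: dhomog_map.
  + by apply: dhomogM => //; apply: dhomog_map.
  + move=> y Vy; rewrite !evM !evE; have := fe y Vy; rewrite /= !evE => fe'.
    by rewrite mulrA [evk f.2 y * _]mulrC -fg // mulrAC fe'; ring.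
exists (evk g.1 x / evk g.2 x); split=> //; exists g; split=> //.
by split; [exists d | exists x | exists x].
Qed.

(* If D = div h over K, write h with a denominator over k and apply a k-linear
   form to the coefficients of its numerator. The result h' is again a section
   of O(D), so that h' / h is a global regular function, hence constant. *)
Theorem principal_descent D : is_divisor iota V D ->
  lin_equiv id_K V (div_base_change iota D) (@div0 K K n) ->
  lin_equiv iota V D (@div0 k K n).
Proof.
move=> dD [h Rh H]; have [RD nD] := dD.
have evE p y : evK (map_mpoly iota p) y = evk p y by exact: ev_map.
have dDK := is_divisor_map (iota' := id_K) (fun c => erefl) dD.
have RDK x : V x -> rat_fun id_K V (rf_map iota (D x)).
  by move=> Vx; case: dDK => R _; apply: R.
have uhD x : V x -> unit_at id_K V (rf_div h (rf_map iota (D x))) x.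
  move=> Vx; have RDx := RDK x Vx; apply: unit_at_div_sym => //.
  by apply/(unit_at_div1 irrV x RDx Rh); apply: H.
have clVK := closed_over_map (iota' := id_K) (fun c => erefl) clV.
(* Near x the quotient h / D x is regular, hence of the form s / w^N. This rewrites h as s (D x).1 /
   (w^N (D x).2), where only s has coefficients in K. *)
have glob x : V x -> exists w d N s e, [/\ w \is d.-homog, evk w x != 0,
    s \is (d * N).-homog, h.1 \is e.-homog /\ h.2 \is e.-homog &
    forall y, V y -> evK h.1 y * evk (D x).2 y * evk w y ^+ N =
      evK s y * (evK h.2 y * evk (D x).1 y)].
  move=> Vx; have [w [d [hw d0 wx wU]]] := near_positive_degree Vx (nD x Vx).
  have hpair : homog_pair (rf_div h (rf_map iota (D x))).
    by case: (rat_fun_div irrV Rh (RDK x Vx)).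
  have [|N [s [hs sE]]] := regular_basic_open clVK hpair (dhomog_map iota hw) d0.
    move=> y Vy; rewrite evE => wy; apply: unit_regular.
    have uDy := unit_at_map (iota' := id_K) (fun c => erefl) (wU y Vy wy).
    rewrite rf_map_div in uDy.
    exact: (unit_at_div_trans irrV Rh (RDK y Vy) (RDK x Vx) (uhD y Vy) uDy).
  have [[e [h1 h2]] _ _] := Rh.
  exists w, d, N, s, e; split=> // y Vy.
  by rewrite -!evE -(evM id_K h.1) -(evM id_K h.2); exact: (sE y Vy).
have [[x0 Vx0] _] := irrV.
have [w0 [d0 [N0 [s [e [hw0 w0x hs [hh1 hh2] sE]]]]]] := glob x0 Vx0.
have RD0 := RD x0 Vx0; set D0 := D x0 in sE RD0.
have [hD01 hD02] := rat_fun_homog RD0; have [[dD0 [D01 D02]] nD01 nD02] := RD0.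
have [hh1' hh2'] := rat_fun_homog Rh; have [_ nh1 nh2] := Rh.
have hw0' : homogeneous w0 by exists d0.
have nw0 : exists2 x, V x & evk w0 x != 0 by exists x0.
have ns : exists2 x, V x & s.@[x 0] != 0.
  have hD02' : homogeneous (map_mpoly iota D0.2) by exact: homogeneous_map.
  have [x Vx [[h1x D2x] w0x']] := dense_ex (dense_and irrV
    (dense_and irrV (dense_ne0 hh1' nh1) (dense_ne0 hD02 nD02)) (dense_ne0 hw0' nw0)).
  exists x => //; apply: contraNneq h1x => sx; have /eqP := sE x Vx.
  rewrite -[evK s x]/(s.@[x 0]) sx mul0r !mulf_eq0 expf_eq0 (negPf D2x) (negPf w0x').
  by rewrite andbF !orbF.
have [lam hlam ns'] := form_mpoly_nonvanishing iota ns.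
set s' := form_mpoly lam s in ns'.
have hs' : s' \is (d0 * N0).-homog by exact: (form_mpoly_homog hlam hs).
pose h' : rfun k n := (s' * D0.1, w0 ^+ N0 * D0.2).
have hwN : w0 ^+ N0 \is (d0 * N0).-homog by apply: dhomogMn.
have Rh' : rat_fun iota V h'.
  split=> /=.
  - by exists (d0 * N0 + dD0)%N; split; apply: dhomogM.
  - by apply: ne0_ex_mul => //; exists (d0 * N0)%N.
  - apply: ne0_ex_mul => //; first by exists (d0 * N0)%N.
    by exists x0; rewrite // evXn expf_neq0.
have reg' x : V x -> regular_at iota V (rf_div h' (D x)) x.
  move=> Vx; have [w [d [N [t [e' [hw wx ht _ tE]]]]]] := glob x Vx.
  have [[dDx [Dx1 Dx2]] _ _] := RD x Vx.
  have hwN' : w ^+ N \is (d * N).-homog by apply: dhomogMn.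
  pose a := D0.1 * (D x).2 * w ^+ N; pose b := w0 ^+ N0 * D0.2 * (D x).1.
  have ha : a \is (dD0 + dDx + d * N).-homog by do !apply: dhomogM.
  have hb : b \is (d0 * N0 + dD0 + dDx).-homog by do !apply: dhomogM.
  (* The expressions of h at x0 and at x agree, so F vanishes on V. Applying [lam] to its
     coefficients preserves this and replaces s and t by their images, which exhibits h' / D x as
     [form_mpoly lam t] / w^N near x. *)
  pose F := s * map_mpoly iota a - t * map_mpoly iota b.
  pose M := (d0 * N0 + (dD0 + dDx + d * N))%N.
  have hsa : s * map_mpoly iota a \is M.-homog.
    by apply: dhomogM => //; apply: dhomog_map.
  have htb : t * map_mpoly iota b \is M.-homog.
    have -> : M = (d * N + (d0 * N0 + dD0 + dDx))%N by rewrite /M; ring.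
    by apply: dhomogM => //; apply: dhomog_map.
  have F0 y : V y -> F.@[y 0] = 0.
    move=> Vy; rewrite mevalB; apply/eqP; rewrite subr_eq0; apply/eqP; move: y Vy.
    apply: (@cancel_on _ id_K M h.2 _ _ hh2' nh2 hsa htb) => y Vy.
    rewrite !evM !evE !evM !evXn; have := sE y Vy; have := tE y Vy.
    move: (evK h.1 y) (evK h.2 y) (evK s y) (evK t y) => h1 h2 s0 t0.
    move: (evk D0.1 y) (evk D0.2 y) (evk (D x).1 y) (evk (D x).2 y) => p0 q0 px qx.
    move: (evk w y ^+ N) (evk w0 y ^+ N0) => wN w0N e1 e2.
    transitivity (s0 * (h2 * p0) * (qx * wN)); first by ring.
    rewrite -e2; transitivity (h1 * qx * wN * (q0 * w0N)); first by ring.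
    by rewrite e1; ring.
  have hF : F \is M.-homog by rewrite /F dhomogD // dhomogN.
  have lF := form_mpoly_vanish hlam defV hF F0.
  exists (evk (form_mpoly lam t) x / evk (w ^+ N) x), (form_mpoly lam t, w ^+ N).
  split=> //=; first by exists (d * N)%N; split=> //; exact: (form_mpoly_homog hlam ht).
    by rewrite evXn expf_neq0.
  move=> y Vy /=; have /eqP := lF y Vy.
  rewrite /F (form_mpolyB hlam) !(form_mpolyM hlam) evB subr_eq0 => /eqP.
  rewrite /= !evM -/s'; move: (evk s' y) (evk (form_mpoly lam t) y) => s0 t0 E.
  move: (evk D0.1 y) (evk D0.2 y) (evk (D x).1 y) (evk (D x).2 y) E => p0 q0 px qx.
  move: (evk (w ^+ N) y) (evk (w0 ^+ N0) y) => wN w0N E.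
  transitivity (s0 * (p0 * qx * wN)); first by ring.
  by rewrite E; ring.
have [c cE] : exists c, forall x, V x ->
    evK (rf_div (rf_map iota h') h).1 x = c * evK (rf_div (rf_map iota h') h).2 x.
  apply: (@regular_constant _ _ _ irrV clVK (rf_div (rf_map iota h') h)).
  - by case: (rat_fun_div irrV (rat_fun_map (iota' := id_K) (fun c => erefl) Rh') Rh).
  - by case: (rat_fun_div irrV (rat_fun_map (iota' := id_K) (fun c => erefl) Rh') Rh).
  - move=> x Vx; have [_ [g [[dg [g1 g2]] g2x gE _]]] := reg' x Vx.
    have [_ [_ [v [Rv hv v1 v2 _]]]] := uhD x Vx.
    have [[dv [hv1 hv2]] _ _] := Rv.
    pose r : rfun K n := (map_mpoly iota g.1 * v.2, map_mpoly iota g.2 * v.1).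
    exists (evK r.1 x / evK r.2 x), r; split=> //=.
    + by exists (dg + dv)%N; split; apply: dhomogM => //; apply: dhomog_map.
    + by rewrite evM evE mulf_neq0.
    + have RDx := RDK x Vx.
      have Rh'K := rat_fun_map (iota' := id_K) (fun c => erefl) Rh'.
      apply: (rf_eq_trans_pair irrV _ _ _ (rf_eq_div_cancel id_K _ _ (rf_map iota (D x)))).
      * by case: (rat_fun_div irrV Rh'K Rh).
      * by rat_fun_tac.
      * by exists (dg + dv)%N; split; apply: dhomogM => //; apply: dhomog_map.
      apply: (@rf_eq_div _ _ id_K _ V _ (rf_map iota g) _ v _ hv); rewrite -rf_map_div.
      exact: (rf_map_eq (iota' := id_K) (fun c => erefl) gE).
have hh'1 : homogeneous h'.1 by case: (rat_fun_homog Rh').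
have c0 : c != 0.
  have [_ nh'1 _] := Rh'.
  have [x Vx [h1x h2x]] := dense_ex (dense_and irrV (dense_ne0 hh'1 nh'1) (dense_ne0 hh2' nh2)).
  have : evK (rf_div (rf_map iota h') h).1 x != 0.
    by rewrite (evM id_K) evE mulf_neq0.
  by rewrite cE //; apply: contraNneq => ->; rewrite mul0r.
exists h' => // x Vx; have [RDx RDKx] := (RD x Vx, RDK x Vx).
(* Over K, h' is the nonzero multiple c h, so h' / D x is a unit at x; as it is regular over k, it
   is a unit over k. *)
suff u : unit_at iota V (rf_div h' (D x)) x.
  by apply/(unit_at_div1 irrV x RDx Rh')/unit_at_div_sym.
apply: unit_at_descent => //; [exact: rat_fun_div|exact: reg'|].
have Rh'K := rat_fun_map (iota' := id_K) (fun c => erefl) Rh'.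
have ch := rf_eq_constant_multiple cE.
rewrite rf_map_div; apply: (unit_at_eq irrV (rf_eq_div ch (@rf_eq_refl _ _ id_K _ _ _))).
  exact: rat_fun_div.
exact: unit_at_mul_div (unit_at_const id_K irrV x c0) (uhD x Vx).
Qed.

End Descent.

(** * Moving lemma *)

Section Moving.
Variables (k : fieldType) (K : closedFieldType) (iota : {rmorphism k -> K}).
Variables (n : nat) (V : points K n).
Hypotheses (irrV : irreducible_points V) (clV : closed_over iota V).
Local Notation ev := (ev iota).
Local Notation reg_value := (reg_value iota V).
Implicit Types f g h t : rfun k n.

Lemma reg_value_mul f g x c e : reg_value f x c -> reg_value g x e ->
  reg_value (rf_mul f g) x (c * e).
Proof.
move=> [f' [[d [f1 f2]] f2x ff' ->]] [g' [[d' [g1 g2]] g2x gg' ->]].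
exists (rf_mul f' g'); rewrite /= !evM mulf_div; split; rewrite ?mulf_neq0 //.
- by exists (d + d')%N; split; apply: dhomogM.
- exact: rf_eq_mul.
Qed.

Definition rf_add f g : rfun k n := (f.1 * g.2 + g.1 * f.2, f.2 * g.2).

Lemma homog_pair_add f g : homog_pair f -> homog_pair g -> homog_pair (rf_add f g).
Proof.
move=> [d [f1 f2]] [e [g1 g2]]; exists (d + e)%N; split; last exact: dhomogM.
by apply: dhomogD; [apply: dhomogM | rewrite addnC; apply: dhomogM].
Qed.

Lemma reg_value_add f g x c e : reg_value f x c -> reg_value g x e ->
  reg_value (rf_add f g) x (c + e).
Proof.
move=> [f' [hf f2x ff' ->]] [g' [hg g2x gg' ->]].
exists (rf_add f' g'); split; [exact: homog_pair_add|by rewrite evM mulf_neq0|..].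
  move=> y Vy; rewrite /= !evD !evM; have := ff' y Vy; have := gg' y Vy.
  move: (ev f.1 y) (ev f.2 y) (ev f'.1 y) (ev f'.2 y) => a b a' b'.
  move: (ev g.1 y) (ev g.2 y) (ev g'.1 y) (ev g'.2 y) => p q p' q' e1 e2.
  transitivity ((a * b') * (q * q') + (p * q') * (b * b')); first by ring.
  by rewrite e1 e2; ring.
by rewrite /= evD !evM addf_div.
Qed.

Lemma reg_value_proj f x y c : proj_eq x y -> reg_value f x c -> reg_value f y c.
Proof.
move=> [l l0 ->] [g [[d [g1 g2]] g2x fg ->]]; exists g; split=> //.
- by exists d.
- move: g2x; rewrite (ev_scale _ _ _ g2) mulf_eq0 expf_eq0 (negPf l0) andbF //.
- rewrite (ev_scale _ _ _ g1) (ev_scale _ _ _ g2) -mulf_div divff ?mul1r //.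
  by rewrite expf_neq0.
Qed.

Lemma reg_value_eq f f' x c : homog_pair f' ->
  homogeneous f.2 -> (exists2 y, V y & ev f.2 y != 0) ->
  rf_eq iota V f f' -> reg_value f x c -> reg_value f' x c.
Proof.
move=> [d' [f1' f2']] hf2 nf2 ff' [g [[d [g1 g2]] g2x fg ->]].
exists g; split=> //; first by exists d.
move=> y Vy; rewrite -!evM; move: y Vy.
apply: (@cancel_on K n V irrV k iota (d' + d) f.2) => //.
- exact: dhomogM.
- by rewrite addnC; apply: dhomogM.
- move=> y Vy; rewrite !evM; have := ff' y Vy; have := fg y Vy.
  move: (ev f.1 y) (ev f.2 y) (ev f'.1 y) (ev f'.2 y) => a b a' b'.
  move: (ev g.1 y) (ev g.2 y) => p q e1 e2.
  transitivity (a' * b * q); first by ring.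
  by rewrite -e2; transitivity (a * q * b'); [ring|rewrite e1; ring].
Qed.

Lemma unit_of_reg_value f x c : rat_fun iota V f -> V x -> c != 0 ->
  reg_value f x c -> unit_value iota V f x c.
Proof.
move=> Rf Vx c0 [g [hg g2 fg ec]]; split=> //; exists g.
have g1 : ev g.1 x != 0 by apply: contraNneq c0 => e; rewrite ec e mul0r.
by split=> //; split=> //; exists x.
Qed.

Lemma reg_value_of_unit f x c : unit_value iota V f x c -> reg_value f x c.
Proof. by move=> [_ [g [[hg _ _] fg g1 g2 ->]]]; exists g. Qed.

(** A nonzero 2 by 2 minor of the coordinates of p and q in k provides the form; if all minors
    vanish, the points are proportional. *)
Lemma separating_linear_form p q : V p -> V q ->
  rational_point iota p -> rational_point iota q -> ~ proj_eq q p ->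
  exists l : {mpoly k[n]}, [/\ l \is 1.-homog, ev l p = 0 & ev l q != 0].
Proof.
move=> Vp Vq [p0 pp0] [q0 qq0] npq.
have hX := @dhomogXi k n.
have [[ij ne]|nex] := excluded_middle_informative
    (exists ij, p0 0 ij.1 * q0 0 ij.2 != p0 0 ij.2 * q0 0 ij.1).
  pose l := p0 0 ij.1 *: 'X_(ij.2) - p0 0 ij.2 *: 'X_(ij.1) : {mpoly k[n]}.
  have hl : l \is 1.-homog by rewrite /l dhomogD // ?dhomogN dhomogZ.
  have evl z z0 : proj_eq z (map_mx iota z0) -> exists2 c, c != 0 &
      ev l z = c * iota (p0 0 ij.1 * z0 0 ij.2 - p0 0 ij.2 * z0 0 ij.1).
    move=> [c c0 ->]; exists c => //; rewrite (ev_scale _ _ _ hl) expr1.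
    by rewrite evB -!mul_mpolyC !evM !evC !evX !mxE rmorphB !rmorphM.
  exists l; split=> //.
    by have [c _ ->] := evl _ _ pp0; rewrite [X in X - _]mulrC subrr rmorph0 mulr0.
  by have [c c0 ->] := evl _ _ qq0; rewrite mulf_neq0 // fmorph_eq0 subr_eq0.
exfalso; apply: npq; apply: (proj_eq_trans qq0); apply/proj_eq_sym.
apply: (proj_eq_trans pp0).
have cross i j : p0 0 i * q0 0 j = p0 0 j * q0 0 i.
  by apply/eqP/negPn/negP => ne; apply: nex; exists (i, j).
have nz z z0 : V z -> proj_eq z (map_mx iota z0) -> exists i, z0 0 i != 0.
  move=> Vz [l _ ez]; apply/rV0Pn.
  by apply: contraNneq (closed_over_nonzero clV Vz) => e; rewrite ez e map_mx0 scaler0.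
have [i qi] := nz _ _ Vq qq0; have [j pj] := nz _ _ Vp pp0.
have pi : p0 0 i != 0.
  apply: contraNneq pj => pi; have /eqP := cross i j.
  by rewrite pi mul0r eq_sym mulf_eq0 (negPf qi) orbF.
exists (iota (p0 0 i / q0 0 i)); first by rewrite fmorph_eq0 mulf_neq0 ?invr_eq0.
apply/rowP => l; rewrite !mxE -rmorphM; congr (iota _).
by rewrite mulrAC cross mulfK.
Qed.

Definition rational_in (q : 'rV[K]_n) := V q /\ rational_point iota q.

Lemma separating_form (ps : seq 'rV[K]_n) q :
  (forall p, p \in ps -> rational_in p) -> rational_in q ->
  (forall p, p \in ps -> ~ proj_eq q p) ->
  exists l d, [/\ l \is d.-homog, (0 < d)%N, forall p, p \in ps -> ev l p = 0
    & ev l q != 0].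
Proof.
move=> rps [Vq rq]; elim: ps rps => [|p ps IH] rps nps.
  have /rV0Pn [i qi] := closed_over_nonzero clV Vq.
  exists 'X_i, 1%N; rewrite evX; split=> //.
  exact: dhomogXi.
have [||l [d [hl d0 lps lq]]] := IH.
- by move=> r rin; apply: rps; rewrite in_cons rin orbT.
- by move=> r rin; apply: nps; rewrite in_cons rin orbT.
have [Vp rp] := rps p (mem_head _ _).
have [l' [hl' l'p l'q]] := separating_linear_form Vp Vq rp rq (nps p (mem_head _ _)).
exists (l' * l), (1 + d)%N; split=> //; first exact: dhomogM.
  move=> r; rewrite in_cons evM => /orP [/eqP ->|rin]; first by rewrite l'p mul0r.
  by rewrite lps // mulr0.
by rewrite evM mulf_neq0.
Qed.

(** If u vanishes at the new point q, a form l is added that vanishes at the old points but not at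
    q. The powers equalise the degrees, and being positive they preserve the zeros; this works over
    finite fields as well. *)
Lemma nonvanishing_form (qs : seq 'rV[K]_n) :
  (forall q, q \in qs -> rational_in q) ->
  exists u d, [/\ u \is d.-homog, (0 < d)%N & forall q, q \in qs -> ev u q != 0].
Proof.
elim: qs => [|q qs IH] rqs.
  have [[x Vx] _] := irrV; have /rV0Pn [i xi] := closed_over_nonzero clV Vx.
  exists 'X_i, 1%N; split=> //.
  exact: dhomogXi.
have rqs' p : p \in qs -> rational_in p by move=> pin; apply: rqs; rewrite in_cons pin orbT.
have [u [d [hu d0 uqs]]] := IH rqs'.
have [uq|uq] := eqVneq (ev u q) 0; last first.
  by exists u, d; split=> // p; rewrite in_cons => /orP [/eqP ->|/uqs].
have [//|||l [e [hl e0 lqs lq]]] := @separating_form qs q.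
- exact: rqs (mem_head _ _).
- move=> p pin qp; have := uqs p pin.
  by rewrite -(ev_proj_eq0 iota _ qp) ?uq ?eqxx //; exists d.
exists (u ^+ e + l ^+ d), (d * e)%N; split.
- by apply: dhomogD; [|rewrite mulnC]; apply: dhomogMn.
- by rewrite muln_gt0 d0.
- move=> p; rewrite in_cons evD !evXn => /orP [/eqP ->|pin].
    by rewrite uq expr0n gtn_eqF // add0r expf_neq0.
  by rewrite lqs // expr0n gtn_eqF // addr0 expf_neq0 // uqs.
Qed.

Section Divisor.
Variables (D : divisor k K n) (qs : seq 'rV[K]_n).
Hypotheses (dD : is_divisor iota V D) (rqs : forall q, q \in qs -> rational_in q).

(** As [D p] is the local equation of D at p, this says that t is a section of the line bundle O(D)
    at the points of [qs]; a nonzero value means that t generates the bundle there. *)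
Definition section_at t := forall p, p \in qs -> exists c, reg_value (rf_mul (D p) t) p c.
Definition generates_at t q := exists2 c, c != 0 & reg_value (rf_mul (D q) t) q c.
Definition frac t := [/\ homog_pair t & exists2 x, V x & ev t.2 x != 0].

(* w extends the local equation of D at q: w^N / D(q) is regular at all the
   points of qs for N large. *)
Lemma local_generator q : q \in qs -> exists t, [/\ frac t, section_at t & generates_at t q].
Proof.
move=> qin; have [Vq _] := rqs qin; have [RD nD] := dD.
have [u [du [hu du0 uqs]]] := nonvanishing_form rqs.
have [w [e [hw e0 wq wU]]] := near_positive_degree clV Vq (nD q Vq).
have Np p : exists N, p \in qs -> forall M, (N <= M)%N -> exists a b d,
    [/\ a \is (e * M + d).-homog, b \is d.-homog, ev b p != 0 &
      forall y, V y -> ev (D p).1 y * ev (D q).2 y * ev w y ^+ M * ev b y =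
        ev a y * (ev (D p).2 y * ev (D q).1 y)].
  have [pin|nin] := boolP (p \in qs); last by exists 0%N.
  have [Vp _] := rqs pin.
  have [w' [e' [hw' e'0 w'p w'U]]] := near_positive_degree clV Vp (nD p Vp).
  have hww : w' * w \is (e' + e).-homog by apply: dhomogM.
  have Rpq : rat_fun iota V (rf_div (D p) (D q)) by apply: rat_fun_div => //; apply: RD.
  have [|||N [s [hs sE]]] := @regular_basic_open _ _ iota _ _ clV (rf_div (D p) (D q)) _ _ _ hww.
  - by case: Rpq.
  - by rewrite addn_gt0 e'0.
  - move=> y Vy; rewrite evM mulf_eq0 negb_or => /andP [w'y wy].
    apply: unit_regular; apply: (unit_at_div_trans irrV (g := D y)); try exact: RD.
      by apply: unit_at_div_sym (w'U y Vy w'y) => //; apply: RD.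
    exact: wU.
  exists N => _ M NM; exists (s * w ^+ (M - N)), (w' ^+ N), (e' * N)%N; split.
  - have -> : (e * M + e' * N)%N = ((e' + e) * N + e * (M - N))%N.
      by rewrite mulnDl -addnA -mulnDr subnKC // addnC.
    by apply: dhomogM => //; apply: dhomogMn.
  - exact: dhomogMn.
  - by rewrite evXn expf_neq0.
  - move=> y Vy; have := sE y Vy; rewrite /= !evM !evXn exprMn => e1.
    rewrite -{1}(subnKC NM) exprD.
    move: (ev (D p).1 y) (ev (D p).2 y) (ev (D q).1 y) (ev (D q).2 y) e1 => a b c d.
    move: (ev s y) (ev w y ^+ N) (ev w' y ^+ N) (ev w y ^+ (M - N)) => s0 x1 x2 x3 e1.
    transitivity (a * d * (x2 * x1) * x3); first by ring.
    by rewrite e1; ring.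
pose N p := proj1_sig (constructive_indefinite_description _ (Np p)).
have NP p : p \in qs -> forall M, (N p <= M)%N -> exists a b d,
    [/\ a \is (e * M + d).-homog, b \is d.-homog, ev b p != 0 &
      forall y, V y -> ev (D p).1 y * ev (D q).2 y * ev w y ^+ M * ev b y =
        ev a y * (ev (D p).2 y * ev (D q).1 y)].
  by rewrite /N; case: constructive_indefinite_description.
pose M := (\max_(p <- qs) N p)%N; pose m := (M * du)%N.
have Nm p : p \in qs -> (N p <= m)%N.
  move=> pin; apply: leq_trans (leq_pmulr M du0).
  exact: (@leq_bigmax_seq _ qs xpredT N).
have hwm : w ^+ m \is (e * m).-homog by apply: dhomogMn.
have hum : u ^+ (M * e) \is (e * m).-homog.
  have -> : (e * m = du * (M * e))%N by rewrite /m; lia.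
  exact: dhomogMn.
have [[[dq [h1 h2]] n1 n2] RDq] := (RD q Vq, RD q Vq).
(* This is w^m / (u^(M e) D(q)). The exponent m = M du is at least each bound [N p], and the power
   of u, nonzero at all points of [qs], makes the degrees equal. *)
exists (w ^+ m * (D q).2, u ^+ (M * e) * (D q).1); split.
- split; first by exists (e * m + dq)%N; split; apply: dhomogM.
  apply: ne0_ex_mul => //; first by exists (e * m)%N.
    by exists dq.
  by exists q; rewrite // evXn expf_neq0 // uqs.
- move=> p pin; have [Vp _] := rqs pin; have [a [b [d [ha hb bp abE]]]] := NP p pin m (Nm p pin).
  exists (ev a p / (ev b p * ev (u ^+ (M * e)) p)), (a, b * u ^+ (M * e)).
  split=> /=; [|by rewrite evM evXn !mulf_neq0 // expf_neq0 // uqs| |by rewrite evM].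
    by exists (e * m + d)%N; split=> //; rewrite addnC; apply: dhomogM.
  move=> y Vy; have := abE y Vy; rewrite /= !evM !evXn.
  move: (ev (D p).1 y) (ev (D p).2 y) (ev (D q).1 y) (ev (D q).2 y) => p1 p2 q1 q2.
  move: (ev a y) (ev b y) (ev w y ^+ m) (ev u y ^+ (M * e)) => a0 b0 w0 u0 e1.
  transitivity (p1 * q2 * w0 * b0 * u0); first by ring.
  by rewrite e1; ring.
- exists (ev (w ^+ m) q / ev (u ^+ (M * e)) q).
    by rewrite !evXn mulf_neq0 ?invr_eq0 ?expf_neq0 // uqs.
  exists (w ^+ m, u ^+ (M * e)); split=> //=; first by exists (e * m)%N.
    by rewrite evXn expf_neq0 // uqs.
  by move: (w ^+ m) (u ^+ (M * e)) => a b; rf_ring.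
Qed.

(** The list may contain several coordinate vectors of one point, which no form separates; the local
    equations of D at them differ by a unit. *)
Lemma generates_at_proj h p q : p \in qs -> q \in qs -> frac h -> proj_eq q p ->
  generates_at h p -> generates_at h q.
Proof.
move=> pin qin [[d [h1 h2]] nh] qp [c c0 rc].
have [[Vp _] [Vq _]] := (rqs pin, rqs qin); have [RD nD] := dD.
have [a ua] : unit_at iota V (rf_div (D q) (D p)) q.
  have [w [hw wp wU]] := nD p Vp; apply: wU => //.
  by rewrite (ev_proj_eq0 iota hw qp).
have [RDp RDq] := (RD p Vp, RD q Vq).
exists (a * c); first by rewrite mulf_neq0 // (unit_value_neq0 ua).
have r := reg_value_mul (reg_value_of_unit ua) (reg_value_proj (proj_eq_sym qp) rc).
have [hDp1 hDp2] := rat_fun_homog RDp; have [_ nDp1 nDp2] := RDp.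
have [hDq1 hDq2] := rat_fun_homog RDq; have [[dq [q1 q2]] _ nDq2] := RDq.
apply: reg_value_eq r.
- by exists (dq + d)%N; split; apply: dhomogM.
- by do 2?apply: homogeneousM => //; exists d.
- by do 2?apply: ne0_ex_mul => //; [apply: homogeneousM|apply: homogeneousM => //; exists d|exists d].
- rf_ring.
Qed.

(** If h fails to generate at the new point q, the term eps t is added, where t generates at q and
    eps = l^du / u^e vanishes at the old points but not at q. The value at q was 0 and becomes
    nonzero, while the old values do not change. *)
Lemma simultaneous_generator (ps : seq 'rV[K]_n) : {subset ps <= qs} ->
  exists h, [/\ frac h, section_at h & forall p, p \in ps -> generates_at h p].
Proof.
elim: ps => [|q ps IH] sub.
  have [qs0|[q qin]] : (forall q, q \notin qs) \/ (exists q, q \in qs).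
    by case: (qs) => [|q s]; [left|right; exists q; rewrite mem_head].
    exists (rf1 k n); split=> // [|p pin]; last by have := qs0 p; rewrite pin.
    by have [] := rat_fun1 iota irrV.
  by have [t [ft st _]] := local_generator qin; exists t; split.
have qin : q \in qs by apply: sub; rewrite mem_head.
have [|h [fh sh gh]] := IH; first by move=> p pin; apply: sub; rewrite in_cons pin orbT.
have [gq|ngq] := excluded_middle_informative (generates_at h q).
  by exists h; split=> // p; rewrite in_cons => /orP [/eqP ->|/gh].
have [t [ft st [ct ct0 tq]]] := local_generator qin.
have subp p : p \in ps -> p \in qs by move=> pin; apply: sub; rewrite in_cons pin orbT.
have [|||l [e [hl e0 lps lq]]] := @separating_form ps q.
- by move=> p /subp /rqs.
- exact: rqs.
- by move=> p pin qp; apply: ngq; apply: generates_at_proj qp (gh p pin) => //; apply: subp.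
have [u [du [hu du0 uqs]]] := nonvanishing_form rqs.
pose eps : rfun k n := (l ^+ du, u ^+ e).
have heps : homog_pair eps.
  exists (e * du)%N; split; first exact: dhomogMn.
  by rewrite mulnC; apply: dhomogMn.
have repsE p : p \in qs -> reg_value eps p (ev l p ^+ du / ev u p ^+ e).
  move=> pin; exists eps; split; rewrite /= ?evXn //.
  by rewrite expf_neq0 // uqs.
pose et := rf_mul eps t.
have [het [net hh nh]] : homog_pair et /\ [/\ exists2 x, V x & ev et.2 x != 0,
    homog_pair h & exists2 x, V x & ev h.2 x != 0].
  case: ft fh => [[d [t1 t2]] nt2] [hh nh]; split; last split=> //.
    case: heps => d' [e1 e2]; exists (d' + d)%N; split; exact: dhomogM.
  case: heps => d' [_ e2]; apply: ne0_ex_mul => //; [by exists d'|by exists d|].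
  by have [Vq _] := rqs qin; exists q; rewrite //= evXn expf_neq0 // uqs.
have fadd : frac (rf_add h et).
  split; first exact: homog_pair_add.
  by case: hh het => d [_ h2] [d' [_ e2]]; apply: ne0_ex_mul => //; [exists d|exists d'].
have radd p a b c : p \in qs -> reg_value (rf_mul (D p) h) p a -> reg_value eps p b ->
    reg_value (rf_mul (D p) t) p c -> reg_value (rf_mul (D p) (rf_add h et)) p (a + b * c).
  move=> pin ra rb rc; have [Vp _] := rqs pin; have [RD _] := dD.
  have [[[dp [p1 p2]] np1 np2] RDp] := (RD p Vp, RD p Vp).
  have r := reg_value_add ra (reg_value_mul rb rc).
  case: hh het fadd heps ft => d [h1 h2] [d' [e1 e2]] [[da [a1 a2]] na] [d3 [ep1 ep2]] [[d4 [t1 t2]] nt].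
  have hDp2 : homogeneous (D p).2 by exists dp.
  apply: reg_value_eq r.
  - by exists (dp + da)%N; split; apply: dhomogM.
  - do ?apply: homogeneousM => //; [by exists d|by exists d3|by exists d4].
  - apply: ne0_ex_mul => //.
    + by apply: homogeneousM => //; exists d.
    + do ?apply: homogeneousM => //; [by exists d3|by exists d4].
    + by apply: ne0_ex_mul => //; exists d.
    + have [Vq _] := rqs qin.
      apply: ne0_ex_mul => //; [by exists d3|by apply: homogeneousM => //; exists d4| |].
        by exists q; rewrite //= evXn expf_neq0 // uqs.
      by apply: ne0_ex_mul => //; exists d4.
  - move=> y Vy; rewrite /= !(evM, evD, evXn).
    repeat match goal with |- context [Defs.ev ?i ?p ?y] =>
      let z := fresh in generalize (Defs.ev i p y); intro z end.
    by move: (_ ^+ du) (_ ^+ e) => A B; ring.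
exists (rf_add h et); split=> //.
- move=> p pin; have [a ra] := sh p pin; have [c rc] := st p pin.
  by exists (a + ev l p ^+ du / ev u p ^+ e * c); apply: radd => //; apply: repsE.
- move=> p; rewrite in_cons => /orP [/eqP ->|pin].
    have [a ra] := sh q qin; have a0 : a = 0.
      by apply/eqP/negPn/negP => ne; apply: ngq; exists a.
    exists (a + ev l q ^+ du / ev u q ^+ e * ct).
      by rewrite a0 add0r !mulf_neq0 ?invr_eq0 ?expf_neq0 // uqs.
    by apply: radd => //; apply: repsE.
  have [a a0 ra] := gh p pin; have [c rc] := st p (subp p pin).
  exists (a + ev l p ^+ du / ev u p ^+ e * c).
    by rewrite lps // expr0n gtn_eqF // !mul0r addr0.
  by apply: radd; [apply: subp| |apply/repsE/subp|].
Qed.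

Theorem moving_lemma : exists E, [/\ is_divisor iota V E, lin_equiv iota V E D &
  forall q, q \in qs -> avoids iota V E q].
Proof.
have [qs0|[q qin]] : (forall q, q \notin qs) \/ (exists q, q \in qs).
    by case: (qs) => [|q s]; [left|right; exists q; rewrite mem_head].
  exists D; split=> //; first exact: lin_equiv_refl.
  by move=> q qin; have := qs0 q; rewrite qin.
have [h [[hh nh2] _ gh]] := @simultaneous_generator qs (fun _ => id).
have [RD _] := dD; have [Vq _] := rqs qin; have RDq := RD q Vq.
have Rh : rat_fun iota V h.
  split=> //; have [c c0 [g [hg g2 e ec]]] := gh q qin.
  have g1 : ev g.1 q != 0 by apply: contraNneq c0 => e0; rewrite ec e0 mul0r.
  case: hg hh => d [hg1 hg2] [d' [hh1 hh2]].
  have [[_ hD2] [_ _ nD2]] := (rat_fun_homog RDq, RDq).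
  have [y Vy [g1y [D2y h2y]]] := dense_ex (dense_and irrV
    (dense_ne0 (ex_intro _ d hg1) (ex_intro2 _ _ q Vq g1))
    (dense_and irrV (dense_ne0 hD2 nD2) (dense_ne0 (ex_intro _ d' hh2) nh2))).
  exists y => //; apply: contraTneq isT => h1y; have := e y Vy; rewrite /= !evM h1y.
  rewrite mulr0 mul0r => /esym /eqP.
  by rewrite !mulf_eq0 (negPf g1y) (negPf D2y) (negPf h2y).
have dh := is_divisor_of irrV Rh; exists (div_add D (div_of h)); split.
- exact: is_divisor_add.
- exists h => // x Vx; have RDx := RD x Vx.
  unit_by irrV (ex_intro _ 1 (unit_value1 iota irrV x)).
- move=> p pin; have [Vp _] := rqs pin; have [c c0 rc] := gh p pin.
  exists c; apply: unit_of_reg_value => //; apply: rat_fun_mul => //; exact: RD.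
Qed.

End Divisor.
End Moving.

(** * Segre products and morphisms *)

Section SegreCoordinates.
Variables (K : fieldType) (n m : nat).
Implicit Types (x : 'rV[K]_n) (y : 'rV[K]_m).

Lemma segE x y i j : seg x y 0 (mxvec_index i j) = x 0 i * y 0 j.
Proof. by rewrite mxvecE mxE big_ord1 mxE. Qed.

Lemma vec_mx_seg x y i j : vec_mx (seg x y) i j = x 0 i * y 0 j.
Proof. by rewrite mxvecK mxE big_ord1 mxE. Qed.

Lemma seg_neq0 x y : x != 0 -> y != 0 -> seg x y != 0.
Proof.
move=> /rV0Pn [i xi] /rV0Pn [j yj]; apply/rV0Pn; exists (mxvec_index i j).
by rewrite segE mulf_neq0.
Qed.

Lemma seg_proj x x' y y' : proj_eq x x' -> proj_eq y y' ->
  proj_eq (seg x y) (seg x' y').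
Proof.
move=> [l l0 ->] [c c0 ->]; exists (l * c); first exact: mulf_neq0.
by apply/rowP => z; case/mxvec_indexP: z => i j; rewrite mxE !segE !mxE mulrACA.
Qed.

Lemma seg1_proj x y : x != 0 -> y != 0 -> proj_eq (seg1 (seg x y)) x.
Proof.
move=> x0 /rV0Pn [j yj]; rewrite /seg1.
have colE i : (col i (vec_mx (seg x y)))^T = y 0 i *: x.
  by apply/rowP => l; rewrite !mxE -/(vec_mx _) mulrC -vec_mx_seg [RHS]mxE.
case: pickP => [i|none].
  rewrite -trmx_eq0 colE scalemx_eq0 negb_or => /andP [yi _].
  by exists (y 0 i).
have := none j; rewrite -trmx_eq0 colE scalemx_eq0 negb_or x0 andbT => /negbT.
by rewrite yj.
Qed.

Lemma seg2_proj x y : x != 0 -> y != 0 -> proj_eq (seg2 (seg x y)) y.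
Proof.
move=> /rV0Pn [j xj] y0; rewrite /seg2.
have rowE i : row i (vec_mx (seg x y)) = x 0 i *: y.
  by apply/rowP => l; rewrite !mxE -/(vec_mx _) -vec_mx_seg [RHS]mxE.
case: pickP => [i|none].
  by rewrite rowE scalemx_eq0 negb_or => /andP [yi _]; exists (x 0 i).
have := none j; rewrite rowE scalemx_eq0 negb_or y0 andbT => /negbT.
by rewrite xj.
Qed.

End SegreCoordinates.

Section Morphisms.
Variables (k K : fieldType) (iota : {rmorphism k -> K}).
Local Notation ev := (ev iota).
Local Notation morphism := (morphism iota).

Lemma morphism_id n (V : points K n) : nonzero_points V -> morphism V V id.
Proof.
move=> nzV x Vx; split=> //; exists 1%N, (fun i => 'X_i).
have rowX y : \row_i ev ('X_i : {mpoly k[n]}) y = y by apply/rowP => i; rewrite mxE evX.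
split=> [i||y Vy _]; rewrite ?rowX; [exact: dhomogXi|exact: nzV|exact: proj_eq_refl].
Qed.

Lemma morphism_const n m (V : points K n) (W : points K m) w (w0 : 'rV[k]_m) :
  W w -> w != 0 -> proj_eq w (map_mx iota w0) -> morphism V W (fun=> w).
Proof.
move=> Ww wn0 ww0 x Vx; split=> //; exists 0%N, (fun i => (w0 0 i)%:MP).
have rowC y : \row_i ev ((w0 0 i)%:MP : {mpoly k[n]}) y = map_mx iota w0.
  by apply/rowP => i; rewrite !mxE evC.
split=> [i||y Vy _]; rewrite ?rowC //.
  by rewrite -alg_mpolyC dhomogZ ?dhomog1.
by case: ww0 wn0 => l _ ->; rewrite scalemx_eq0 negb_or => /andP [].
Qed.

Lemma row_ev_scale n m d (F : 'I_m -> {mpoly k[n]}) l x :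
  (forall i, F i \is d.-homog) ->
  \row_i ev (F i) (l *: x) = l ^+ d *: \row_i ev (F i) x.
Proof. by move=> hF; apply/rowP => i; rewrite !mxE (ev_scale _ _ _ (hF i)). Qed.

Lemma morphism_comp n m l (V : points K n) (W : points K m) (X : points K l) phi psi :
  morphism V W phi -> morphism W X psi -> morphism V X (psi \o phi).
Proof.
move=> mphi mpsi x Vx; have [Wx [d [F [hF nF pF]]]] := mphi x Vx.
have [Xx [e [G [hG nG pG]]]] := mpsi _ Wx; split=> //.
have /rV0Pn [i0] := nF; rewrite mxE => Fi0.
(* The extra factor [F i0] confines y to the set where F represents phi. *)
exists (d * e + d)%N, (fun i => (G i \mPo [tuple F i | i < m]) * F i0).
have rowE y : \row_i ev ((G i \mPo [tuple F i | i < m]) * F i0) y =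
    ev (F i0) y *: \row_i ev (G i) (\row_i ev (F i) y).
  by apply/rowP => i; rewrite !mxE evM ev_comp mulrC.
split=> [i||y Vy].
- by apply: dhomogM => //; apply: dhomog_comp.
- rewrite rowE scalemx_eq0 negb_or Fi0.
  have [c c0 ec] := pF x Vx nF; move: nG; rewrite ec (row_ev_scale _ _ hG).
  by rewrite scalemx_eq0 negb_or => /andP [].
- rewrite rowE scalemx_eq0 negb_or => /andP [Fi0y GFy].
  have nFy : \row_i ev (F i) y != 0 by apply/rV0Pn; exists i0; rewrite mxE.
  have [c c0 ec] := pF y Vy nFy; have [Wy _] := mphi y Vy.
  have rowG : \row_i ev (G i) (phi y) = c ^+ e *: \row_i ev (G i) (\row_i ev (F i) y).
    by rewrite ec (row_ev_scale _ _ hG).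
  apply: (proj_eq_trans (pG _ Wy _)); rewrite rowG.
    by rewrite scalemx_eq0 negb_or expf_neq0.
  exists (c ^+ e / ev (F i0) y); first by rewrite mulf_neq0 ?expf_neq0 ?invr_eq0.
  by rewrite scalerA divfK.
Qed.

Lemma morphism_seg n m l (V : points K n) (W : points K m) (X : points K l) phi psi :
  morphism V W phi -> morphism V X psi ->
  morphism V (segre W X) (fun x => seg (phi x) (psi x)).
Proof.
move=> mphi mpsi x Vx; have [Wx [d [F [hF nF pF]]]] := mphi x Vx.
have [Xx [e [G [hG nG pG]]]] := mpsi x Vx.
split; first by exists (phi x), (psi x).
pose H l0 := (mxvec (\matrix_(i, j) (F i * G j))) 0 l0.
have rowE y : \row_i ev (H i) y = seg (\row_i ev (F i) y) (\row_i ev (G i) y).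
  apply/rowP => z; case/mxvec_indexP: z => i j.
  by rewrite mxE segE /H mxvecE !mxE evM.
exists (d + e)%N, H; split=> [z||y Vy].
- by case/mxvec_indexP: z => i j; rewrite /H mxvecE mxE; apply: dhomogM.
- by rewrite rowE; apply: seg_neq0.
- rewrite rowE => /rV0Pn [z]; case/mxvec_indexP: z => i j.
  rewrite segE mulf_eq0 negb_or !mxE => /andP [Fi Gj].
  by apply: seg_proj; [apply: pF|apply: pG] => //; apply/rV0Pn;
    [exists i|exists j]; rewrite mxE.
Qed.

Lemma morphism_seg1 n m (V : points K n) (W : points K m) :
  nonzero_points V -> nonzero_points W -> scale_closed V ->
  morphism (segre V W) V (@seg1 K n m).
Proof.
move=> nzV nzW scV _ [x [y [Vx Wy ->]]].
split; first exact: (scV _ _ (seg1_proj (nzV _ Vx) (nzW _ Wy)) Vx).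
have /rV0Pn [j yj] := nzW y Wy.
have rowE x' y' : \row_i ev ('X_(mxvec_index i j) : {mpoly k[n * m]}) (seg x' y') = y' 0 j *: x'.
  by apply/rowP => i; rewrite !mxE evX segE mulrC.
exists 1%N, (fun i => 'X_(mxvec_index i j)); split=> [i||_ [x' [y' [Vx' Wy' ->]]]].
- exact: dhomogXi.
- by rewrite rowE scalemx_eq0 negb_or yj nzV.
- rewrite rowE scalemx_eq0 negb_or => /andP [y'j _].
  apply: (proj_eq_trans (seg1_proj (nzV _ Vx') (nzW _ Wy'))).
  by apply: proj_eq_sym; exists (y' 0 j).
Qed.

Lemma morphism_seg2 n m (V : points K n) (W : points K m) :
  nonzero_points V -> nonzero_points W -> scale_closed W ->
  morphism (segre V W) W (@seg2 K n m).
Proof.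
move=> nzV nzW scW _ [x [y [Vx Wy ->]]].
split; first exact: (scW _ _ (seg2_proj (nzV _ Vx) (nzW _ Wy)) Wy).
have /rV0Pn [i xi] := nzV x Vx.
have rowE x' y' : \row_j ev ('X_(mxvec_index i j) : {mpoly k[n * m]}) (seg x' y') = x' 0 i *: y'.
  by apply/rowP => j; rewrite !mxE evX segE.
exists 1%N, (fun j => 'X_(mxvec_index i j)); split=> [j||_ [x' [y' [Vx' Wy' ->]]]].
- exact: dhomogXi.
- by rewrite rowE scalemx_eq0 negb_or xi nzW.
- rewrite rowE scalemx_eq0 negb_or => /andP [x'i _].
  apply: (proj_eq_trans (seg2_proj (nzV _ Vx') (nzW _ Wy'))).
  by apply: proj_eq_sym; exists (x' 0 i).
Qed.

Lemma morphism_rational n m (V : points K n) (W : points K m) phi x :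
  nonzero_points W ->
  morphism V W phi -> V x -> rational_point iota x -> rational_point iota (phi x).
Proof.
move=> nzW mphi Vx [x0 [l l0 ex]]; have [Wx [d [F [hF nF pF]]]] := mphi x Vx.
exists (\row_i (F i).@[x0 0]); apply: (proj_eq_trans (pF x Vx nF)).
rewrite ex (row_ev_scale _ _ hF); exists (l ^+ d); first exact: expf_neq0.
by congr (_ *: _); apply/rowP => i; rewrite !mxE ev_map_mx.
Qed.

Lemma seg_rational n m (x : 'rV[K]_n) (y : 'rV[K]_m) :
  rational_point iota x -> rational_point iota y -> rational_point iota (seg x y).
Proof.
move=> [x0 xx0] [y0 yy0]; exists (seg x0 y0).
apply: (proj_eq_trans (seg_proj xx0 yy0)); suff -> : seg (map_mx iota x0) (map_mx iota y0) =
  map_mx iota (seg x0 y0) by exact: proj_eq_refl.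
by apply/rowP => z; case/mxvec_indexP: z => i j; rewrite mxE !segE !mxE rmorphM.
Qed.

End Morphisms.

Section SegreVariety.
Variables (k K : fieldType) (iota : {rmorphism k -> K}) (n m : nat).
Variables (V : points K n) (W : points K m).
Local Notation ev := (ev iota).

(** If p is nonzero at (x1, y1) and q at (x2, y2), irreducibility of W gives y such that p is
    nonzero at (x1, y) and q at (x2, y); irreducibility of V then gives x such that both are nonzero
    at (x, y). *)
Lemma irreducible_segre : irreducible_points V -> irreducible_points W ->
  irreducible_points (segre V W).
Proof.
move=> irrV irrW; have [[x0 Vx0] _] := irrV; have [[y0 Wy0] _] := irrW.
split=> [|d e p q hp hq pq]; first by exists (seg x0 y0), x0, y0.
pose Fx (y : 'rV[K]_m) l : {mpoly K[n]} :=
  mxvec (\matrix_(i < n, j < m) (y 0 j *: ('X_i : {mpoly K[n]}))) 0 l.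
pose Fy (x : 'rV[K]_n) l : {mpoly K[m]} :=
  mxvec (\matrix_(i < n, j < m) (x 0 i *: ('X_j : {mpoly K[m]}))) 0 l.
have hFx y l : Fx y l \is 1.-homog.
  by case/mxvec_indexP: l => i j; rewrite /Fx mxvecE mxE dhomogZ ?dhomogXi.
have hFy x l : Fy x l \is 1.-homog.
  by case/mxvec_indexP: l => i j; rewrite /Fy mxvecE mxE dhomogZ ?dhomogXi.
have evx (r : {mpoly K[n * m]}) (x : 'rV[K]_n) (y : 'rV[K]_m) : (r \mPo [tuple Fx y i | i < n * m]).@[x 0] = r.@[seg x y 0].
  rewrite -!ev_idfun ev_comp; congr (Defs.ev _ _ _).
  apply/rowP => z; case/mxvec_indexP: z => i j; rewrite mxE segE /Fx mxvecE mxE.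
  by rewrite ev_idfun mevalZ mevalXU mulrC.
have evy (r : {mpoly K[n * m]}) (x : 'rV[K]_n) (y : 'rV[K]_m) : (r \mPo [tuple Fy x i | i < n * m]).@[y 0] = r.@[seg x y 0].
  rewrite -!ev_idfun ev_comp; congr (Defs.ev _ _ _).
  apply/rowP => z; case/mxvec_indexP: z => i j; rewrite mxE segE /Fy mxvecE mxE.
  by rewrite ev_idfun mevalZ mevalXU.
have hcomp r b l (F : 'I_(n * m) -> {mpoly K[l]}) : r \is b.-homog ->
    (forall i, F i \is 1.-homog) -> homogeneous (r \mPo [tuple F i | i < n * m]).
  by move=> hr hF; exists (1 * b)%N; apply: dhomog_comp.
apply: NNPP => nor; have [nP nQ] := not_or_and _ _ nor.
have wit (r : {mpoly K[n * m]}) : ~ (forall z, segre V W z -> r.@[z 0] = 0) ->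
    exists x y, [/\ V x, W y & r.@[seg x y 0] != 0].
  move=> nall; apply: NNPP => nex; apply: nall => _ [x [y [Vx Wy ->]]].
  by apply/eqP/negPn/negP => ne; apply: nex; exists x, y.
have [x1 [y1 [Vx1 Wy1 p1]]] := wit p nP; have [x2 [y2 [Vx2 Wy2 q2]]] := wit q nQ.
rewrite -evy in p1; rewrite -evy in q2.
have dne l (X : points K l) (r : {mpoly K[l]}) z : homogeneous r -> X z ->
    r.@[z 0] != 0 -> dense X (fun x => r.@[x 0] != 0).
  by move=> hr Xz rz; exists r; split=> //; exists z.
have [y Wy [py qy]] := dense_ex (dense_and irrW
  (dne _ _ _ _ (hcomp _ _ _ _ hp (hFy x1)) Wy1 p1)
  (dne _ _ _ _ (hcomp _ _ _ _ hq (hFy x2)) Wy2 q2)).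
rewrite evy -evx in py; rewrite evy -evx in qy.
have [x Vx [px qx]] := dense_ex (dense_and irrV
  (dne _ _ _ _ (hcomp _ _ _ _ hp (hFx y)) Vx1 py)
  (dne _ _ _ _ (hcomp _ _ _ _ hq (hFx y)) Vx2 qy)).
have := mulf_neq0 px qx; rewrite !evx pq ?eqxx //.
by exists x, y.
Qed.

Lemma closed_over_segre : closed_over iota V -> closed_over iota W ->
  closed_over iota (segre V W).
Proof.
move=> [s hs HV] [t ht HW].
pose Z i j : {mpoly k[n * m]} := 'X_(mxvec_index i j).
(* The minors force rank one. The equations of V are imposed on every column and those of W on every
   row, because a nonzero column is a multiple of x and a nonzero row one of y. *)
pose minors := [seq Z u.1.1 u.1.2 * Z u.2.1 u.2.2 - Z u.1.1 u.2.2 * Z u.2.1 u.1.2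
  | u : ('I_n * 'I_m) * ('I_n * 'I_m)].
pose cols := [seq p \mPo [tuple Z i j | i < n] | p <- s, j <- enum 'I_m].
pose rows := [seq p \mPo [tuple Z i j | j < m] | p <- t, i <- enum 'I_n].
have evZ z i j : ev (Z i j) z = z 0 (mxvec_index i j) by rewrite evX.
exists (minors ++ cols ++ rows).
  move=> p; rewrite !mem_cat => /orP [/mapP [u _ ->]|/orP [|]].
  - by exists (1 + 1)%N; rewrite dhomogD // ?dhomogN; apply: dhomogM; exact: dhomogXi.
  - move=> /allpairsP [u [us _ ->]]; have [d hu] := hs _ us; exists (1 * d)%N.
    by apply: dhomog_comp => // i; exact: dhomogXi.
  - move=> /allpairsP [u [us _ ->]]; have [d hu] := ht _ us; exists (1 * d)%N.
    by apply: dhomog_comp => // i; exact: dhomogXi.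
move=> z; split=> [[x [y [/HV [x0 sx] /HW [y0 ty] ->]]]|[z0 van]].
  split; first exact: seg_neq0.
  move=> p; rewrite !mem_cat => /orP [/mapP [u _ ->]|/orP [|]].
  - by rewrite evB !evM !evZ !segE; ring.
  - move=> /allpairsP [u [us _ ->]]; rewrite ev_comp; have [d hu] := hs _ us.
    have -> : \row_i ev (Z i u.2) (seg x y) = y 0 u.2 *: x.
      by apply/rowP => i; rewrite !mxE evZ segE mulrC.
    by rewrite (ev_scale _ _ _ hu) sx // mulr0.
  - move=> /allpairsP [u [us _ ->]]; rewrite ev_comp; have [d hu] := ht _ us.
    have -> : \row_j ev (Z u.2 j) (seg x y) = x 0 u.2 *: y.
      by apply/rowP => i; rewrite !mxE evZ segE.
    by rewrite (ev_scale _ _ _ hu) ty // mulr0.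
have /rV0Pn [l] := z0; case/mxvec_indexP: l => i0 j0 zij.
pose x : 'rV[K]_n := \row_i z 0 (mxvec_index i j0).
pose y' : 'rV[K]_m := \row_j z 0 (mxvec_index i0 j).
pose c := (z 0 (mxvec_index i0 j0))^-1; have c0 : c != 0 by rewrite invr_eq0.
exists x, (c *: y'); split.
- apply/HV; split; first by apply/rV0Pn; exists i0; rewrite mxE.
  move=> p ps; rewrite -(_ : \row_i ev (Z i j0) z = x); last first.
    by apply/rowP => i; rewrite !mxE evZ.
  rewrite -ev_comp; apply: van; rewrite !mem_cat; apply/orP; right; apply/orP; left.
  by apply/allpairsP; exists (p, j0); rewrite mem_enum.
- apply/HW; split.
    by rewrite scalemx_eq0 negb_or c0; apply/rV0Pn; exists j0; rewrite mxE.
  move=> p ps; have [d hp] := ht p ps; rewrite (ev_scale _ _ _ hp).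
  rewrite -(_ : \row_j ev (Z i0 j) z = y'); last first.
    by apply/rowP => i; rewrite !mxE evZ.
  rewrite -ev_comp van ?mulr0 // !mem_cat; apply/orP; right; apply/orP; right.
  by apply/allpairsP; exists (p, i0); rewrite mem_enum.
- apply/rowP => l; case/mxvec_indexP: l => i j; rewrite segE !mxE mulrCA.
  have : ev (Z i j * Z i0 j0 - Z i j0 * Z i0 j) z = 0.
    apply: van; rewrite mem_cat; apply/orP; left.
    by apply/mapP; exists ((i, j), (i0, j0)); rewrite ?mem_enum.
  rewrite evB !evM !evZ => /subr0_eq <-; rewrite /c.
  by rewrite mulrC mulfK.
Qed.

End SegreVariety.

(** * Values of rational functions modulo powers *)

Section ModPowers.
Variables (k : fieldType) (m : nat).
Implicit Types x y z : k.

Lemma eq_mod_powers_refl x : x != 0 -> eq_mod_powers m x x.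
Proof. by move=> x0; split=> //; exists 1; rewrite ?oner_neq0 // expr1n mulr1. Qed.

Lemma eq_mod_powers_sym x y : eq_mod_powers m x y -> eq_mod_powers m y x.
Proof.
move=> [x0 y0 [u u0 e]]; split=> //; exists u^-1; first by rewrite invr_eq0.
by rewrite e exprVn mulfK // expf_neq0.
Qed.

Lemma eq_mod_powers_trans x y z :
  eq_mod_powers m x y -> eq_mod_powers m y z -> eq_mod_powers m x z.
Proof.
move=> [x0 y0 [u u0 e]] [_ z0 [v v0 e']]; split=> //.
by exists (v * u); [exact: mulf_neq0|rewrite e e' exprMn mulrA].
Qed.

Lemma eq_mod_powers_mul x y x' y' :
  eq_mod_powers m x y -> eq_mod_powers m x' y' -> eq_mod_powers m (x * x') (y * y').
Proof.
move=> [x0 y0 [u u0 e]] [x'0 y'0 [v v0 e']]; split; rewrite ?mulf_neq0 //.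
by exists (u * v); [exact: mulf_neq0|rewrite e e' exprMn mulrACA].
Qed.

End ModPowers.

Lemma div_base_change_muln (k k' K : fieldType) (j : {rmorphism k -> k'}) n
    (D : divisor k K n) m :
  div_base_change j (div_muln D m) = div_muln (div_base_change j D) m.
Proof.
by apply: functional_extensionality => x; rewrite /div_base_change /div_muln /rf_exp /= !rmorphXn.
Qed.

Lemma div_base_change_sub (k k' K : fieldType) (j : {rmorphism k -> k'}) n
    (D E : divisor k K n) :
  div_base_change j (div_sub D E) = div_sub (div_base_change j D) (div_base_change j E).
Proof.
by apply: functional_extensionality => x; rewrite /div_base_change /div_sub /rf_div /= !rmorphM.
Qed.

Lemma div_base_change0 (k k' K : fieldType) (j : {rmorphism k -> k'}) n :
  div_base_change j (@div0 k K n) = @div0 k' K n.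
Proof.
by apply: functional_extensionality => x; rewrite /div_base_change /div0 /rf1 /= !rmorph1.
Qed.

Lemma map_mpoly_id (K : fieldType) n (p : {mpoly K[n]}) :
  map_mpoly (idfun : {rmorphism K -> K}) p = p.
Proof. by apply/mpolyP => mm; rewrite mcoeff_map_mpoly. Qed.

Lemma div_base_change_id (K : fieldType) n (D : divisor K K n) :
  div_base_change (idfun : {rmorphism K -> K}) D = D.
Proof.
apply: functional_extensionality => x; rewrite /div_base_change !map_mpoly_id.
by case: (D x).
Qed.

(** Numerator and denominator have the same degree, so the scalar between x and a vector over k
    cancels, and the value lies in k. *)
Lemma unit_value_rational (k K : fieldType) (iota : {rmorphism k -> K}) n
    (V : points K n) f x :
  rational_point iota x -> unit_at iota V f x ->
  exists2 c, c != 0 & unit_value iota V f x (iota c).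
Proof.
move=> [x0 [l l0 ex]] [c0 [Rf [g [Rg fg g1 g2 ec]]]].
have [[d [h1 h2]] _ _] := Rg.
exists (g.1.@[x0 0] / g.2.@[x0 0]).
  apply: contraNneq (mulf_neq0 g1 (invr_neq0 g2)) => e.
  rewrite ex (ev_scale _ _ _ h1) (ev_scale _ _ _ h2) -mulf_div divff ?expf_neq0 //.
  by rewrite !ev_map_mx mul1r -fmorph_div e rmorph0.
split=> //; exists g; split=> //.
rewrite ex (ev_scale _ _ _ h1) (ev_scale _ _ _ h2) -mulf_div divff ?expf_neq0 //.
by rewrite !ev_map_mx mul1r -fmorph_div.
Qed.

Section Values.
Variables (k : fieldType) (K : closedFieldType) (iota : {rmorphism k -> K}).
Variables (n : nat) (V : points K n).
Hypotheses (irrV : irreducible_points V) (clV : closed_over iota V).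
Local Notation unit_at := (unit_at iota V).
Local Notation unit_value := (unit_value iota V).
Local Notation rat_fun := (rat_fun iota V).
Local Notation is_divisor := (is_divisor iota V).
Local Notation lin_equiv := (lin_equiv iota V).

Lemma avoids_proj D x y : is_divisor D -> V x -> V y -> proj_eq y x ->
  avoids iota V D x -> avoids iota V D y.
Proof.
move=> dD Vx Vy yx ux; have [h [hh hx hU]] := avoids_near irrV dD Vx ux.
by apply: hU => //; rewrite (ev_proj_eq0 iota hh yx).
Qed.

Lemma lin_equiv_double D : is_divisor D ->
  lin_equiv (div_add D D) D -> lin_equiv D (@div0 k K n).
Proof.
move=> dD [h Rh H]; exists h => // x Vx; have RDx := is_divisor_rat dD Vx.
unit_by irrV (H x Vx).
Qed.

Lemma lin_equiv_subxx D : is_divisor D -> lin_equiv (div_sub D D) (@div0 k K n).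
Proof.
move=> dD; exists (rf1 k n); first exact: rat_fun1.
move=> x Vx; have RDx := is_divisor_rat dD Vx.
unit_by irrV (ex_intro _ 1 (unit_value1 iota irrV x)).
Qed.

Lemma lin_equiv_of_sub D E : is_divisor D -> is_divisor E ->
  lin_equiv (div_sub D E) (@div0 k K n) -> lin_equiv D E.
Proof.
move=> dD dE [h Rh H]; exists h => // x Vx.
have RDx := is_divisor_rat dD Vx; have REx := is_divisor_rat dE Vx.
unit_by irrV (H x Vx).
Qed.

Lemma lin_equiv_sub0 D E : is_divisor D -> is_divisor E ->
  lin_equiv D E -> lin_equiv (div_sub D E) (@div0 k K n).
Proof.
move=> dD dE [h Rh H]; exists h => // x Vx.
have RDx := is_divisor_rat dD Vx; have REx := is_divisor_rat dE Vx.
unit_by irrV (H x Vx).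
Qed.

Lemma principal_div D : is_divisor D -> lin_equiv D (@div0 k K n) ->
  exists2 f, rat_fun f & div_eq iota V (div_of f) D.
Proof.
move=> dD [h Rh H]; exists h => // x Vx; have RDx := is_divisor_rat dD Vx.
apply: unit_at_div_sym => //.
by apply/(unit_at_div1 irrV x RDx Rh); apply: H.
Qed.

(** Constancy comes from [regular_constant] over K, so c is an element of K; comparisons with values
    in k are made at rational points. *)
Lemma unit_constant f : rat_fun f -> (forall x, V x -> unit_at f x) ->
  exists c, forall x, V x -> unit_value f x c.
Proof.
move=> Rf uf.
have clVK := closed_over_map (iota' := idfun) (fun c => erefl) clV.
have RfK := rat_fun_map (iota' := idfun) (fun c => erefl) Rf.
have ufK x : V x -> Defs.unit_at idfun V (rf_map iota f) x.
  by move=> Vx; apply: unit_at_map => //; apply: uf.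
have [hf nf1 nf2] := RfK.
have [c cE] := regular_constant irrV clVK hf nf2 (fun x Vx => unit_regular (ufK x Vx)).
have c0 : c != 0.
  by case: nf1 => x Vx; rewrite cE //; apply: contraNneq => ->; rewrite mul0r.
exists c => x Vx; have [e ue] := uf x Vx.
suff -> : c = e by [].
have ueK := unit_value_map (iota' := idfun) (fun c => erefl) ue.
have Rc : Defs.rat_fun idfun V (c%:MP, 1) := unit_at_rat (unit_at_const idfun irrV x c0).
apply: (unit_value_uniq irrV Vx _ (unit_value_eq irrV _ Rc ueK)).
  have := @unit_value_self _ _ idfun _ V (c%:MP, 1) x Rc.
  by rewrite /= evC ev1 divr1 oner_neq0; apply.
by move=> y Vy; rewrite /= ev1 mulr1 cE // evC.
Qed.

Lemma rational_ratio f a o : rational_point iota a -> rational_point iota o ->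
  unit_at f a -> unit_at f o -> exists2 r, r != 0 & ratio_value iota V f a o r.
Proof.
move=> ra ro ua uo; have [c c0 uc] := unit_value_rational ra ua.
have [e e0 ue] := unit_value_rational ro uo.
by exists (c / e); [rewrite mulf_neq0 ?invr_eq0|exists c, e].
Qed.

Lemma div_eq_unit m D f x : is_divisor D -> V x ->
  div_eq iota V (div_of f) (div_muln D m) -> rat_fun f ->
  avoids iota V D x -> unit_at f x.
Proof.
move=> dD Vx H Rf ux; have RDx := is_divisor_rat dD Vx.
unit_by irrV (unit_at_mul irrV (H x Vx) (unit_at_exp irrV m ux)).
Qed.

Lemma rf_exp_div (f g : rfun k n) m :
  rf_exp (rf_div f g) m = rf_div (rf_exp f m) (rf_exp g m).
Proof. by rewrite /rf_exp /rf_div /= !exprMn. Qed.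

Lemma rf_exp_mul (f g : rfun k n) m :
  rf_exp (rf_mul f g) m = rf_mul (rf_exp f m) (rf_exp g m).
Proof. by rewrite /rf_exp /rf_mul /= !exprMn. Qed.

Lemma unit_at_quotient (f1 f2 p1 p2 q : rfun k n) x :
  rat_fun f1 -> rat_fun f2 -> rat_fun p1 -> rat_fun p2 -> rat_fun q ->
  unit_at (rf_div f1 p1) x -> unit_at (rf_div f2 p2) x ->
  unit_at (rf_div p1 (rf_mul p2 q)) x -> unit_at (rf_div f1 (rf_mul f2 q)) x.
Proof.
move=> R1 R2 R3 R4 R5 u1 u2 u3.
unit_by irrV (unit_at_mul irrV (unit_at_div irrV u1 u2) u3).
Qed.

(* If D1 = D2 + div h, then f1 / (f2 h^m) is a global unit, hence constant. *)
Lemma ratio_lin_equiv m D1 D2 f1 f2 a o r1 r2 :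
  V a -> V o -> rational_point iota a -> rational_point iota o ->
  is_divisor D1 -> is_divisor D2 -> lin_equiv D1 D2 ->
  avoids iota V D1 a -> avoids iota V D1 o ->
  avoids iota V D2 a -> avoids iota V D2 o ->
  rat_fun f1 -> rat_fun f2 ->
  div_eq iota V (div_of f1) (div_muln D1 m) ->
  div_eq iota V (div_of f2) (div_muln D2 m) ->
  ratio_value iota V f1 a o r1 -> ratio_value iota V f2 a o r2 ->
  eq_mod_powers m r1 r2.
Proof.
move=> Va Vo ra ro dD1 dD2 [h Rh H] u1a u1o u2a u2o Rf1 Rf2 E1 E2.
move=> [c1 [e1 [v1a v1o ->]]] [c2 [e2 [v2a v2o ->]]].
have uh x : V x -> unit_at (D1 x) x -> unit_at (D2 x) x -> unit_at h x.
  move=> Vx u1 u2; have R1 := is_divisor_rat dD1 Vx; have R2 := is_divisor_rat dD2 Vx.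
  unit_by irrV (unit_at_div irrV u1 (unit_at_mul irrV u2 (H x Vx))).
have [ha ha0 vha] := unit_value_rational ra (uh a Va u1a u2a).
have [ho ho0 vho] := unit_value_rational ro (uh o Vo u1o u2o).
pose F := rf_div f1 (rf_mul f2 (rf_exp h m)).
have [||c Fc] := @unit_constant F.
- by rewrite /F; rat_fun_tac.
- move=> x Vx; have R1 := is_divisor_rat dD1 Vx; have R2 := is_divisor_rat dD2 Vx.
  have u1 := E1 x Vx; have u2 := E2 x Vx; have u3 := unit_at_exp irrV m (H x Vx).
  rewrite rf_exp_div rf_exp_mul in u3.
  by apply: (unit_at_quotient _ _ _ _ _ u1 u2 u3); rat_fun_tac.
have val x c0 e0 b0 : V x -> unit_value f1 x (iota c0) -> unit_value f2 x (iota e0) ->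
    unit_value h x (iota b0) -> c = iota (c0 / (e0 * b0 ^+ m)).
  move=> Vx w1 w2 w3; rewrite fmorph_div rmorphM rmorphXn.
  apply: (unit_value_uniq irrV Vx (Fc x Vx)).
  exact: (unit_value_div irrV w1 (unit_value_mul irrV w2 (unit_value_exp irrV m w3))).
have Ea := val a _ _ _ Va v1a v2a vha; have := val o _ _ _ Vo v1o v2o vho.
rewrite Ea => /fmorph_inj e.
have nz f x c0 : unit_value f x (iota c0) -> c0 != 0.
  by move=> /unit_value_neq0; rewrite fmorph_eq0.
have [[[c10 e10] c20] e20] := (nz _ _ _ v1a, nz _ _ _ v1o, nz _ _ _ v2a, nz _ _ _ v2o).
split; rewrite ?mulf_neq0 ?invr_eq0 //.
(* The constant f1 / (f2 h^m) has the same value at a and at o, so the two ratios differ by the m-th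
   power of h(a) / h(o). *)
exists (ha / ho); first by rewrite mulf_neq0 ?invr_eq0.
have ham0 : ha ^+ m != 0 by rewrite expf_neq0.
have hom0 : ho ^+ m != 0 by rewrite expf_neq0.
rewrite expr_div_n.
have -> : c1 = (c1 / (c2 * ha ^+ m)) * (c2 * ha ^+ m) by rewrite divfK // mulf_neq0.
rewrite e; move: (ha ^+ m) (ho ^+ m) ham0 hom0 => A B A0 B0.
by field; rewrite ?e10 ?e20 ?B0.
Qed.

End Values.

(** * The dual abelian variety *)

Lemma morphism_proj (k K : fieldType) (iota : {rmorphism k -> K}) n m
    (V : points K n) (W : points K m) phi x y :
  morphism iota V W phi -> V x -> V y -> proj_eq x y -> proj_eq (phi x) (phi y).
Proof.
move=> mphi Vx Vy xy; have [_ [d [F [hF nF pF]]]] := mphi y Vy.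
have pFy := pF y Vy nF; case: xy pF => l l0 -> pF in Vx *.
have e := row_ev_scale iota l y hF.
have nFx : \row_i ev iota (F i) (l *: y) != 0.
  by rewrite e scalemx_eq0 negb_or expf_neq0.
apply: (proj_eq_trans (pF _ Vx nFx)); apply: proj_eq_trans (proj_eq_sym pFy).
by exists (l ^+ d); rewrite ?expf_neq0.
Qed.

Lemma rational_idfun (K : fieldType) n (w : 'rV[K]_n) :
  proj_eq w (map_mx (idfun : {rmorphism K -> K}) w).
Proof. by rewrite map_mx_id //; apply: proj_eq_refl. Qed.

Lemma quasi_projective_idfun (K : fieldType) n (V : points K n) :
  irreducible_points V -> closed_over (idfun : {rmorphism K -> K}) V ->
  quasi_projective_variety (idfun : {rmorphism K -> K}) V.
Proof.
move=> irrV [s hs HV]; split=> //; last first.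
  move=> d p _ van; exists [:: (1, p)].
    by move=> u; rewrite mem_seq1 => /eqP -> x /van.
  by rewrite big_seq1 scale1r map_mpoly_id.
exists s, [:: 1]; split=> [p|x].
  rewrite mem_cat mem_seq1 => /orP [/hs //|/eqP ->].
  by exists 0%N; exact: dhomog1.
rewrite HV; split=> [[x0 sx]|[x0 sx _]]; split=> //.
by exists 1; rewrite ?mem_seq1 ?eqxx // ev1 oner_neq0.
Qed.

Section GroupVariety.
Variables (k K : fieldType) (iota : {rmorphism k -> K}) (n : nat) (G : group_data K n).
Hypothesis hG : abelian_variety iota G.

Lemma group_variety_closed : closed_over iota G.
Proof. by case: hG => [[]]. Qed.
Lemma group_irreducible : irreducible_points G.
Proof. by case: hG => [[]]. Qed.
Lemma group_defined : defined_over iota G.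
Proof. by case: hG => [[]]. Qed.
Lemma group_nonzero : nonzero_points G.
Proof. exact: closed_over_nonzero group_variety_closed. Qed.
Lemma group_scale_closed : scale_closed G.
Proof. exact: closed_over_scale_closed group_variety_closed. Qed.
Lemma group_zero : carrier G (zero_pt G).
Proof. by case: hG => _ [[]]. Qed.
Lemma group_zero_rational : rational_point iota (zero_pt G).
Proof. by case: hG => _ [[]]. Qed.
Lemma group_mul_morphism : morphism iota (segre G G) G (mul_map G).
Proof. by case: hG => _ [_ [[]]]. Qed.
Lemma group_add0 x : carrier G x -> proj_eq (add_pt G (zero_pt G) x) x.
Proof. by case: hG => _ [_ [_ [_ H _]]]; apply: H. Qed.

Lemma group_add x y : carrier G x -> carrier G y -> carrier G (add_pt G x y).
Proof. by move=> Gx Gy; apply: (morphism_in group_mul_morphism); exists x, y. Qed.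

Lemma group_iter a m : carrier G a -> carrier G (iter m (add_pt G a) (zero_pt G)).
Proof. by move=> Ga; elim: m => [|m IH] /=; [exact: group_zero | exact: group_add]. Qed.

Lemma group_add_rational x y : carrier G x -> carrier G y ->
  rational_point iota x -> rational_point iota y -> rational_point iota (add_pt G x y).
Proof.
move=> Gx Gy rx ry; apply: (morphism_rational group_nonzero group_mul_morphism).
  by exists x, y.
exact: seg_rational.
Qed.

Lemma group_add_proj x x' y y' : carrier G x -> carrier G x' -> carrier G y -> carrier G y' ->
  proj_eq x x' -> proj_eq y y' -> proj_eq (add_pt G x y) (add_pt G x' y').
Proof.
move=> Gx Gx' Gy Gy' xx' yy'; apply: (morphism_proj group_mul_morphism).
- by exists x, y.
- by exists x', y'.
- exact: seg_proj.
Qed.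

Lemma translation_morphism a : carrier G a -> rational_point iota a ->
  morphism iota G G (fun x => add_pt G x a).
Proof.
move=> Ga [a0 aa0].
have mc := morphism_const (V := G) Ga (group_nonzero Ga) aa0.
exact: (morphism_comp (morphism_seg (morphism_id iota group_nonzero) mc) group_mul_morphism).
Qed.

End GroupVariety.

Section Dual.
Variables (k : fieldType) (K : closedFieldType) (iota : {rmorphism k -> K}).
Variables (n n' : nat) (A : group_data K n) (B : group_data K n').
Variable P : divisor k K (n * n').
Hypotheses (hA : abelian_variety iota A) (hB : dual_abelian_variety iota A B P).
Local Notation id_K := (idfun : {rmorphism K -> K}).
Local Notation PK := (div_base_change iota P).
Local Notation X := (segre A B).
Local Notation lin_equivK := (lin_equiv id_K).
Local Notation class_pullbackK := (class_pullback id_K).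
Local Notation slice b := (fun x => seg x b).
Local Notation coslice a := (fun y => seg a y).

Lemma dual_group : abelian_variety iota B.
Proof. by case: hB. Qed.

Let irrA := group_irreducible hA.
Let irrB := group_irreducible dual_group.
Let nzA := group_nonzero hA.
Let nzB := group_nonzero dual_group.
Let scA := group_scale_closed hA.
Let scB := group_scale_closed dual_group.
Let A0 := group_zero hA.
Let B0 := group_zero dual_group.

Lemma product_irreducible : irreducible_points X.
Proof. exact: irreducible_segre. Qed.
Let irrX := product_irreducible.

Lemma product_closed : closed_over iota X.
Proof. by apply: closed_over_segre; [exact: group_variety_closed hA|exact: group_variety_closed dual_group]. Qed.

Lemma poincare_divisor : is_divisor iota X P.
Proof. by case: hB => _ []. Qed.

Let iotaE c : id_K (iota c) = iota c := erefl.

Lemma poincare_divisorK : is_divisor id_K X PK.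
Proof. exact: is_divisor_map poincare_divisor. Qed.
Let dPK := poincare_divisorK.

Lemma slice_morphism b : carrier B b -> rational_point iota b ->
  morphism iota A X (slice b).
Proof.
move=> Bb [b0 bb0]; apply: morphism_seg (morphism_id _ nzA) _.
exact: morphism_const Bb (nzB Bb) bb0.
Qed.

Lemma coslice_morphism a : carrier A a -> rational_point iota a ->
  morphism iota B X (coslice a).
Proof.
move=> Aa [a0 aa0]; apply: morphism_seg _ (morphism_id _ nzB).
exact: morphism_const Aa (nzA Aa) aa0.
Qed.

Lemma slice_morphismK b : carrier B b -> morphism id_K A X (slice b).
Proof.
move=> Bb; apply: morphism_seg (morphism_id _ nzA) _.
exact: morphism_const Bb (nzB Bb) (rational_idfun b).
Qed.

Lemma coslice_morphismK a : carrier A a -> morphism id_K B X (coslice a).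
Proof.
move=> Aa; apply: morphism_seg _ (morphism_id _ nzB).
exact: morphism_const Aa (nzA Aa) (rational_idfun a).
Qed.

Lemma translation_morphismK a : carrier A a -> morphism id_K A A (fun x => add_pt A x a).
Proof.
move=> Aa; have mc := morphism_const (V := A) Aa (nzA Aa) (rational_idfun a).
apply: (morphism_comp (morphism_seg (morphism_id id_K nzA) mc)).
exact: (morphism_map (iota' := id_K) iotaE (group_mul_morphism hA)).
Qed.

Let mseg1 : morphism id_K X A (@seg1 K n n').
Proof. exact: morphism_seg1. Qed.
Let mseg2 : morphism id_K X B (@seg2 K n n').
Proof. exact: morphism_seg2. Qed.

Let seg1E x y : carrier A x -> carrier B y -> proj_eq (seg1 (seg x y)) x.
Proof. by move=> Ax By; apply: seg1_proj; [apply: nzA | apply: nzB]. Qed.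
Let seg2E x y : carrier A x -> carrier B y -> proj_eq (seg2 (seg x y)) y.
Proof. by move=> Ax By; apply: seg2_proj; [apply: nzA | apply: nzB]. Qed.

Definition restricts b (D : divisor K K n) := class_pullbackK A X (slice b) PK D.
Definition corestricts a (D : divisor K K n') := class_pullbackK B X (coslice a) PK D.

Lemma in_pic0_lin D D' : is_divisor id_K A D -> is_divisor id_K A D' ->
  lin_equivK A D D' -> in_pic0 A D -> in_pic0 A D'.
Proof.
move=> dD dD' DD' H a Aa; have mt := translation_morphismK Aa.
apply: (class_pullback_linl irrA (E := D)) => //.
exact: (class_pullback_lin irrA (H a Aa)).
Qed.

Lemma restricts_pic0 b D : carrier B b -> restricts b D -> in_pic0 A D.
Proof.
move=> Bb rD; case: hB => _ [_ /(_ b Bb) [D' rD' pD'] _] _ _.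
apply: in_pic0_lin pD'; [by case: rD'|by case: rD|].
exact: (class_pullback_uniq irrA irrX (slice_morphismK Bb) dPK rD' rD).
Qed.

Lemma restricts_ex b : carrier B b -> exists D, restricts b D.
Proof. by move=> Bb; apply: class_pullback_ex => //; apply: slice_morphismK. Qed.

Lemma restricts_add b1 b2 D1 D2 : carrier B b1 -> carrier B b2 ->
  restricts b1 D1 -> restricts b2 D2 -> restricts (add_pt B b1 b2) (div_add D1 D2).
Proof. by case: hB => _ _ _ H; apply: H. Qed.

Lemma restricts_proj b b' D : carrier B b -> carrier B b' -> proj_eq b' b ->
  restricts b D -> restricts b' D.
Proof.
move=> Bb Bb' bb'; apply: class_pullback_ext => //.
- exact: slice_morphismK.
- exact: slice_morphismK.
- by move=> x _; apply: seg_proj => //; apply: proj_eq_refl.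
Qed.

(** As 0 + 0 = 0 in B, additivity yields D + D ~ D for the restriction D of the Poincare class to A
    x 0. *)
Lemma restricts0 : restricts (zero_pt B) (@div0 K K n).
Proof.
have [D rD] := restricts_ex B0; have dD := class_pullback_div rD.
have rDD := restricts_proj (group_add dual_group B0 B0) B0
  (proj_eq_sym (group_add0 dual_group B0)) (restricts_add B0 B0 rD rD).
apply: (class_pullback_lin irrA rD); first exact: is_divisor0.
apply: lin_equiv_double => //.
exact: (class_pullback_uniq irrA irrX (slice_morphismK B0) dPK rDD rD).
Qed.

Lemma restricts_muln b D m : carrier B b -> restricts b D ->
  restricts (iter m (add_pt B b) (zero_pt B)) (div_muln D m).
Proof.
move=> Bb rD; elim: m => [|m IH] /=; first exact: restricts0.
by rewrite div_mulnS; apply: restricts_add => //; apply: group_iter dual_group _ _ _.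
Qed.

Lemma restricts_torsion b D m : carrier B b -> restricts b D ->
  proj_eq (iter m (add_pt B b) (zero_pt B)) (zero_pt B) ->
  lin_equivK A (div_muln D m) (@div0 K K n).
Proof.
move=> Bb rD tors; have Bi := group_iter dual_group m Bb.
have r := restricts_proj Bi B0 (proj_eq_sym tors) (restricts_muln m Bb rD).
exact: (class_pullback_uniq irrA irrX (slice_morphismK B0) dPK r restricts0).
Qed.

(* Both constant maps from a one-point variety T to b, b' classify the same
   family on A x T. *)
Lemma restricts_inj b b' D : carrier B b -> carrier B b' ->
  restricts b D -> restricts b' D -> proj_eq b b'.
Proof.
move=> Bb Bb' rD rD'; have dD := class_pullback_div rD.
pose T : points K 1 := fun x => x != 0.
have Tone : T (const_mx 1) by apply/rV0Pn; exists 0; rewrite mxE oner_neq0.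
have Tall x : T x -> x = x 0 0 *: const_mx 1 /\ x 0 0 != 0.
  move=> Tx; have ex : x = x 0 0 *: const_mx 1.
    by apply/rowP => i; rewrite !mxE mulr1 (ord1 i).
  by split=> //; apply: contraTneq Tx => e; rewrite /T ex e scale0r eqxx.
have irrT : irreducible_points T.
  split=> [|d e p q hp hq pq]; first by exists (const_mx 1).
  have van b0 (r : {mpoly K[1]}) : r \is b0.-homog -> r.@[(const_mx 1 : 'rV[K]_1) 0] = 0 ->
      forall x, T x -> r.@[x 0] = 0.
    move=> hr r0 x /Tall [-> _]; rewrite -ev_idfun (ev_scale _ _ _ hr) ev_idfun r0.
    by rewrite mulr0.
  have /eqP := pq _ Tone; rewrite mulf_eq0 => /orP [] /eqP r0; [left; exact: (van _ _ hp r0)|right; exact: (van _ _ hq r0)].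
have clT : closed_over id_K T by exists [::] => // x; split=> [Tx|[]//]; split.
have qT := quasi_projective_idfun irrT clT.
have nzT : nonzero_points T by [].
pose Y := segre A T; have irrY : irreducible_points Y by exact: irreducible_segre.
have mY : morphism id_K Y A (@seg1 K n 1) by exact: morphism_seg1.
(* The constant family: the pullback of D along the projection to A restricts to D on the fibre and
   is trivial on 0 x T. *)
have [L LD] := class_pullback_ex irrY irrA mY dD; have dL := class_pullback_div LD.
have msl y : T y -> morphism id_K A Y (slice y).
  move=> Ty; apply: morphism_seg (morphism_id _ nzA) _.
  exact: morphism_const Ty (nzT _ Ty) (rational_idfun y).
have mco : morphism id_K T Y (coslice (zero_pt A)).
  apply: morphism_seg _ (morphism_id _ nzT).
  exact: morphism_const A0 (nzA A0) (rational_idfun _).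
have famL : pic0_family id_K A T L.
  split=> //.
  - move=> y Ty; exists D; last exact: restricts_pic0 rD.
    rewrite div_base_change_id.
    have [D1 L1] := class_pullback_ex irrA irrY (msl y Ty) dL.
    apply: (class_pullback_lin irrA L1) => //.
    have c1 := class_pullback_comp irrA irrY irrA (msl y Ty) mY dD L1 LD.
    have c2 : class_pullbackK A A id D D1.
      apply: (class_pullback_ext irrA irrA _ dD (morphism_id _ nzA) _ c1).
        exact: morphism_comp (msl y Ty) mY.
      move=> x Ax; apply: proj_eq_sym; apply: seg1_proj; [exact: nzA|exact: nzT].
    apply: (class_pullback_uniq irrA irrA (morphism_id _ nzA) dD c2).
    exact: class_pullback_id.
  - have [D1 L1] := class_pullback_ex irrT irrY mco dL.
    apply: (class_pullback_lin irrT L1); first exact: is_divisor0.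
    have c1 := class_pullback_comp irrT irrY irrA mco mY dD L1 LD.
    have mc := morphism_comp mco mY.
    apply: (class_pullback_uniq irrT irrA mc dD c1).
    apply: (class_pullback_const irrT irrA mc dD _ A0) => y Ty /=.
    by apply: seg1_proj; [exact: nzA|exact: nzT].
have [_ _ univ _] := hB.
have [alpha _ uniq] := univ K iota id_K (fun c => erefl) 1%N T L qT famL.
have cls c : carrier B c -> restricts c D ->
    morphism id_K T B (fun=> c) /\
    class_pullbackK Y X (fun z => seg (seg1 z) c) PK L.
  move=> Bc rc; split; first exact: morphism_const Bc (nzB Bc) (rational_idfun c).
  exact: (class_pullback_comp irrY irrA irrX mY (slice_morphismK Bc) dPK LD rc).
have e1 := uniq (fun=> b) (cls b Bb rD) _ Tone.
have e2 := uniq (fun=> b') (cls b' Bb' rD') _ Tone.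
exact: proj_eq_trans e1 (proj_eq_sym e2).
Qed.

Lemma corestricts_ex a : carrier A a -> exists D, corestricts a D.
Proof. by move=> Aa; apply: class_pullback_ex => //; apply: coslice_morphismK. Qed.

Lemma corestricts_proj a a' D : carrier A a -> carrier A a' -> proj_eq a' a ->
  corestricts a D -> corestricts a' D.
Proof.
move=> Aa Aa' aa'; apply: class_pullback_ext => //.
- exact: coslice_morphismK.
- exact: coslice_morphismK.
- by move=> x _; apply: seg_proj => //; apply: proj_eq_refl.
Qed.

Lemma corestricts0 : corestricts (zero_pt A) (@div0 K K n').
Proof.
case: hB => _ [_ _ H] _ _.
have m0 := coslice_morphism A0 (group_zero_rational hA).
have := class_pullback_map (iota' := id_K) iotaE irrB irrX m0 H.
by rewrite div_base_change0.
Qed.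

(* The family L = (t_{a1} x 1)^* P - pr_2^* (P | a1 x B) has the same fibres
   over B as P, hence is classified by the identity. *)
Lemma corestricts_add a1 a2 D1 D2 : carrier A a1 -> carrier A a2 ->
  corestricts a1 D1 -> corestricts a2 D2 ->
  corestricts (add_pt A a2 a1) (div_add D2 D1).
Proof.
move=> Aa1 Aa2 r1 r2; have dD1 := class_pullback_div r1; have dD2 := class_pullback_div r2.
have mt := translation_morphismK Aa1.
pose tau z := seg (add_pt A (@seg1 K n n' z) a1) (@seg2 K n n' z).
have mtau : morphism id_K X X tau.
  exact: morphism_seg (morphism_comp mseg1 mt) mseg2.
have tauE x y : carrier A x -> carrier B y ->
    proj_eq (tau (seg x y)) (seg (add_pt A x a1) y).
  move=> Ax By; apply: seg_proj; last exact: seg2E.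
  apply: (group_add_proj hA) => //; try exact: proj_eq_refl; last exact: seg1E.
  exact: (scA (seg1E Ax By) Ax).
have [M tM] := class_pullback_ex irrX irrX mtau dPK; have dM := class_pullback_div tM.
have [N' pN] := class_pullback_ex irrX irrB mseg2 dD1; have dN := class_pullback_div pN.
pose L := div_sub M N'; have dL : is_divisor id_K X L by exact: is_divisor_sub.
have co a Da : carrier A a -> corestricts (add_pt A a a1) Da ->
    class_pullbackK B X (coslice a) L (div_sub Da D1).
  move=> Aa rDa; have mc := coslice_morphismK Aa; have Aaa := group_add hA Aa Aa1.
  apply: (class_pullback_sub irrB irrX mc dM dN).
    have [M1 cM1] := class_pullback_ex irrB irrX mc dM.
    apply: (class_pullback_lin irrB cM1); first exact: class_pullback_div rDa.
    have c1 := class_pullback_comp irrB irrX irrX mc mtau dPK cM1 tM.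
    have c2 : corestricts (add_pt A a a1) M1.
      apply: (class_pullback_ext irrB irrX (morphism_comp mc mtau) dPK
        (coslice_morphismK Aaa) _ c1) => y By.
      by apply: proj_eq_sym; apply: tauE.
    exact: (class_pullback_uniq irrB irrX (coslice_morphismK Aaa) dPK c2 rDa).
  have [N1 cN1] := class_pullback_ex irrB irrX mc dN.
  apply: (class_pullback_lin irrB cN1) => //.
  have c1 := class_pullback_comp irrB irrX irrB mc mseg2 dD1 cN1 pN.
  have c2 : class_pullbackK B B id D1 N1.
    apply: (class_pullback_ext irrB irrB (morphism_comp mc mseg2) dD1
      (morphism_id _ nzB) _ c1) => y By.
    by apply: proj_eq_sym; apply: seg2E.
  apply: (class_pullback_uniq irrB irrB (morphism_id _ nzB) dD1 c2).
  exact: class_pullback_id.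
(* On A x y, the divisor M restricts to a translate of the fibre of P, equivalent to that fibre
   since it lies in Pic^0; the subtracted pullback from B is trivial there, the projection being
   constant. *)
have sl y D : carrier B y -> restricts y D -> class_pullbackK A X (slice y) L D.
  move=> By rD; have ms := slice_morphismK By; have dD := class_pullback_div rD.
  have d0 := is_divisor0 id_K irrA.
  apply: (class_pullback_lin irrA (D := div_sub D (@div0 K K n))) => //; last first.
    apply: lin_equiv_sub_self => //; exact: lin_equiv_refl.
  apply: (class_pullback_sub irrA irrX ms dM dN).
    have [M1 cM1] := class_pullback_ex irrA irrX ms dM.
    apply: (class_pullback_lin irrA cM1) => //.
    have c1 := class_pullback_comp irrA irrX irrX ms mtau dPK cM1 tM.
    have mst := morphism_comp mt ms.
    have c2 : class_pullbackK A X (slice y \o (fun x => add_pt A x a1)) PK M1.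
      apply: (class_pullback_ext irrA irrX (morphism_comp ms mtau) dPK mst _ c1) => x Ax.
      by apply: proj_eq_sym; apply: tauE.
    have c3 := class_pullback_comp irrA irrA irrX mt ms dPK
      (restricts_pic0 By rD Aa1) rD.
    exact: (class_pullback_uniq irrA irrX mst dPK c2 c3).
  have [N1 cN1] := class_pullback_ex irrA irrX ms dN.
  apply: (class_pullback_lin irrA cN1) => //.
  have c1 := class_pullback_comp irrA irrX irrB ms mseg2 dD1 cN1 pN.
  have mc := morphism_comp ms mseg2.
  apply: (class_pullback_uniq irrA irrB mc dD1 c1).
  apply: (class_pullback_const irrA irrB mc dD1 _ By) => x Ax; exact: seg2E.
(* Triviality along 0 x B is the purpose of the subtracted pullback of D1: without it, the
   translated class would restrict to D1 there. *)
have famL : pic0_family id_K A B L.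
  split=> //.
  - move=> y By; have [D rD] := restricts_ex By; exists D.
      by rewrite div_base_change_id; apply: sl.
    exact: restricts_pic0 rD.
  - have r0 : corestricts (add_pt A (zero_pt A) a1) D1.
      apply: corestricts_proj r1 => //; first exact: (group_add hA).
      exact: (group_add0 hA).
    apply: (class_pullback_lin irrB (co _ _ A0 r0)); first exact: is_divisor0.
    exact: lin_equiv_subxx.
have qB : quasi_projective_variety id_K B.
  exact: quasi_projective_idfun irrB (closed_over_map (iota' := id_K) iotaE (group_variety_closed dual_group)).
have [_ _ univ _] := hB.
have [alpha [malpha calpha] _] := univ K iota id_K (fun c => erefl) n' B L qB famL.
pose psi z := seg (@seg1 K n n' z) (alpha (@seg2 K n n' z)).
have mpsi : morphism id_K X X psi.
  exact: morphism_seg mseg1 (morphism_comp mseg2 malpha).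
(* The classifying map sends y to a point over which P has the same fibre class, and by
   [restricts_inj] this point is y. *)
have alphaE y : carrier B y -> proj_eq y (alpha y).
  move=> By; have Bay := morphism_in malpha By.
  have [D rD] := restricts_ex By; apply: (restricts_inj By Bay rD).
  have ms := slice_morphismK By.
  have c1 := class_pullback_comp irrA irrX irrX ms mpsi dPK (sl y D By rD) calpha.
  apply: (class_pullback_ext irrA irrX (morphism_comp ms mpsi) dPK
    (slice_morphismK Bay) _ c1) => x Ax.
  apply: proj_eq_sym; apply: seg_proj; first exact: seg1E.
  apply: (morphism_proj malpha) => //; last exact: seg2E.
  exact: (scB (seg2E Ax By) By).
have LP : lin_equivK X L PK.
  have nzX : nonzero_points X.
    by move=> _ [x [y [Ax By ->]]]; apply: seg_neq0; [apply: nzA|apply: nzB].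
  have c1 : class_pullbackK X X id PK L.
    apply: (class_pullback_ext irrX irrX mpsi dPK (morphism_id _ nzX) _ calpha).
    move=> _ [x [y [Ax By ->]]] /=; apply: proj_eq_sym.
    have Bs2 : carrier B (seg2 (seg x y)) by exact: (scB (seg2E Ax By) By).
    apply: seg_proj; first exact: seg1E.
    apply: (proj_eq_trans (proj_eq_sym (alphaE _ Bs2))); exact: seg2E.
  apply: (class_pullback_uniq irrX irrX (morphism_id _ nzX) dPK c1).
  exact: class_pullback_id.
have Aaa := group_add hA Aa2 Aa1.
have [D12 r12] := corestricts_ex Aaa; have dD12 := class_pullback_div r12.
(* Restricting L ~ P to a2 x B gives D12 - D1 ~ D2, where D12 is the restriction of P at a2 + a1. *)
have e := class_pullback_linE irrB irrX (coslice_morphismK Aa2) dL dPK LP (co _ _ Aa2 r12) r2.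
apply: (class_pullback_lin irrB r12); first exact: is_divisor_add.
exact: lin_equiv_subr.
Qed.

(** The order of the summands in [corestricts_add] is that of [iter], so the multiples of a can be
    taken one step at a time. *)
Lemma corestricts_torsion a D m : carrier A a -> corestricts a D ->
  proj_eq (iter m (add_pt A a) (zero_pt A)) (zero_pt A) ->
  lin_equivK B (div_muln D m) (@div0 K K n').
Proof.
move=> Aa rD tors.
have r i : corestricts (iter i (add_pt A a) (zero_pt A)) (div_muln D i).
  elim: i => [|i IH] /=; first exact: corestricts0.
  by rewrite div_mulnS; apply: corestricts_add => //; apply: (group_iter hA).
have r0 := corestricts_proj (group_iter hA m Aa) A0 (proj_eq_sym tors) (r m).
exact: (class_pullback_uniq irrB irrX (coslice_morphismK A0) dPK r0 corestricts0).
Qed.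

End Dual.

(** * The pairings *)

Lemma div_base_change_add (k k' K : fieldType) (j : {rmorphism k -> k'}) n
    (D E : divisor k K n) :
  div_base_change j (div_add D E) = div_add (div_base_change j D) (div_base_change j E).
Proof.
by apply: functional_extensionality => x; rewrite /div_base_change /div_add /rf_mul /= !rmorphM.
Qed.

Section GroupDivisors.
Variables (k : fieldType) (K : closedFieldType) (iota : {rmorphism k -> K}).
Variables (n : nat) (G : group_data K n).
Hypothesis hG : abelian_variety iota G.
Local Notation id_K := (idfun : {rmorphism K -> K}).
Let irrG := group_irreducible hG.
Let clG := group_variety_closed hG.

Lemma lin_equiv_descent D E : is_divisor iota G D -> is_divisor iota G E ->
  lin_equiv id_K G (div_base_change iota D) (div_base_change iota E) ->
  lin_equiv iota G D E.
Proof.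
move=> dD dE DE; apply: lin_equiv_of_sub => //.
apply: (principal_descent irrG clG (group_defined hG)); first exact: is_divisor_sub.
rewrite div_base_change_sub; apply: lin_equiv_sub0 => //; exact: is_divisor_map.
Qed.

Lemma principal_descent0 D : is_divisor iota G D ->
  lin_equiv id_K G (div_base_change iota D) (@div0 K K n) ->
  lin_equiv iota G D (@div0 k K n).
Proof. by move=> dD; apply: (principal_descent irrG clG (group_defined hG)). Qed.

Lemma div_eq_principal D f : is_divisor iota G D -> rat_fun iota G f ->
  div_eq iota G (div_of f) D -> lin_equiv iota G D (@div0 k K n).
Proof.
move=> dD Rf E; exists f => // x Gx; have RDx := is_divisor_rat dD Gx.
by apply/(unit_at_div1 irrG x RDx Rf); apply: unit_at_div_sym (E x Gx).
Qed.

Lemma div_eq_mul D1 D2 f1 f2 m : is_divisor iota G D1 -> is_divisor iota G D2 ->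
  rat_fun iota G f1 -> rat_fun iota G f2 ->
  div_eq iota G (div_of f1) (div_muln D1 m) -> div_eq iota G (div_of f2) (div_muln D2 m) ->
  div_eq iota G (div_of (rf_mul f1 f2)) (div_muln (div_add D1 D2) m).
Proof.
move=> dD1 dD2 Rf1 Rf2 E1 E2 x Gx.
have R1 := rat_fun_exp irrG m (is_divisor_rat dD1 Gx).
have R2 := rat_fun_exp irrG m (is_divisor_rat dD2 Gx).
have := unit_at_mul irrG (E1 x Gx) (E2 x Gx).
rewrite /div_muln /div_add /div_of rf_exp_mul.
move: (rf_exp (D1 x) m) (rf_exp (D2 x) m) R1 R2 => p q R1 R2 u.
unit_by irrG u.
Qed.

Section Value.
Variables (l : nat) (X : points K l) (P : divisor k K l) (s : 'rV[K]_n -> 'rV[K]_l).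
Variable m : nat.
Hypotheses (irrX : irreducible_points X) (dP : is_divisor iota X P).
Hypothesis ms : morphism iota G X s.

(** Several rational points are avoided at once, so that a single f supplies all the values that
    have to be compared. *)
Lemma adapted_function (qs : seq 'rV[K]_n) :
  (forall q, q \in qs -> carrier G q /\ rational_point iota q) ->
  (forall D, class_pullback iota G X s P D ->
     lin_equiv iota G (div_muln D m) (@div0 k K n)) ->
  exists D f, [/\ class_pullback iota G X s P D, forall q, q \in qs -> avoids iota G D q,
    rat_fun iota G f & div_eq iota G (div_of f) (div_muln D m)].
Proof.
move=> rqs tors; have [D0 c0] := class_pullback_ex irrG irrX ms dP.
have dD0 := class_pullback_div c0.
have [D [dD DD0 av]] := moving_lemma irrG clG dD0 rqs.
have cD : class_pullback iota G X s P D.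
  by apply: (class_pullback_lin irrG c0) => //; apply: lin_equiv_sym.
have [f Rf E] := principal_div irrG (is_divisor_muln irrG m dD) (tors D cD).
by exists D, f.
Qed.

Variable a : 'rV[K]_n.
Hypotheses (Ga : carrier G a) (ra : rational_point iota a).

Lemma b_value_of D f : class_pullback iota G X s P D ->
  avoids iota G D a -> avoids iota G D (zero_pt G) -> rat_fun iota G f ->
  div_eq iota G (div_of f) (div_muln D m) ->
  exists2 r, ratio_value iota G f a (zero_pt G) r & b_value iota m G X P s a r.
Proof.
move=> cD av av0 Rf E; have dD := class_pullback_div cD.
have uf x : carrier G x -> avoids iota G D x -> unit_at iota G f x.
  by move=> Gx; apply: div_eq_unit E Rf.
have [r _ fr] := rational_ratio ra (group_zero_rational hG) (uf _ Ga av)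
  (uf _ (group_zero hG) av0).
by exists r => //; exists D, f.
Qed.

Lemma b_value_ex :
  (forall D, class_pullback iota G X s P D ->
     lin_equiv iota G (div_muln D m) (@div0 k K n)) ->
  exists r, b_value iota m G X P s a r.
Proof.
move=> tors; have [|D [f [cD av Rf E]]] := @adapted_function [:: a; zero_pt G] _ tors.
  move=> q; rewrite !inE => /orP [] /eqP -> //.
  by split; [exact: (group_zero hG) | exact: (group_zero_rational hG)].
have [||r _ br] := b_value_of cD _ _ Rf E; last by exists r.
- by apply: av; rewrite !inE eqxx.
- by apply: av; rewrite !inE eqxx orbT.
Qed.

Lemma b_value_uniq r1 r2 : b_value iota m G X P s a r1 -> b_value iota m G X P s a r2 ->
  eq_mod_powers m r1 r2.
Proof.
move=> [D1 [f1 [c1 [u1a u1o] R1 E1 v1]]] [D2 [f2 [c2 [u2a u2o] R2 E2 v2]]].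
have D12 := class_pullback_uniq irrG irrX ms dP c1 c2.
exact: (ratio_lin_equiv irrG clG Ga (group_zero hG) ra (group_zero_rational hG)
  (class_pullback_div c1) (class_pullback_div c2) D12 u1a u1o u2a u2o R1 R2 E1 E2 v1 v2).
Qed.

End Value.
End GroupDivisors.

Lemma b_value_neq0 (k K : fieldType) (iota : {rmorphism k -> K}) m n l
    (G : group_data K n) (X : points K l) P s a r :
  b_value iota m G X P s a r -> r != 0.
Proof.
move=> [_ [_ [_ _ _ _ [c [c0 [/unit_value_neq0 u /unit_value_neq0 u0 ->]]]]]].
by rewrite !fmorph_eq0 in u u0; rewrite mulf_neq0 ?invr_eq0.
Qed.

Section Pairing.
Variables (k : fieldType) (K : closedFieldType) (iota : {rmorphism k -> K}).
Variables (n n' : nat) (A : group_data K n) (B : group_data K n').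
Variables (P : divisor k K (n * n')) (m : nat).
Hypotheses (hA : abelian_variety iota A) (hB : dual_abelian_variety iota A B P).
Local Notation id_K := (idfun : {rmorphism K -> K}).
Local Notation PK := (div_base_change iota P).
Local Notation X := (segre A B).
Local Notation slice b := (fun x => seg x b).
Local Notation coslice a := (fun y => seg a y).
Local Notation o := (zero_pt A).
Local Notation o' := (zero_pt B).
Local Notation lin_equiv := (lin_equiv iota).
Local Notation rat_fun := (rat_fun iota).
Local Notation avoids := (avoids iota).
Local Notation rational := (rational_point iota).

Let hB' := dual_group hB.
Let irrA := group_irreducible hA.
Let irrB := group_irreducible hB'.
Let clA := group_variety_closed hA.
Let A0 := group_zero hA.
Let B0 := group_zero hB'.
Let rA0 := group_zero_rational hA.
Let rB0 := group_zero_rational hB'.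
Let irrX := product_irreducible hA hB.
Let clX := product_closed hA hB.
Let dP := poincare_divisor hB.
Let dPK := poincare_divisorK hB.
Let iotaE c : id_K (iota c) = iota c := erefl.

Lemma slice_map b D : carrier B b -> rational b ->
  class_pullback iota A X (slice b) P D -> restricts iota A B P b (div_base_change iota D).
Proof.
move=> Bb rb; exact: (class_pullback_map iotaE irrA irrX (slice_morphism hA hB Bb rb)).
Qed.

Lemma coslice_map a D : carrier A a -> rational a ->
  class_pullback iota B X (coslice a) P D -> corestricts iota A B P a (div_base_change iota D).
Proof.
move=> Aa ra; exact: (class_pullback_map iotaE irrB irrX (coslice_morphism hA hB Aa ra)).
Qed.

Lemma slice_torsion b D : torsion_point iota B m b ->
  class_pullback iota A X (slice b) P D -> lin_equiv A (div_muln D m) (@div0 k K n).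
Proof.
move=> [Bb rb tb] cD; have dD := class_pullback_div cD.
apply: (principal_descent0 hA); first exact: is_divisor_muln.
rewrite div_base_change_muln; apply: (restricts_torsion hA hB Bb _ tb).
exact: slice_map.
Qed.

Lemma coslice_torsion a D : torsion_point iota A m a ->
  class_pullback iota B X (coslice a) P D -> lin_equiv B (div_muln D m) (@div0 k K n').
Proof.
move=> [Aa ra ta] cD; have dD := class_pullback_div cD.
apply: (principal_descent0 hB'); first exact: is_divisor_muln.
rewrite div_base_change_muln; apply: (corestricts_torsion hA hB Aa _ ta).
exact: coslice_map.
Qed.

Lemma slice_zero D : class_pullback iota A X (slice o') P D -> lin_equiv A D (@div0 k K n).
Proof.
move=> cD; have dD := class_pullback_div cD; apply: (principal_descent0 hA) => //.
apply: (class_pullback_uniq irrA irrX (slice_morphismK hA hB B0) dPK).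
- exact: slice_map.
- exact: (restricts0 hA hB).
Qed.

Lemma coslice_zero D : class_pullback iota B X (coslice o) P D -> lin_equiv B D (@div0 k K n').
Proof.
move=> cD; have [_ [_ _ c0] _ _] := hB.
exact: (class_pullback_uniq irrB irrX (coslice_morphism hA hB A0 rA0) dP cD c0).
Qed.

Lemma slice_add b1 b2 D1 D2 D : carrier B b1 -> carrier B b2 -> rational b1 -> rational b2 ->
  class_pullback iota A X (slice b1) P D1 -> class_pullback iota A X (slice b2) P D2 ->
  class_pullback iota A X (slice (add_pt B b1 b2)) P D -> lin_equiv A D (div_add D1 D2).
Proof.
move=> Bb1 Bb2 rb1 rb2 c1 c2 c.
have Bb := group_add hB' Bb1 Bb2; have rb := group_add_rational hB' Bb1 Bb2 rb1 rb2.
apply: (lin_equiv_descent hA); first exact: class_pullback_div c.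
  by apply: is_divisor_add => //; [exact: class_pullback_div c1|exact: class_pullback_div c2].
rewrite div_base_change_add.
apply: (class_pullback_uniq irrA irrX (slice_morphismK hA hB Bb) dPK (slice_map Bb rb c)).
by apply: (restricts_add hB) => //; apply: slice_map.
Qed.

Lemma slice_translate a b D Dt : carrier A a -> rational a -> carrier B b -> rational b ->
  class_pullback iota A X (slice b) P D -> is_divisor iota A Dt ->
  div_pullback iota A A (fun x => add_pt A x a) D Dt -> lin_equiv A Dt D.
Proof.
move=> Aa ra Bb rb cD dDt pDt; have dD := class_pullback_div cD.
have mt := translation_morphism hA Aa ra.
apply: (lin_equiv_descent hA) => //.
have c1 : class_pullback id_K A A (fun x => add_pt A x a)
    (div_base_change iota D) (div_base_change iota Dt).
  apply: (class_pullback_map iotaE irrA irrA mt).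
  exact: div_pullback_class.
have dDK := is_divisor_map (iota' := id_K) iotaE dD.
exact: (class_pullback_uniq irrA irrA (translation_morphismK hA Aa) dDK c1
  (restricts_pic0 hA hB Bb (slice_map Bb rb cD) Aa)).
Qed.

(** The hypothesis concerns divisor classes instead of [torsion_point], so that it can be verified
    for a sum b1 + b2 by means of the product of two functions. *)
Lemma b_pairing_value a b : carrier A a -> rational a -> carrier B b -> rational b ->
  (forall D, class_pullback iota A X (slice b) P D ->
     lin_equiv A (div_muln D m) (@div0 k K n)) ->
  b_value iota m A X P (slice b) a (b_pairing iota m A B P a b).
Proof.
move=> Aa ra Bb rb tors; apply: epsilon_spec.
exact: (b_value_ex hA irrX dP (slice_morphism hA hB Bb rb) Aa ra tors).
Qed.

Lemma b'_pairing_value a b : carrier B b -> rational b -> torsion_point iota A m a ->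
  b_value iota m B X P (coslice a) b (b'_pairing iota m A B P b a).
Proof.
move=> Bb rb ta; have [Aa ra _] := ta; apply: epsilon_spec.
apply: (b_value_ex hB' irrX dP (coslice_morphism hA hB Aa ra) Bb rb) => D.
exact: coslice_torsion.
Qed.

Lemma b_pairing_addr a b1 b2 : torsion_point iota A m a ->
  torsion_point iota B m b1 -> torsion_point iota B m b2 ->
  eq_mod_powers m (b_pairing iota m A B P a (add_pt B b1 b2))
    (b_pairing iota m A B P a b1 * b_pairing iota m A B P a b2).
Proof.
move=> [Aa ra _] t1 t2; have [[Bb1 rb1 _] [Bb2 rb2 _]] := (t1, t2).
have Bb := group_add hB' Bb1 Bb2; have rb := group_add_rational hB' Bb1 Bb2 rb1 rb2.
have [D1 [f1 [c1 [u1a u1o] Rf1 E1 v1]]] :=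
  b_pairing_value Aa ra Bb1 rb1 (fun D => slice_torsion t1).
have [D2 [f2 [c2 [u2a u2o] Rf2 E2 v2]]] :=
  b_pairing_value Aa ra Bb2 rb2 (fun D => slice_torsion t2).
have dD1 := class_pullback_div c1; have dD2 := class_pullback_div c2.
have dD12 := is_divisor_add irrA dD1 dD2.
have E12 := div_eq_mul hA dD1 dD2 Rf1 Rf2 E1 E2.
have Rf12 := rat_fun_mul irrA Rf1 Rf2.
(* The function f1 f2 shows that m (D1 + D2), and with it m D, is principal. *)
have tors D : class_pullback iota A X (slice (add_pt B b1 b2)) P D ->
    lin_equiv A (div_muln D m) (@div0 k K n).
  move=> c; have dD := class_pullback_div c.
  have DD := slice_add Bb1 Bb2 rb1 rb2 c1 c2 c.
  apply: (lin_equiv_trans irrA _ _ (is_divisor0 iota irrA) (lin_equiv_muln irrA m dD dD12 DD)).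
  - exact: is_divisor_muln.
  - exact: is_divisor_muln.
  - by apply: (div_eq_principal hA _ Rf12 E12); apply: is_divisor_muln.
have [D3 [f3 [c3 [u3a u3o] Rf3 E3 v3]]] := b_pairing_value Aa ra Bb rb tors.
apply: (ratio_lin_equiv irrA clA Aa A0 ra rA0 (class_pullback_div c3) dD12
  (slice_add Bb1 Bb2 rb1 rb2 c1 c2 c3) u3a u3o _ _ Rf3 Rf12 E3 E12 v3).
- exact: unit_at_mul.
- exact: unit_at_mul.
case: v1 v2 => p1 [q1 [w1 x1 ->]] [p2 [q2 [w2 x2 ->]]].
exists (p1 * p2), (q1 * q2); rewrite !rmorphM mulf_div.
by split=> //; apply: unit_value_mul.
Qed.

(* f o t_{a2} has divisor m t_{a2}^* D, where t_{a2}^* D ~ D. *)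
Lemma b_pairing_addl a1 a2 b : torsion_point iota A m a1 -> torsion_point iota A m a2 ->
  torsion_point iota B m b ->
  eq_mod_powers m (b_pairing iota m A B P (add_pt A a1 a2) b)
    (b_pairing iota m A B P a1 b * b_pairing iota m A B P a2 b).
Proof.
move=> [Aa1 ra1 _] [Aa2 ra2 _] tb; have [Bb rb _] := tb.
have Aa := group_add hA Aa1 Aa2; have ra := group_add_rational hA Aa1 Aa2 ra1 ra2.
have ms := slice_morphism hA hB Bb rb.
have tors D := @slice_torsion b D tb.
have bv x (Ax : carrier A x) (rx : rational x) := b_pairing_value Ax rx Bb rb tors.
(* Besides o and a1, the divisor has to avoid a2 and a1 + a2, to which translation by a2 carries
   them. *)
have [|D [f [cD av Rf E]]] := @adapted_function _ _ _ _ _ hA _ X P (slice b) m irrX dP ms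
  [:: o; a1; a2; add_pt A a1 a2] _ tors.
  by move=> q; rewrite !inE => /or4P [] /eqP ->.
have dD := class_pullback_div cD.
have avo : avoids A D o by apply: av; rewrite !inE eqxx.
have av1 : avoids A D a1 by apply: av; rewrite !inE eqxx orbT.
have av2 : avoids A D a2 by apply: av; rewrite !inE eqxx !orbT.
have av12 : avoids A D (add_pt A a1 a2) by apply: av; rewrite !inE eqxx !orbT.
have bval x : carrier A x -> rational x -> avoids A D x ->
    exists2 r, ratio_value iota A f x o r & eq_mod_powers m (b_pairing iota m A B P x b) r.
  move=> Ax rx ax; have [r fr br] := b_value_of hA Ax rx cD ax avo Rf E.
  exists r => //; exact: (b_value_uniq hA irrX dP ms Ax rx (bv x Ax rx) br).
have [r1 fr1 br1] := bval a1 Aa1 ra1 av1; have [r2 fr2 br2] := bval a2 Aa2 ra2 av2.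
have [r fr br] := bval _ Aa ra av12.
have [Ct1 [C0 [vC1 vC0 eC1]]] := fr1; have [C2 [C0' [vC2 vC0' eC2]]] := fr2.
have [C12 [C0'' [vC12 vC0'' eC12]]] := fr.
have mt := translation_morphism hA Aa2 ra2.
have [Dt [dDt pDt]] := div_pullback_ex irrA irrA mt dD Aa1 av12.
have DtD := slice_translate Aa2 ra2 Bb rb cD dDt pDt.
have uf12 : unit_at iota A f (add_pt A a1 a2) by exists (iota C12).
have [g fg] := rf_comp_ex irrA irrA mt Aa1 uf12.
have [_ Rg] := rf_comp_rat fg.
have a02 := group_add0 hA Aa2; have Aa02 := group_add hA A0 Aa2.
have avt1 : avoids A Dt a1 := div_pullback_avoids irrA dDt pDt Aa1 av12.
have avt0 : avoids A Dt o.
  apply: (div_pullback_avoids irrA dDt pDt A0).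
  exact: avoids_proj dD Aa2 Aa02 a02 av2.
have Eg : div_eq iota A (div_of g) (div_muln Dt m).
  move=> x Ax; have Atx := group_add hA Ax Aa2.
  have [gx cgx ugx] := pDt x Ax; have [_ Rgx] := rf_comp_rat cgx.
  (* To find the divisor of g, the unit f / D^m at x + a2 is composed with the translation, which
     requires the composite of a power of the local equation. *)
  have cexp i : rf_comp iota A A (fun x => add_pt A x a2) (rf_exp (D (add_pt A x a2)) i) (rf_exp gx i).
    elim: i => [|i IH].
      rewrite /rf_exp !expr0; split; first exact: rat_fun1.
        by exists x, 1; split=> //; exact: unit_value1.
      move=> y c Ay uc.
      rewrite (unit_value_uniq irrA (group_add hA Ay Aa2) uc (unit_value1 _ irrA _)).
      exact: unit_value1.
    by rewrite /rf_exp !exprS; apply: (rf_comp_mul irrA irrA mt cgx IH).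
  have uq := rf_comp_unit (rf_comp_div irrA irrA mt fg (cexp m)) Ax (E _ Atx).
  have uexp := unit_at_exp irrA m ugx; rewrite rf_exp_div in uexp.
  have RDx := rat_fun_exp irrA m (is_divisor_rat dDt Ax).
  have Rgm := rat_fun_exp irrA m Rgx.
  rewrite /div_muln /div_of; move: (rf_exp (Dt x) m) (rf_exp gx m) uq uexp RDx Rgm.
  move=> p q uq uexp Rp Rq.
  by apply: (unit_at_div_trans irrA Rg Rq Rp uq); apply: unit_at_div_sym.
(* Since g(x) = f(x + a2), the ratio of g is f(a1 + a2) / f(a2), and Dt ~ D makes it equal to f(a1)
   / f(0) up to m-th powers. Multiplying by f(a2) / f(0) turns it into f(a1 + a2) / f(0). *)
have vg : ratio_value iota A g a1 o (C12 / C2).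
  have [_ _ H] := fg; exists C12, C2; split=> //; first exact: H.
  by apply: H => //; apply: unit_value_proj (proj_eq_sym a02) vC2.
have key := ratio_lin_equiv irrA clA Aa1 A0 ra1 rA0 dDt dD DtD avt1 avt0 av1 avo Rg Rf
  Eg E vg fr1.
have nz x c : carrier A x -> unit_value iota A f x (iota c) -> c != 0.
  by move=> _ /unit_value_neq0; rewrite fmorph_eq0.
have eC0 : C0'' = C0'.
  by apply: (fmorph_inj iota); apply: (unit_value_uniq irrA A0 vC0'' vC0').
have er : r = C12 / C2 * r2.
  by rewrite eC12 eC2 eC0 mulrA divfK // (nz a2).
apply: (eq_mod_powers_trans br); rewrite er; apply: eq_mod_powers_mul.
  exact: eq_mod_powers_trans key (eq_mod_powers_sym br1).
exact: eq_mod_powers_sym.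
Qed.

(* A pullback in the sense of [div_pullback] need not have homogeneous local
   equations; those of D' are. *)
Lemma div_pullback_homogenize l1 l2 (V : points K l1) (W : points K l2) phi E D :
  irreducible_points V -> irreducible_points W -> morphism iota V W phi ->
  is_divisor iota W E -> div_pullback iota V W phi E D ->
  exists D', [/\ is_divisor iota V D', div_pullback iota V W phi E D' &
    forall x, V x -> unit_at iota V (rf_div (D x) (D' x)) x].
Proof.
move=> irrV irrW mphi dE pD.
have ex x : exists g, V x -> rf_comp iota V W phi (E (phi x)) g /\
    unit_at iota V (rf_div (D x) g) x.
  have [Vx|nVx] := excluded_middle_informative (V x); last by exists (rf1 k l1).
  by have [g cg ug] := pD x Vx; exists g.
pose D' x := proj1_sig (constructive_indefinite_description _ (ex x)).
have D'P x : V x -> rf_comp iota V W phi (E (phi x)) (D' x) /\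
    unit_at iota V (rf_div (D x) (D' x)) x.
  by rewrite /D'; case: constructive_indefinite_description.
have [|dD' pD'] := @div_pullback_local _ _ iota _ _ V W irrV irrW phi mphi E D' dE.
  by move=> x /D'P [].
by exists D'; split=> // x /D'P [].
Qed.

(** * One side of the Weil pairing: on A with slices, on A' with coslices *)

Section WeilSide.
Variables (l : nat) (G : group_data K l) (s t : 'rV[K]_l -> 'rV[K]_(n * n')).
Variables (E : divisor k K (n * n')) (a : 'rV[K]_l).
Hypotheses (hG : abelian_variety iota G).
Hypotheses (ms : morphism iota G X s) (mt : morphism iota G X t).
Hypothesis tz : forall D, class_pullback iota G X t P D ->
  lin_equiv G D (@div0 k K l).
Hypotheses (dE : is_divisor iota X E) (EP : lin_equiv X E P).
Hypotheses (sa : avoids X E (s a)) (so : avoids X E (s (zero_pt G))).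
Hypotheses (ta : avoids X E (t a)) (to : avoids X E (t (zero_pt G))).
Hypothesis Ga : carrier G a.
Let irrG := group_irreducible hG.
Let G0 := group_zero hG.

(** The restriction along t is principal, so subtracting it preserves the class; as E avoids the
    four points, neither restriction meets a or 0. *)
Lemma difference_class D1 D0 : is_divisor iota G D1 -> is_divisor iota G D0 ->
  div_pullback iota G X s E D1 -> div_pullback iota G X t E D0 ->
  [/\ class_pullback iota G X s P (div_sub D1 D0), avoids G (div_sub D1 D0) a
    & avoids G (div_sub D1 D0) (zero_pt G)].
Proof.
move=> dD1 dD0 p1 p0; have dD := is_divisor_sub irrG dD1 dD0.
have c1 := class_pullback_linl irrX dE dP (div_pullback_class irrG irrX dE dD1 p1) EP.
have c0 := class_pullback_linl irrX dE dP (div_pullback_class irrG irrX dE dD0 p0) EP.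
have av x : carrier G x -> avoids X E (s x) -> avoids X E (t x) -> avoids G (div_sub D1 D0) x.
  move=> Gx us ut; apply: unit_at_div => //.
    exact: (div_pullback_avoids irrG dD1 p1 Gx us).
  exact: (div_pullback_avoids irrG dD0 p0 Gx ut).
split; [|exact: av|exact: av].
apply: (class_pullback_lin irrG c1) => //; apply: lin_equiv_sym => //.
exact: lin_equiv_sub_self (tz c0).
Qed.

(** In [weil_value], D1 and D0 are pullbacks without [is_divisor], which [b_value] demands of its
    divisor. They are replaced by D1' and D0', whose local equations differ from theirs by units. *)
Lemma weil_side D1 D0 f r :
  div_pullback iota G X s E D1 -> div_pullback iota G X t E D0 ->
  rat_fun G f -> div_eq iota G (div_of f) (div_muln (div_sub D1 D0) m) ->
  ratio_value iota G f a (zero_pt G) r -> b_value iota m G X P s a r.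
Proof.
move=> p1 p0 Rf Ef vf.
have [D1' [dD1' p1' u1]] := div_pullback_homogenize irrG irrX ms dE p1.
have [D0' [dD0' p0' u0]] := div_pullback_homogenize irrG irrX mt dE p0.
have [cD ava av0] := difference_class dD1' dD0' p1' p0'.
exists (div_sub D1' D0'), f; split=> // x Gx; have := unit_at_mul irrG (Ef x Gx)
  (unit_at_exp irrG m (unit_at_div irrG (u1 x Gx) (u0 x Gx))).
have R1 := rat_fun_exp irrG m (is_divisor_rat dD1' Gx).
have R0 := rat_fun_exp irrG m (is_divisor_rat dD0' Gx).
rewrite /div_muln /div_sub /div_of !rf_exp_div.
move: (rf_exp (D1 x) m) (rf_exp (D0 x) m) => p q.
move: (rf_exp (D1' x) m) (rf_exp (D0' x) m) R1 R0 => p' q' R1 R0 u.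
unit_by irrG u.
Qed.

Lemma weil_side_ex : rational a ->
  (forall D, class_pullback iota G X s P D ->
     lin_equiv G (div_muln D m) (@div0 k K l)) ->
  exists D1 D0 f r, [/\ div_pullback iota G X s E D1, div_pullback iota G X t E D0,
    rat_fun G f, div_eq iota G (div_of f) (div_muln (div_sub D1 D0) m)
    & ratio_value iota G f a (zero_pt G) r].
Proof.
move=> ra tors.
have [D1 [dD1 p1]] := div_pullback_ex irrG irrX ms dE Ga sa.
have [D0 [dD0 p0]] := div_pullback_ex irrG irrX mt dE Ga ta.
have [cD ava av0] := difference_class dD1 dD0 p1 p0.
have [f Rf Ef] :=
  principal_div irrG (is_divisor_muln irrG m (class_pullback_div cD)) (tors _ cD).
have [r fr _] := b_value_of hG Ga ra cD ava av0 Rf Ef.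
by exists D1, D0, f, r.
Qed.

End WeilSide.

Lemma weil_value_sides a b e : torsion_point iota A m a -> torsion_point iota B m b ->
  weil_value iota m A B P a b e ->
  exists r r', [/\ b_value iota m A X P (slice b) a r,
    b_value iota m B X P (coslice a) b r' & e = r / r'].
Proof.
move=> [Aa ra _] [Bb rb _].
move=> [E [D1 [D0 [D1' [D0' [f [f' [r [r' []]]]]]]]]].
move=> [dE EP] [av1 av2 av3 av4] [p1 p0 p1' p0'] [Rf Ef Rf' Ef'] [vf vf' ->].
exists r, r'; split=> //.
(* The two sides evaluate E at the same four points, with the roles of (a, o') and (o, b)
   exchanged. *)
- exact: (weil_side hA (slice_morphism hA hB Bb rb) (slice_morphism hA hB B0 rB0)
    slice_zero dE EP av1 av3 av2 av4 Aa p1 p0 Rf Ef vf).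
- exact: (weil_side hB' (coslice_morphism hA hB Aa ra) (coslice_morphism hA hB A0 rA0)
    coslice_zero dE EP av1 av2 av3 av4 Bb p1' p0' Rf' Ef' vf').
Qed.

Lemma weil_value_ex a b : torsion_point iota A m a -> torsion_point iota B m b ->
  exists e, weil_value iota m A B P a b e.
Proof.
move=> ta tb; have [[Aa ra _] [Bb rb _]] := (ta, tb).
have [|E [dE EP av]] := moving_lemma irrX clX (D := P)
    (qs := [:: seg a b; seg a o'; seg o b; seg o o']) dP.
  move=> q; rewrite !inE => /or4P [] /eqP ->; split; try exact: seg_rational;
    [by exists a, b|by exists a, o'|by exists o, b|by exists o, o'].
have av1 : avoids X E (seg a b) by apply: av; rewrite !inE eqxx.
have av2 : avoids X E (seg a o') by apply: av; rewrite !inE eqxx !orbT.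
have av3 : avoids X E (seg o b) by apply: av; rewrite !inE eqxx !orbT.
have av4 : avoids X E (seg o o') by apply: av; rewrite !inE eqxx !orbT.
have [D1 [D0 [f [r [p1 p0 Rf Ef vf]]]]] := weil_side_ex hA (slice_morphism hA hB Bb rb)
  (slice_morphism hA hB B0 rB0) slice_zero dE EP av1 av3 av2 av4 Aa ra
  (fun D => slice_torsion tb).
have [D1' [D0' [f' [r' [p1' p0' Rf' Ef' vf']]]]] := weil_side_ex hB'
  (coslice_morphism hA hB Aa ra) (coslice_morphism hA hB A0 rA0) coslice_zero
  dE EP av1 av2 av3 av4 Bb rb (fun D => coslice_torsion ta).
by exists (r / r'), E, D1, D0, D1', D0', f, f', r, r'; split.
Qed.

Lemma b_pairing_weil a b : torsion_point iota A m a -> torsion_point iota B m b ->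
  eq_mod_powers m (b_pairing iota m A B P a b)
    (weil_pairing iota m A B P a b * b'_pairing iota m A B P b a).
Proof.
move=> ta tb; have [[Aa ra _] [Bb rb _]] := (ta, tb).
have we : weil_value iota m A B P a b (weil_pairing iota m A B P a b).
  by apply: epsilon_spec; apply: weil_value_ex.
have [r [r' [br br' ->]]] := weil_value_sides ta tb we.
have r0 := b_value_neq0 br; have r'0 := b_value_neq0 br'.
have bb := b_pairing_value Aa ra Bb rb (fun D => slice_torsion tb).
have bb' := b'_pairing_value Bb rb ta.
have e1 := b_value_uniq hA irrX dP (slice_morphism hA hB Bb rb) Aa ra bb br.
have e2 := b_value_uniq hB' irrX dP (coslice_morphism hA hB Aa ra) Bb rb br' bb'.
apply: (eq_mod_powers_trans e1).
(* The chosen Weil value is the quotient r / r', so r is this value times r', and r' agrees with the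
   chosen value of b' up to m-th powers. *)
rewrite -[X in eq_mod_powers m X _](divfK r'0 r); apply: eq_mod_powers_mul => //.
by apply: eq_mod_powers_refl; rewrite mulf_neq0 ?invr_eq0.
Qed.

End Pairing.

Theorem theorem3p2 (k : fieldType) (K : closedFieldType)
    (iota : {rmorphism k -> K}) (iota_alg : forall z : K, algebraicOver iota z)
    (m : nat) (m_gt0 : (0 < m)%N)
    (m_char : forall p : nat, p \in [pchar k] -> ~~ (p %| m)%N)
    (n n' : nat) (A : group_data K n) (A' : group_data K n')
    (P : divisor k K (n * n'))
    (hA : abelian_variety iota A) (hA' : dual_abelian_variety iota A A' P) :
  [/\ (* (i) *)
      forall a a1' a2',
        torsion_point iota A m a ->
        torsion_point iota A' m a1' -> torsion_point iota A' m a2' ->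
        eq_mod_powers m
          (b_pairing iota m A A' P a (add_pt A' a1' a2'))
          (b_pairing iota m A A' P a a1' * b_pairing iota m A A' P a a2'),
      (* (ii) *)
      forall a1 a2 a',
        torsion_point iota A m a1 -> torsion_point iota A m a2 ->
        torsion_point iota A' m a' ->
        eq_mod_powers m
          (b_pairing iota m A A' P (add_pt A a1 a2) a')
          (b_pairing iota m A A' P a1 a' * b_pairing iota m A A' P a2 a')
    & (* (iii) *)
      forall a a',
        torsion_point iota A m a -> torsion_point iota A' m a' ->
        eq_mod_powers m
          (b_pairing iota m A A' P a a')
          (weil_pairing iota m A A' P a a' * b'_pairing iota m A A' P a' a)].
Proof.
split.
- by move=> a b1 b2; apply: b_pairing_addr.
- by move=> a1 a2 b; apply: b_pairing_addl.
- by move=> a b; apply: b_pairing_weil.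
Qed.
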